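(* Assume $n r_n^d\to\lambda\in(0,\infty]$ as $n\to\infty$, and in the case $\lambda=\infty$ assume moreover that $f$ is lower bounded and $\mathrm{supp}(f)$ is convex. Let $1\le k\le d$. Then \[ \lim_{n\to\infty}n^{-1}\mathbb{E}\{N_{k,n}\}=\gamma_k(\lambda)\quad\text{and}\quad\lim_{n\to\infty}n^{-1}\mathbb{E}\{\widehat N_{k,n}\}=\gamma_k(\lambda), \] where, for $\lambda\in(0,\infty)$, \[ \gamma_k(\lambda)=\frac{\lambda^k}{(k+1)!}\int_{\mathbb{R}^d}\int_{(\mathbb{R}^d)^{k}}f^{k+1}(x)\,h_1(0,\mathbf{y})\,e^{-\lambda\omega_d R^d(0,\mathbf{y})f(x)}\,d\mathbf{y}\,dx, \] and \[ \gamma_k(\infty)=\lim_{\lambda\to\infty}\gamma_k(\lambda)=\frac{1}{(k+1)!}\int_{(\mathbb{R}^d)^k}h(0,\mathbf{y})\,e^{-\omega_d R^d(0,\mathbf{y})}\,d\mathbf{y}. \]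
   Context: Fix $d\ge1$. Let $f$ be a bounded probability density on $\mathbb{R}^d$. $f$ is called lower bounded if it has compact support and $\inf\{f(x):x\in\mathrm{supp}(f)\}>0$. For each $n$, $\mathcal{X}_n=\{X_1,\dots,X_n\}$ where $X_1,X_2,\dots$ are i.i.d. with density $f$, and $\mathcal{P}_n$ is a Poisson point process on $\mathbb{R}^d$ with intensity function $nf$. $(r_n)_{n\ge1}$ is a sequence of positive numbers with $r_n\to0$. For a finite set $\mathcal{P}\subset\mathbb{R}^d$ let $d_{\mathcal{P}}(x)=\min_{p\in\mathcal{P}}\|x-p\|$. For a set $\mathcal{Y}$ of $k+1$ affinely independent points of $\mathbb{R}^d$, $C(\mathcal{Y})$ is the center and $R(\mathcal{Y})$ the radius of the unique $(k-1)$-dimensional sphere containing $\mathcal{Y}$, and $\mathrm{conv}^\circ(\mathcal{Y})$ is the interior of the convex hull of $\mathcal{Y}$ (an open $k$-simplex). For $1\le k\le d$, a point $c\in\mathbb{R}^d$ is a critical point of index $k$ of $d_{\mathcal{P}}$ if there is a subset $\mathcal{Y}\subset\mathcal{P}$ of $k+1$ affinely independent points with $\|c-y\|=d_{\mathcal{P}}(c)$ for all $y\in\mathcal{Y}$, $\|c-p\|>d_{\mathcal{P}}(c)$ for all $p\in\mathcal{P}\setminus\mathcal{Y}$, and $c\in\mathrm{conv}^\circ(\mathcal{Y})$. $N_{k,n}$ is the number of critical points $c$ of index $k$ of $d_{\mathcal{X}_n}$ with $d_{\mathcal{X}_n}(c)\le r_n$, and $\widehat N_{k,n}$ the same for $d_{\mathcal{P}_n}$.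 For $\mathbf{y}=(y_1,\dots,y_k)\in(\mathbb{R}^d)^k$, write $R(0,\mathbf{y})=R(\{0,y_1,\dots,y_k\})$; $h(0,\mathbf{y})=1$ if $\mathcal{Y}=\{0,y_1,\dots,y_k\}$ consists of $k+1$ affinely independent points with $C(\mathcal{Y})\in\mathrm{conv}^\circ(\mathcal{Y})$, and $0$ otherwise; $h_1(0,\mathbf{y})=h(0,\mathbf{y})\mathbf{1}\{R(0,\mathbf{y})\le1\}$. $\omega_d$ is the volume of the unit ball in $\mathbb{R}^d$. *)

(* Defs.v *)
From HB Require Import structures.
From mathcomp Require Import all_boot all_order all_algebra.
From mathcomp Require Import all_classical all_reals all_analysis.
Set Implicit Arguments. Unset Strict Implicit. Unset Printing Implicit Defensive.
Import Order.TTheory GRing.Theory Num.Theory.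
Import numFieldNormedType.Exports.
Local Open Scope classical_set_scope.
Local Open Scope ring_scope.

Section Defs.
Variable R : realType.

Definition edist (d : nat) (x y : 'rV[R]_d) : R :=
  Num.sqrt (\sum_(i < d) (x 0 i - y 0 i) ^+ 2).

Fixpoint iint (m : nat) (F : (nat -> R) -> \bar R) : \bar R :=
  match m with
  | 0 => F (fun _ => 0)
  | m'.+1 => (\int[@lebesgue_measure R]_(x in setT)
                iint m' (fun s => F (fun j => if j is j'.+1 then s j' else x)))%E
  end.

Definition intRd (d : nat) (g : 'rV[R]_d -> \bar R) : \bar R :=
  iint d (fun s => g (\row_(j < d) s j)).

Definition intRdm (m d : nat) (G : ('I_m -> 'rV[R]_d) -> \bar R) : \bar R :=
  iint (m * d) (fun s => G (fun i => \row_(j < d) s (i * d + j)%N)).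

Definition omega (d : nat) : R :=
  fine (intRd (fun x : 'rV[R]_d => (if edist x 0 <= 1 then 1 else 0)%:E)).

Definition borel_measurable (d : nat) (f : 'rV[R]_d -> R) : Prop :=
  forall U : set R, open U -> <<s (@open 'rV[R]_d) >> (f @^-1` U).

Definition bounded_density (d : nat) (f : 'rV[R]_d -> R) : Prop :=
  borel_measurable f /\ (forall x, 0 <= f x) /\ (exists M : R, forall x, f x <= M)
  /\ intRd (fun x => (f x)%:E) = 1%E.

Definition supp (d : nat) (f : 'rV[R]_d -> R) : set 'rV[R]_d :=
  closure [set x | 0 < f x].

Definition lower_bounded (d : nat) (f : 'rV[R]_d -> R) : Prop :=
  compact (supp f) /\ exists c : R, 0 < c /\ forall x, supp f x -> c <= f x.

Definition aff_indep (d k : nat) (y : 'I_k.+1 -> 'rV[R]_d) : Prop :=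
  \rank (\matrix_(i < k) (y (lift ord0 i) - y ord0)) = k.

Definition in_open_simplex (d k : nat) (y : 'I_k.+1 -> 'rV[R]_d) (c : 'rV[R]_d) :
  Prop :=
  exists t : 'I_k.+1 -> R, (forall i, 0 < t i) /\ \sum_i t i = 1 /\
    c = \sum_i t i *: y i.

Definition in_aff_hull (d k : nat) (y : 'I_k.+1 -> 'rV[R]_d) (c : 'rV[R]_d) :
  Prop :=
  exists t : 'I_k.+1 -> R, \sum_i t i = 1 /\ c = \sum_i t i *: y i.

(* C(Y): center of the unique (k-1)-sphere through Y, i.e. the point of the
   affine hull of Y equidistant from all points of Y (unique for affinely
   independent Y); R(Y) its radius. *)
Definition circumcenter (d k : nat) (y : 'I_k.+1 -> 'rV[R]_d) : 'rV[R]_d :=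
  xget 0 [set c | in_aff_hull y c /\ forall i j, edist c (y i) = edist c (y j)].

Definition circumradius (d k : nat) (y : 'I_k.+1 -> 'rV[R]_d) : R :=
  edist (circumcenter y) (y ord0).

Definition with0 (d k : nat) (y : 'I_k -> 'rV[R]_d) : 'I_k.+1 -> 'rV[R]_d :=
  fun i => match unlift ord0 i with None => 0 | Some j => y j end.

Definition h (d k : nat) (y : 'I_k -> 'rV[R]_d) : R :=
  if `[< aff_indep (with0 y) /\ in_open_simplex (with0 y) (circumcenter (with0 y)) >]
  then 1 else 0.

Definition R0 (d k : nat) (y : 'I_k -> 'rV[R]_d) : R := circumradius (with0 y).

Definition h1 (d k : nat) (y : 'I_k -> 'rV[R]_d) : R :=
  h y * (if R0 y <= 1 then 1 else 0).

Definition is_dP (d : nat) (P : seq 'rV[R]_d) (c : 'rV[R]_d) (rho : R) : Prop :=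
  (exists2 p, p \in P & edist c p = rho) /\ (forall p, p \in P -> rho <= edist c p).

Definition critical (d k : nat) (P : seq 'rV[R]_d) (c : 'rV[R]_d) (rho : R) : Prop :=
  is_dP P c rho /\
  exists y : 'I_k.+1 -> 'rV[R]_d,
    injective y /\ (forall i, y i \in P) /\ aff_indep y /\
    (forall i, edist c (y i) = rho) /\
    (forall p, p \in P -> (forall i, p != y i) -> rho < edist c p) /\
    in_open_simplex y c.

Definition Ncrit (d k : nat) (r : R) (P : seq 'rV[R]_d) : \bar R :=
  (\esum_(c in [set c | exists rho, critical k P c rho /\ (rho <= r)%R]) 1)%E.

Definition ENbin (d k : nat) (f : 'rV[R]_d -> R) (r : R) (m : nat) : \bar R :=
  intRdm (fun x : 'I_m -> 'rV[R]_d =>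
    (Ncrit k r [seq x i | i <- enum 'I_m] * (\prod_(i < m) f (x i))%:E)%E).

(* E{N} for a Poisson process with intensity n f (f a probability density):
   Poisson(n) many i.i.d. points with density f. *)
Definition ENpois (d k : nat) (f : 'rV[R]_d -> R) (r : R) (n : nat) : \bar R :=
  (\sum_(m <oo) ((expR (- n%:R) * n%:R ^+ m / (m`!)%:R)%:E * ENbin k f r m))%E.

Definition gamma_fin (d k : nat) (f : 'rV[R]_d -> R) (lam : R) : \bar R :=
  ((lam ^+ k / (k.+1)`!%:R)%:E *
   intRd (fun x => intRdm (fun y : 'I_k -> 'rV[R]_d =>
     (f x ^+ k.+1 * h1 y * expR (- (lam * omega d * R0 y ^+ d * f x)))%:E)))%E.

Definition gamma_inf (d k : nat) : \bar R :=
  (((k.+1)`!%:R)^-1%:E *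
   intRdm (fun y : 'I_k -> 'rV[R]_d => (h y * expR (- (omega d * R0 y ^+ d)))%:E))%E.

Definition gamma (d k : nat) (f : 'rV[R]_d -> R) (lam : \bar R) : \bar R :=
  match lam with
  | EFin l => gamma_fin k f l
  | _ => gamma_inf d k
  end.

End Defs.

(* Main.v *)
(** Summing over the k+1 points spanning a critical simplex (exchangeability for the sample,
    the Poisson sum for the point process) expresses the mean count as a combinatorial factor
    times an integral of prod f(x_i) Q_n(p) over the simplices containing their circumcenter,
    of circumradius at most r_n, where p is the f-mass of the circumscribed ball and
    Q_n(p) = (1 - p)^(n-k-1), resp. exp(- n p); both laws satisfy Q_n(p) = exp(- n p) + o(1).
    After the substitution x_i = x + a_n y_i, with a_n = r_n if lam is finite and
    a_n = n^(-1/d) otherwise, the integral over x converges for each fixed y because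
    translations are continuous in L1; no Lebesgue point argument is needed.  Dominated
    convergence in y concludes: the y_i are bounded when lam is finite; when lam is infinite,
    convexity of the support puts the circumcenter in it and bounds p below by a constant
    times the volume of the ball, so that the integrand decays exponentially. *)
From Pilot Require Import Defs.
From HB Require Import structures.
From mathcomp Require Import all_boot all_order all_algebra.
From mathcomp Require Import fingroup perm.
From mathcomp Require Import all_classical all_reals all_analysis.
From mathcomp Require Import measurable_realfun ring lra.
Set Implicit Arguments. Unset Strict Implicit. Unset Printing Implicit Defensive.
Import Order.TTheory GRing.Theory Num.Theory.
Import numFieldNormedType.Exports.
Local Open Scope classical_set_scope.
Local Open Scope ring_scope.
Local Notation edist := Pilot.Defs.edist.

(** * Iterated Lebesgue integrals as integrals over sequences *)

(** The integrand of a mean count contains [Ncrit], which is defined through existence conditions.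
    Two devices make it tractable: Cramer's rule gives the circumcenter by a formula rational in the
    coordinates, and off the null set of samples with ties the count is a finite sum of measurable
    indicators. After rescaling, n p is n a_n^d times the integral of f over a fixed ball seen from
    x at scale a_n. As f is bounded, n p stays in a bounded range, so an o(1) that is uniform there
    is enough. As exp(-t) is 1-Lipschitz for t >= 0, the remaining error is linear in the
    differences between f and its translates, and Tonelli's theorem turns its integral over x into
    L1 norms of such differences. The constants come from a homothety of the simplex whose ratio c
    satisfies c^d = f(x), or c^d = lam f(x). It absorbs the k-th power of that number. Without a
    radius constraint the inner integral no longer depends on x; with one, lam survives only in a
    cutoff on the radius, which gives the limit of gamma at infinity. *)

Definition coord_sets (R : realType) : set (set (nat -> R)) :=
  \bigcup_i preimage_set_system setT (fun s : nat -> R => s i) measurable.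

Definition rseq (R : realType) := g_sigma_algebraType (@coord_sets R).

Definition scons (R : realType) (x : R) (s : nat -> R) : nat -> R :=
  fun j => if j is j'.+1 then s j' else x.

Section rseq_measurable.
Variable R : realType.

Lemma measurable_coord i : measurable_fun setT (fun s : rseq R => s i : R).
Proof.
move=> _ Y mY; rewrite setTI; apply: sub_sigma_algebra; exists i => //; exists Y => //.
by rewrite setTI.
Qed.

Lemma measurable_into d (T : measurableType d) (g : T -> rseq R) :
  (forall i, measurable_fun setT (fun t => g t i : R)) -> measurable_fun setT g.
Proof.
move=> mg; refine (@measurability _ _ T (rseq R) setT g (@coord_sets R) erefl _).
move=> _ [_ [i _ [Y mY <-]] <-]; rewrite !setTI -[X in measurable X]setTI.
exact: mg.
Qed.

Lemma measurable_scons :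
  measurable_fun setT (fun p : R * rseq R => scons p.1 p.2 : rseq R).
Proof.
apply: measurable_into => -[|i]/=; first exact: measurable_fst.
by apply: (measurableT_comp (measurable_coord i)); exact: measurable_snd.
Qed.

Lemma measurable_sconsl (x : R) :
  measurable_fun setT (scons x : rseq R -> rseq R).
Proof.
apply: measurable_into => -[|i]/=; first exact: measurable_cst.
exact: measurable_coord.
Qed.

Lemma measurable_sconsr (s : rseq R) :
  measurable_fun setT (fun x : R => scons x s : rseq R).
Proof. by apply: measurable_into => -[|i]//=; exact: measurable_cst. Qed.

Lemma measurable_uncons : measurable_fun setT
  (fun s : rseq R => (s 0%N : R, (fun j => s j.+1) : rseq R)).
Proof.
apply/measurable_fun_pair => /=; first exact: measurable_coord.
by apply: measurable_into => i; exact: measurable_coord.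
Qed.

Definition scons2 (p : R * rseq R) : rseq R := scons p.1 p.2.
End rseq_measurable.

Section lebs_step.
Variable R : realType.
Local Open Scope ereal_scope.
Local Notation mu := (@lebesgue_measure R).

Variable m : {sigma_finite_measure set (rseq R) -> \bar R}.

Definition lebs_step : set (rseq R) -> \bar R := pushforward (mu \x m)%E (@scons2 R).

Let pm : {measure set (rseq R) -> \bar R} :=
  measure_function_pushforward__canonical__measure_function_Measure
    (mu \x m)%E (@measurable_scons R).

HB.instance Definition _ := isMeasure.Build _ _ _ lebs_step
  (measure0 pm) (measure_ge0 pm) (@measure_semi_sigma_additive _ _ _ pm).

(** Prepending a coordinate is inverted by splitting it off, so the rectangles exhausting the
    product pull back to sets whose mass is again a product of two finite masses. *)
Let lebs_step_sigma_finite : sigma_finite setT lebs_step.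
Proof.
have /sigma_finiteP[F [TF ndF Foo]] := sigma_finiteT mu.
have /sigma_finiteP[G [TG ndG Goo]] := sigma_finiteT m.
pose u (s : rseq R) : R * rseq R := (s 0%N, fun j => s j.+1).
exists (fun n => u @^-1` (F n `*` G n)).
  apply/esym; rewrite -subTset => s _.
  have [i _ Fi] : (\bigcup_i F i) (s 0%N) by rewrite -TF.
  have [j _ Gj] : (\bigcup_i G i) ((fun j => s j.+1) : rseq R) by rewrite -TG.
  exists (maxn i j) => //; split => /=.
  - by move: Fi; exact/subsetPset/ndF/leq_maxl.
  - by move: Gj; exact/subsetPset/ndG/leq_maxr.
move=> k; have [mF Fk] := Foo k; have [mG Gk] := Goo k; split.
  rewrite -[X in measurable X]setTI; apply: (@measurable_uncons R) => //.
  exact: measurableX.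
rewrite /lebs_step /pushforward -comp_preimage.
rewrite (_ : u \o _ = id); last by apply/funext => -[].
by rewrite preimage_id product_measure1E// lte_mul_pinfty// ge0_fin_numE.
Qed.

HB.instance Definition _ := Measure_isSigmaFinite.Build _ _ _ lebs_step
  lebs_step_sigma_finite.
End lebs_step.

Section lebs.
Variable R : realType.
Local Open Scope ereal_scope.
Local Notation mu := (@lebesgue_measure R).

(* Lebesgue measure on the first n coordinates, the others being set to 0: all dimensions
   live on the single measurable type rseq R, and lebs n represents iint n. *)
Fixpoint lebs (n : nat) : {sigma_finite_measure set (rseq R) -> \bar R} :=
  match n with
  | 0%N => @dirac _ (rseq R) (fun=> 0%R) R
  | n'.+1 => lebs_step (lebs n')
  end.

Lemma integral_lebs0 (F : (nat -> R) -> \bar R) :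
  measurable_fun setT (F : rseq R -> \bar R) ->
  \int[lebs 0]_s F s = F (fun=> 0%R).
Proof. by move=> mF; rewrite integral_dirac// diracT mul1e. Qed.

Lemma integral_lebsS n (F : (nat -> R) -> \bar R) :
  measurable_fun setT (F : rseq R -> \bar R) -> (forall s, 0 <= F s) ->
  \int[lebs n.+1]_s F s = \int[mu]_x \int[lebs n]_s F (scons x s).
Proof.
move=> mF F0 /=.
rewrite ge0_integral_pushforward//; last exact: measurable_scons.
rewrite preimage_setT fubini_tonelli1//.
  by apply: measurableT_comp => //; exact: measurable_scons.
by move=> x; exact: F0.
Qed.

Lemma iint_lebs n (F : (nat -> R) -> \bar R) :
  measurable_fun setT (F : rseq R -> \bar R) -> (forall s, 0 <= F s) ->
  iint n F = \int[lebs n]_s F s.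
Proof.
elim: n F => [|n IH] F mF F0; first by rewrite integral_lebs0.
rewrite integral_lebsS//=; apply: eq_integral => x _.
apply: IH => //; exact: (measurableT_comp mF (measurable_sconsl x)).
Qed.

Lemma iint_ge0 n (F : (nat -> R) -> \bar R) : (forall s, 0 <= F s) -> 0 <= iint n F.
Proof. by elim: n F => [|n IH] F F0 //=; apply: integral_ge0 => x _; exact: IH. Qed.

Import HBNNSimple.

(** The integral of a nonnegative function is a supremum over the simple functions below it, so
    monotonicity holds for arbitrary functions. This gives a hold on integrands that contain
    [Ncrit]. *)
Lemma le_integral_nomeas d (T : measurableType d) (m : {measure set T -> \bar R})
    (f g : T -> \bar R) :
  (forall x, 0 <= f x) -> (forall x, f x <= g x) -> \int[m]_x f x <= \int[m]_x g x.
Proof.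
move=> f0 fg; rewrite !ge0_integralTE//; last by move=> x; exact: le_trans (fg x).
apply: le_ereal_sup => _ [h hf <-]; exists h => // x.
exact: le_trans (fg x).
Qed.

Lemma le_iint n (F G : (nat -> R) -> \bar R) : (forall s, 0 <= F s) ->
  (forall s, F s <= G s) -> iint n F <= iint n G.
Proof.
elim: n F G => [|n IH] F G F0 FG //=; apply: le_integral_nomeas => x.
  exact: iint_ge0.
exact: IH.
Qed.

Definition scat (m : nat) (s t : nat -> R) : nat -> R :=
  fun j => if (j < m)%N then s j else t (j - m)%N.

(** Both sides are the same nested integrals, for an arbitrary integrand; [scat] only regroups the
    coordinates. *)
Lemma iint_add m n (F : (nat -> R) -> \bar R) :
  iint (m + n) F = iint m (fun s => iint n (fun t => F (scat m s t))).
Proof.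
elim: m F => [|m IH] F /=.
  by congr iint; apply/funext => t; congr F; apply/funext => j; rewrite /scat subn0.
apply: eq_integral => x _; rewrite IH; congr iint; apply/funext => s.
congr iint; apply/funext => t; congr F; apply/funext => -[|j]//=.
Qed.

End lebs.

(** * Affine substitutions *)

Section affine.
Variable R : realType.
Local Open Scope ereal_scope.
Local Notation mu := (@lebesgue_measure R).

Lemma measurable_affine1 (a c : R) : measurable_fun setT (fun x : R => (a + c * x)%R).
Proof. by apply: measurable_funD => //; exact: measurable_funM. Qed.

(** By uniqueness of Lebesgue measure: c times its image under x -> a + c x agrees with it on
    half-open intervals. *)
Lemma integral_affine1 (a c : R) (g : R -> \bar R) : (0 < c)%R ->
  measurable_fun setT g -> (forall x, 0 <= g x) ->
  c%:E * \int[mu]_x g (a + c * x)%R = \int[mu]_x g x.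
Proof.
move=> c0 mg g0.
pose phi : measurableTypeR R -> measurableTypeR R := fun x => (a + c * x)%R.
have mphi : measurable_fun setT phi by exact: measurable_affine1.
pose nu : {measure set (measurableTypeR R) -> \bar R} :=
  measure_function_pushforward__canonical__measure_function_Measure mu mphi.
have c0' : (0 <= c)%R by exact: ltW.
pose nu' : {measure set (measurableTypeR R) -> \bar R} := mscale (NngNum c0') nu.
have muE A : measurable A -> mu A = nu' A.
  apply: lebesgue_measure_unique => _ [[x y] _ <-] /=.
  rewrite /mscale/= /pushforward.
  have -> : phi @^-1` `]x, y] = `]((x - a) / c)%R, ((y - a) / c)%R]%classic.
    apply/seteqP; split => z; rewrite /phi /= !in_itv/= ltr_pdivrMr// ler_pdivlMr//
      ltrBlDl lerBrDl (mulrC z); exact.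
  rewrite !lebesgue_measure_itv/= !lte_fin ltr_pM2r ?invr_gt0// ltrD2r.
  case: ifPn => _; last by rewrite mule0.
  by rewrite -EFinD -EFinM; congr EFin; field; rewrite gt_eqF.
rewrite [RHS](eq_measure_integral nu'); last by move=> A mA _; exact: muE.
rewrite [RHS]ge0_integral_mscale//; congr (_ * _).
by rewrite ge0_integral_pushforward.
Qed.

(** F reads only the coordinates below n. Under [lebs n] the others are frozen at 0, and an affine
    map would move them; for such F this is harmless. *)
Definition dep (T : Type) n (F : (nat -> R) -> T) :=
  forall s t, (forall j, (j < n)%N -> s j = t j) -> F s = F t.

Lemma measurable_affine (a : nat -> R) (c : R) :
  measurable_fun setT (fun s : rseq R => (fun j => (a j + c * s j)%R) : rseq R).
Proof.
apply: measurable_into => i.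
exact: (measurableT_comp (measurable_affine1 _ _) (@measurable_coord R i)).
Qed.

Lemma integral_affine n (a : nat -> R) (c : R) (F : (nat -> R) -> \bar R) :
  (0 < c)%R -> dep n F ->
  measurable_fun setT (F : rseq R -> \bar R) -> (forall s, 0 <= F s) ->
  (c ^+ n)%:E * \int[lebs R n]_s F (fun j => (a j + c * s j)%R) = \int[lebs R n]_s F s.
Proof.
move=> c0; elim: n a F => [|n IH] a F dF mF F0.
  rewrite mul1e !integral_lebs0//; last exact: (measurableT_comp mF (measurable_affine _ _)).
  exact: dF.
rewrite !integral_lebsS//; last exact: (measurableT_comp mF (measurable_affine _ _)).
have mFx : measurable_fun setT (fun x => \int[lebs R n]_s F (scons x s)).
  have := @measurable_fun_fubini_tonelli_F _ _ _ _ _ (lebs R n) (F \o @scons2 R).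
  by apply; [exact: (measurableT_comp mF (@measurable_scons R))|move=> x; exact: F0].
rewrite -[RHS](integral_affine1 (a 0%N) c0)//; last by move=> x; exact: integral_ge0.
rewrite exprS EFinM -muleA; congr (_ * _).
rewrite -ge0_integralZl//; first last.
- by rewrite lee_fin exprn_ge0// ltW.
- by move=> x _; apply: integral_ge0.
- have := @measurable_fun_fubini_tonelli_F _ _ _ _ _ (lebs R n)
    ((fun s : rseq R => F (fun j => (a j + c * s j)%R)) \o @scons2 R).
  apply; last by move=> x; exact: F0.
  apply: (@measurableT_comp _ _ _ _ _ _ (fun s : rseq R => F (fun j => (a j + c * s j)%R))).
    exact: (measurableT_comp mF (measurable_affine _ _)).
  exact: measurable_scons.
apply: eq_integral => x _.
rewrite -[RHS](IH (fun j => a j.+1))//; last first.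
- exact: (measurableT_comp mF (measurable_sconsl _)).
- by move=> s t st; apply: dF => -[|j]//=; exact: st.
congr (_ * _); apply: eq_integral => s _; congr F; apply/funext => -[|j]//.
Qed.

End affine.

(** * Continuity of translations in L1 *)

Section L1.
Local Open Scope ereal_scope.

Lemma cvge0P (R : realType) (u : nat -> \bar R) : (forall n, 0 <= u n) ->
  u n @[n --> \oo] --> 0 <->
  forall e : R, (0 < e)%R -> \forall n \near \oo, u n <= e%:E.
Proof.
move=> u0; split => [/fine_cvgP[ufin /cvgrPdist_le uc] e e0|H].
  near=> n; have fn : u n \is a fin_num by near: n.
  rewrite -(fineK fn) lee_fin; apply: le_trans (ler_norm _) _.
  rewrite -normrN -sub0r; near: n; exact: uc.
apply/fine_cvgP; split.
  apply: filterS (H 1%R ltr01) => n un.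
  by rewrite ge0_fin_numE// (le_lt_trans un)// ltry.
apply/cvgrPdist_le => e e0; apply: filterS (H e e0) => n un /=.
have fn : u n \is a fin_num by rewrite ge0_fin_numE// (le_lt_trans un)// ltry.
by rewrite sub0r normrN ger0_norm ?fine_ge0// -lee_fin fineK.
Unshelve. all: by end_near. Qed.

(** Dominated convergence to 0, with the pointwise limit required only where the bound is finite,
    which is almost everywhere. When the bound is a fibre integral, these are the fibres on which
    continuity of translations is available. *)
Lemma cvg_integral0 d (T : measurableType d) (R : realType)
    (m : {measure set T -> \bar R}) (a : nat -> T -> \bar R) (b : T -> \bar R) :
  (forall n, measurable_fun setT (a n)) -> measurable_fun setT b ->
  (forall n x, 0 <= a n x) -> (forall n x, a n x <= b x) ->
  \int[m]_x b x < +oo ->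
  (forall x, b x < +oo -> a n x @[n --> \oo] --> 0) ->
  \int[m]_x a n x @[n --> \oo] --> 0.
Proof.
move=> ma mb a0 ab boo acvg.
have b0 x : 0 <= b x by exact: le_trans (ab 0%N x).
have ib : m.-integrable setT b.
  apply/integrableP; split => //.
  by under eq_integral => x _ do rewrite gee0_abs//.
have [] := @dominated_convergence _ _ _ m setT measurableT a (cst 0) b.
- exact: ma.
- exact: measurable_cst.
- have := integrable_ae measurableT ib; apply: filterS => x /(_ I) bx _.
  by apply: acvg; rewrite -ge0_fin_numE.
- exact: ib.
- by apply: aeW => x n _; rewrite gee0_abs.
by move=> _ _; rewrite integral0.
Qed.

Lemma integral_dist_triangle d (T : measurableType d) (R : realType)
    (m : {measure set T -> \bar R}) (f g h : T -> R) :
  measurable_fun setT f -> measurable_fun setT g -> measurable_fun setT h ->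
  \int[m]_x (`|f x - h x|)%:E <=
  \int[m]_x (`|f x - g x|)%:E + \int[m]_x (`|g x - h x|)%:E.
Proof.
move=> mf mg mh.
rewrite -ge0_integralD//=; first last.
- by apply/measurable_EFinP; apply: measurableT_comp => //; exact: measurable_funB.
- by apply/measurable_EFinP; apply: measurableT_comp => //; exact: measurable_funB.
by apply: le_integral_nomeas => x; rewrite ?lee_fin -?EFinD ?lee_fin ?ler_distD.
Qed.

Lemma integral_dist_le d (T : measurableType d) (R : realType)
    (m : {measure set T -> \bar R}) (f g : T -> R) :
  measurable_fun setT f -> measurable_fun setT g ->
  (forall x, 0 <= f x)%R -> (forall x, 0 <= g x)%R ->
  \int[m]_x (`|f x - g x|)%:E <= \int[m]_x (f x)%:E + \int[m]_x (g x)%:E.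
Proof.
move=> mf mg f0 g0.
rewrite -ge0_integralD//=; [|by move=> x _; rewrite lee_fin|exact/measurable_EFinP
  |by move=> x _; rewrite lee_fin|exact/measurable_EFinP].
apply: le_integral_nomeas => x; rewrite ?lee_fin -?EFinD ?lee_fin//.
by rewrite (le_trans (ler_normB _ _))// !ger0_norm.
Qed.

(** Approximation of g in L1 by a continuous G vanishing off a bounded interval. The translation
    error of g is at most that of G plus twice the L1 distance from g to G, since Lebesgue measure
    is translation invariant; that of G vanishes by dominated convergence. *)
Lemma translation_L1_1 (R : realType) (g : R -> R) (h : nat -> R) :
  measurable_fun setT g -> (forall x, 0 <= g x)%R ->
  \int[@lebesgue_measure R]_x (g x)%:E < +oo ->
  h n @[n --> \oo] --> 0%R ->
  \int[@lebesgue_measure R]_x (`|g (h n + x) - g x|)%:E @[n --> \oo] --> 0.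
Proof.
set mu := @lebesgue_measure R => mg g0 goo h0.
have tail : \int[mu]_x (g x * \1_(~` `[(- n%:R)%R, n%:R%R]) x)%:E @[n --> \oo] --> 0.
  apply: (@cvg_integral0 _ (measurableTypeR R) R mu _ (EFin \o g)) => //.
  - move=> n; apply/measurable_EFinP; apply: measurable_funM => //.
    by apply: measurable_indic; exact: measurableC.
  - exact/measurable_EFinP.
  - by move=> n x; rewrite lee_fin mulr_ge0.
  - move=> n x; rewrite lee_fin ler_piMr// indicE; by case: (_ \in _).
  - move=> x _; apply: cvg_near_cst.
    apply: filterS (nbhs_infty_ger `|x|) => n xn.
    by rewrite indicE memNset ?mulr0//= in_itv/= -ler_norml xn; exact.
have close (e : R) : (0 < e)%R -> exists G : R -> R,
   [/\ measurable_fun setT G, \int[mu]_x (`|g x - G x|)%:E <= e%:E &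
     \int[mu]_x (`|G (h n + x) - G x|)%:E @[n --> \oo] --> 0].
  move=> e0.
  have e20 : (0 < e / 2)%R by rewrite divr_gt0.
  have tail0 n : 0 <= \int[mu]_x (g x * \1_(~` `[(- n%:R)%R, n%:R%R]) x)%:E.
    by apply: integral_ge0 => x _; rewrite lee_fin mulr_ge0.
  have [N _ /(_ N (leqnn _)) tN] := (cvge0P tail0).1 tail _ e20.
  pose E := `[(- N.+1%:R)%R, N.+1%:R%R]%classic : set R.
  have mE : measurable E by exact: measurable_itv.
  have Eoo : mu E < +oo by rewrite /mu /E lebesgue_measure_itv/=; case: ifP => _; rewrite ltry.
  have ig : mu.-integrable E (EFin \o g).
    apply: (@integrableS _ _ _ mu setT) => //; apply/integrableP; split.
      exact/measurable_EFinP.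
    by under eq_integral => x _ do rewrite /= ger0_norm//.
  have [phi_ [cphi _ phig]] := approximation_continuous_integrable mE Eoo ig.
  have phi0 n : 0 <= \int[mu]_(x in E) `|(g x - phi_ n x)%:E|.
    exact: integral_ge0.
  have [n0 _ /(_ n0 (leqnn _)) pn] := (cvge0P phi0).1 phig _ e20.
  set phi := phi_ n0 in pn; have {}cphi : continuous phi by exact: cphi.
  (* N + 1 - |x| clamped to [0, 1] *)
  pose chi (x : R) := ((`|N.+1%:R - `|x| | - `|N.+1%:R - `|x| - 1| + 1) / 2 : R)%R.
  have chi01 x : (0 <= chi x <= 1)%R.
    rewrite /chi; set u := (N.+1%:R - _)%R.
    by case: (ger0P u); case: (ger0P (u - 1)%R) => ? ?; apply/andP; split; lra.
  have chi1 x : (`|x| <= N%:R -> chi x = 1)%R.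
    rewrite /chi -natr1 => xN; set u := (N%:R + 1 - _)%R.
    have u1 : (1 <= u)%R by rewrite /u; lra.
    by rewrite !ger0_norm; lra.
  have chi0 x : x \notin E -> chi x = 0%R.
    rewrite notin_setE /E /= in_itv/= -ler_norml => /negP; rewrite -ltNge => xN.
    rewrite /chi; set u := (N.+1%:R - _)%R.
    have u0 : (u < 0)%R by rewrite /u; lra.
    by rewrite !ltr0_norm; lra.
  have cchi : continuous chi.
    move=> x; apply: cvgM; last exact: cvg_cst.
    have c1 : (N.+1%:R - `|z|)%R @[z --> x] --> (N.+1%:R - `|x|)%R.
      by apply: cvgB; [exact: cvg_cst|exact: (@norm_continuous _ R)].
    apply: cvgD; last exact: cvg_cst.
    apply: cvgB; first exact: cvg_norm.
    by apply: cvg_norm; apply: cvgB => //; exact: cvg_cst.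
  pose G x := (phi x * chi x)%R.
  have cG : continuous G by move=> x; apply: continuousM; [exact: cphi|exact: cchi].
  have mG : measurable_fun setT G by exact: continuous_measurable_fun.
  exists G; split => //.
    apply: (@le_trans _ _ ((e/2)%:E + (e/2)%:E)); last by rewrite -EFinD -splitr.
    apply: (@le_trans _ _ (\int[mu]_x (g x * \1_(~` `[(- N%:R)%R, N%:R%R]) x)%:E +
       \int[mu]_(x in E) `|(g x - phi x)%:E|)); last exact: leeD.
    have mi : measurable_fun setT (fun x => (g x * \1_(~` `[(- N%:R)%R, N%:R%R]) x : R)%R).
      apply: measurable_funM => //; apply: measurable_indic; exact: measurableC.
    have mphi : measurable_fun setT phi by exact: continuous_measurable_fun.
    rewrite [X in _ + X]integral_mkcond -ge0_integralD//=; first last.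
    - apply/(measurable_restrictT _ _).1 => //; apply: measurable_funTS.
      by apply/measurable_EFinP; apply: measurableT_comp => //; exact: measurable_funB.
    - by move=> x _; rewrite patchE; case: ifP.
    - exact/measurable_EFinP.
    - by move=> x _; rewrite lee_fin mulr_ge0.
    apply: le_integral_nomeas => x; first by rewrite lee_fin.
    rewrite patchE; case: ifPn => [xE|xE].
      rewrite -EFinD lee_fin indicE /G; have /andP[c0 c1] := chi01 x.
      case: (boolP (x \in _)) => /= [xN|].
        (* The first summand is at most the tail of g, as 0 <= 1 - chi <= 1; the second is at most
           the error of the continuous approximation on E. *)
        rewrite mulr1 (_ : g x - _ = g x * (1 - chi x) + (g x - phi x) * chi x)%R; last by ring.
        apply: le_trans (ler_normD _ _) _; rewrite (normrM (g x)) (normrM (g x - phi x)%R) lerD//.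
          by rewrite ger0_norm// ler_piMr//; rewrite ger0_norm; lra.
        by rewrite ler_piMr// ger0_norm.
      rewrite notin_setE /= => /contrapT; rewrite in_itv/= -ler_norml => xN.
      by rewrite mulr0 add0r chi1 ?mulr1.
    rewrite adde0 lee_fin /G chi0// mulr0 subr0 ger0_norm// indicE mem_set/= ?mulr1//.
    move: xE; rewrite notin_setE /E /= !in_itv/= -!ler_norml => xE xN; apply: xE.
    by rewrite (le_trans xN)// ler_nat.
  have [M [Mreal MG]] := compact_bounded (continuous_compact
    (continuous_subspaceT cG) (@segment_compact R (- N.+1%:R)%R N.+1%:R%R)).
  pose C : R := (`|M| + 1)%R.
  have C0 : (0 <= C)%R by rewrite addr_ge0.
  have GC x : (`|G x| <= C)%R.
    case: (boolP (x \in E)) => xE; last by rewrite /G chi0// mulr0 normr0.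
    apply: (MG C); first by rewrite (le_lt_trans (ler_norm _))// ltrDl.
    by exists x => //; rewrite inE in xE.
  have [K [Kreal Kh]] : bounded_fun h.
    by apply: cvg_seq_bounded; apply/cvg_ex; exists 0%R.
  (* All shifts [h n] are at most |K| + 1 in absolute value, so G and all its translates vanish off
     [-L, L], where 2 C bounds their differences. *)
  pose L := (N.+1%:R + (`|K| + 1))%R.
  have muL : mu (`[(- L)%R, L]%classic : set R) < +oo.
    by rewrite /mu lebesgue_measure_itv/=; case: ifP => _; rewrite ltry.
  apply: (@cvg_integral0 _ (measurableTypeR R) R mu _
    (fun x => (2 * C * \1_(`[(- L)%R, L]) x)%:E)).
  - move=> n; apply/measurable_EFinP; apply: measurableT_comp => //.
    apply: measurable_funB => //; apply: measurableT_comp => //.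
    exact: measurable_funD.
  - by apply/measurable_EFinP; apply: measurable_funM => //; exact: measurable_indic.
  - by move=> n x; rewrite lee_fin.
  - move=> n x; rewrite lee_fin indicE.
    case: (boolP (x \in _)) => xL.
      rewrite mulr1 (le_trans (ler_normB _ _))//.
      by rewrite mulrDl mul1r lerD.
    have hK : (`|h n| <= `|K| + 1)%R.
      by apply: (Kh (`|K| + 1)%R) => //; rewrite (le_lt_trans (ler_norm _))// ltrDl.
    move: xL; rewrite notin_setE /= in_itv/= -ler_norml => /negP; rewrite -ltNge => xL.
    have out y : (N.+1%:R < `|y|)%R -> G y = 0%R.
      move=> yN; rewrite /G chi0 ?mulr0// notin_setE /E /= in_itv/= -ler_norml.
      by apply/negP; rewrite -ltNge.
    rewrite !out ?subr0 ?normr0 ?mulr0//.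
      by apply: le_lt_trans xL; rewrite /L lerDl addr_ge0.
    have := ler_normB (h n + x)%R (h n); rewrite (addrC (h n)) addrK => ?.
    by move: xL; rewrite /L; lra.
  - under eq_integral => x _ do rewrite EFinM.
    rewrite ge0_integralZl//; [|exact/measurable_EFinP/measurable_indic|by rewrite lee_fin mulr_ge0].
    rewrite integral_indic// setIT lte_mul_pinfty ?lee_fin ?mulr_ge0//.
  - move=> x _; rewrite (_ : 0 = (`|G (0 + x) - G x|)%:E); last first.
      by rewrite add0r subrr normr0.
    apply: cvg_EFin; first exact: nearW.
    apply: cvg_norm; apply: cvgB; last exact: cvg_cst.
    apply: continuous_cvg; first exact: cG.
    by apply: cvgD => //; exact: cvg_cst.
have mh n : measurable_fun setT (fun x : R => (h n + x)%R) by exact: measurable_funD.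
apply/cvge0P => [n|e e0]; first by apply: integral_ge0.
have e40 : (0 < e / 4)%R by rewrite divr_gt0.
have [G [mG gG GG]] := close _ e40.
have GG0 n : 0 <= \int[mu]_x (`|G (h n + x) - G x|)%:E by exact: integral_ge0.
apply: filterS ((cvge0P GG0).1 GG _ e40) => n Gn.
have mgn : measurable_fun setT (fun x => g (h n + x)%R) by exact: (measurableT_comp mg (mh n)).
have mGn : measurable_fun setT (fun x => G (h n + x)%R) by exact: (measurableT_comp mG (mh n)).
apply: le_trans (integral_dist_triangle mu mgn mGn mg) _.
have gGn : \int[mu]_x (`|g (h n + x) - G (h n + x)|)%:E <= (e/4)%:E.
  apply: le_trans gG.
  rewrite -[leRHS](@integral_affine1 R (h n) 1%R)//; last first.
    by apply/measurable_EFinP; apply: measurableT_comp => //; exact: measurable_funB.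
  by rewrite mul1e; under [leRHS]eq_integral do rewrite mul1r.
have Gg : \int[mu]_x (`|G (h n + x) - g x|)%:E <= (e/4)%:E + (e/4)%:E.
  apply: le_trans (integral_dist_triangle mu mGn mG mg) _; apply: leeD => //.
  by under eq_integral do rewrite distrC.
apply: (@le_trans _ _ ((e/4)%:E + ((e/4)%:E + (e/4)%:E))); first exact: leeD.
by rewrite -!EFinD lee_fin; lra.
Unshelve. all: by end_near. Qed.
End L1.

(** * Permutations of coordinates *)

Section perm.
Variable R : realType.
Local Open Scope ereal_scope.
Local Notation mu := (@lebesgue_measure R).

Definition cyl (A : nat -> set R) : set (rseq R) := [set s | forall i, A i (s i)].

Lemma measurable_cyl A : (forall i, measurable (A i)) -> measurable (cyl A).
Proof.
move=> mA; rewrite (_ : cyl A = \bigcap_i ((fun s : rseq R => s i) @^-1` A i)).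
  apply: bigcapT_measurable => i; rewrite -[X in measurable X]setTI.
  exact: measurable_coord.
by apply/seteqP; split => s /= h i; [move=> _|]; exact: h.
Qed.

(** The factor [lebs R 0] records whether 0 satisfies the constraints on the coordinates from n on,
    which are frozen at 0. *)
Lemma lebs_cyl n A : (forall i, measurable (A i)) ->
  lebs R n (cyl A) = (\prod_(i < n) mu (A i)) * lebs R 0 (cyl (fun i => A (n + i)%N)).
Proof.
elim: n A => [|n IH] A mA; first by rewrite big_ord0 mul1e.
have mC := measurable_cyl mA.
rewrite -(setIT (cyl A)) -integral_indic// integral_lebsS//; first last.
  exact/measurable_EFinP/measurable_indic.
rewrite big_ord_recl/= -muleA.
rewrite -[X in _ = _ * X](IH (fun i => A i.+1)); last by move=> i; exact: mA.
have mC' : measurable (cyl (fun i => A i.+1)) by exact: measurable_cyl.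
transitivity (\int[mu]_x ((\1_(A 0%N) x)%:E * lebs R n (cyl (fun i => A i.+1)))).
  apply: eq_integral => x _.
  transitivity (\int[lebs R n]_s ((\1_(A 0%N) x)%:E * (\1_(cyl (fun i => A i.+1)) s)%:E)).
    apply: eq_integral => s _; rewrite -EFinM !indicE; congr EFin.
    rewrite -natrM mulnb; congr (_%:R); congr nat_of_bool.
    apply/idP/andP; rewrite !inE /=.
      by move=> h; split; [exact: (h 0%N)|move=> i; exact: (h i.+1)].
    by move=> -[h0 h] [|i]//=; exact: h.
  rewrite ge0_integralZl//; last exact/measurable_EFinP/measurable_indic.
  by rewrite integral_indic// setIT.
have mi : measurable_fun setT (fun x : R => (\1_(A 0%N) x : R)%:E).
  exact/measurable_EFinP/measurable_indic.
rewrite ge0_integralZr//.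
by congr (_ * _); rewrite (integral_indic mu measurableT) ?setIT//; exact: mA.
Qed.

Definition permseq n (sigma : {perm 'I_n}) (s : nat -> R) : nat -> R :=
  fun j => if insub j is Some i then s (sigma i) else s j.

Lemma measurable_permseq n (sigma : {perm 'I_n}) :
  measurable_fun setT (permseq sigma : rseq R -> rseq R).
Proof.
by apply: measurable_into => i; rewrite /permseq; case: insubP => [j _ _|_];
  exact: measurable_coord.
Qed.

(** The measure and its image under the permutation agree on cylinders, a generating family stable
    under intersection; the cylinders over the cubes [-k, k]^n have finite mass and exhaust the
    space. *)
Lemma integral_perm n (sigma : {perm 'I_n}) (F : (nat -> R) -> \bar R) :
  measurable_fun setT (F : rseq R -> \bar R) -> (forall s, 0 <= F s) ->
  \int[lebs R n]_s F (permseq sigma s) = \int[lebs R n]_s F s.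
Proof.
move=> mF F0.
pose nu : {measure set (rseq R) -> \bar R} :=
  measure_function_pushforward__canonical__measure_function_Measure
    (lebs R n) (measurable_permseq sigma).
rewrite [RHS](eq_measure_integral nu).
  by rewrite [RHS]ge0_integral_pushforward//; exact: measurable_permseq.
pose G : set (set (rseq R)) := [set cyl A | A in [set A | forall i, measurable (A i)]].
move=> X mX _.
refine (@measure_unique _ R (rseq R) G
  (fun k => cyl (fun i => if (i < n)%N then `[(- k%:R)%R, k%:R%R]%classic else setT))
  _ _ _ _ (lebs R n) nu _ _ X mX).
- apply/seteqP; split.
    apply: smallest_sub; first exact: smallest_sigma_algebra.
    move=> _ [i _ [Y mY <-]]; apply: sub_sigma_algebra.
    exists (fun j => if j == i then Y else setT) => [j|]; first by case: ifP.
    rewrite setTI; apply/seteqP; split => s /= h; first by have := h i; rewrite eqxx.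
    by move=> j; case: eqVneq => // ->.
  apply: smallest_sub; first exact: sigma_algebra_measurable.
  by move=> _ [A mA <-]; exact: measurable_cyl.
- move=> _ _ [A mA <-] [B mB <-]; exists (fun i => A i `&` B i).
    by move=> i; exact: measurableI.
  apply/seteqP; split => s /=; first by move=> h; split => i; have [] := h i.
  by move=> [h1 h2] i; split.
- by move=> k; exists (fun i => if (i < n)%N then `[(- k%:R)%R, k%:R%R]%classic else setT) => // i; case: ifP.
- rewrite -subTset => s _.
  exists (\max_(i < n) (Num.truncn `|s i|).+1)%N => // i /=.
  case: ifP => // ilt; rewrite /= in_itv/= -ler_norml.
  apply: le_trans (ltW (truncnS_gt _)) _.
  by rewrite ler_nat (leq_bigmax (Ordinal ilt)).
- move=> _ [A mA <-]; rewrite /nu/= /pushforward.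
  pose A' j := if insub j is Some i then A ((sigma^-1)%g i : 'I_n) else A j.
  have -> : permseq sigma @^-1` (cyl A) = cyl A'.
    apply/seteqP; split => s /= h i; have := h i; rewrite /permseq /A'.
      case: insubP => [j _ <-|//].
      have := h ((sigma^-1)%g j); rewrite /permseq.
      by rewrite valK permKV.
    case: insubP => [j ij <-|//]; have := h (sigma j).
    by rewrite /A' valK permK.
  have mA' i : measurable (A' i) by rewrite /A'; case: insubP.
  rewrite (lebs_cyl n mA) (lebs_cyl n mA').
  congr (_ * _); last first.
    congr (lebs R 0 (cyl _)); apply/funext => i; rewrite /A'; case: insubP => // j.
    by rewrite ltnNge leq_addr.
  rewrite [RHS](reindex_inj (@perm_inj _ sigma)); apply: eq_bigr => i _ /=.
  by rewrite /A' valK permK.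
- move=> k /=; set A := (X in cyl X).
  have mA i : measurable (A i) by rewrite /A; case: ifP.
  rewrite (lebs_cyl n mA); set B := cyl (fun i => A (n + i)%N).
  have -> : \prod_(i < n) mu (A i) = (\prod_(i < n) (k%:R - - k%:R))%R%:E.
    rewrite -prodEFin; apply: eq_bigr => i _; rewrite /A ltn_ord lebesgue_measure_itv/=.
    rewrite lte_fin; case: ltP => // kk; congr EFin; apply/esym/eqP.
    by rewrite subr_eq0 eq_le kk ge0_cp// ler0n.
  by rewrite -/(lebs R 0) /= /dirac/= indicE -EFinM ltry.
Qed.

End perm.

(** * Continuity of translations in several dimensions *)

Section translation.
Variable R : realType.
Local Open Scope ereal_scope.
Local Notation mu := (@lebesgue_measure R).

Lemma measurable_integral_lebs d (T : measurableType d) n (F : T * rseq R -> \bar R) :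
  measurable_fun setT F -> (forall x, 0 <= F x) ->
  measurable_fun setT (fun x => \int[lebs R n]_s F (x, s)).
Proof. by move=> mF F0; exact: (@measurable_fun_fubini_tonelli_F _ _ _ _ _ (lebs R n) F). Qed.

Lemma measurable_integral_mu d (T : measurableType d) (F : R * T -> \bar R) :
  measurable_fun setT F -> (forall x, 0 <= F x) ->
  measurable_fun setT (fun s => \int[mu]_x F (x, s)).
Proof. by move=> mF F0; exact: (@measurable_fun_fubini_tonelli_G _ _ _ _ R mu F). Qed.

Lemma int2_lty d (T : measurableType d) (m : {measure set T -> \bar R}) (f : T -> \bar R) :
  measurable_fun setT f -> (forall x, 0 <= f x) -> \int[m]_x f x < +oo ->
  \int[m]_x (2%:E * f x) < +oo.
Proof. by move=> mf f0 foo; rewrite ge0_integralZl// lte_mul_pinfty. Qed.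

(** Induction on the dimension. The shift of the first coordinate and the shift of the others are
    two errors. Each is an integral over fibres of a quantity that vanishes on every fibre of finite
    mass, by the one-dimensional case or by induction, and that is dominated by twice the mass of
    the fibre. *)
Lemma translation_L1 n (F : (nat -> R) -> R) (v : nat -> nat -> R) :
  dep n F -> measurable_fun setT (F : rseq R -> R) -> (forall s, 0 <= F s)%R ->
  \int[lebs R n]_s (F s)%:E < +oo ->
  (forall j, v m j @[m --> \oo] --> 0%R) ->
  \int[lebs R n]_s (`|F (fun j => v m j + s j)%R - F s|)%:E @[m --> \oo] --> 0.
Proof.
elim: n F v => [|n IH] F v dF mF F0 Foo v0.
  apply: cvg_near_cst; apply: nearW => m; apply: integral0_eq => s _.
  by rewrite (dF (fun j => v m j + s j)%R s)// subrr normr0.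
have m1 x : measurable_fun setT (fun s : rseq R => F (scons x s)).
  exact: (measurableT_comp mF (measurable_sconsl x)).
have mcons : measurable_fun setT (fun p : R * rseq R => scons p.1 p.2 : rseq R).
  exact: measurable_scons.
have mv m : measurable_fun setT (fun s : rseq R => (fun j => v m j.+1 + s j)%R : rseq R).
  apply: measurable_into => i; apply: measurable_funD => //.
  exact: measurable_coord.
have mFx : measurable_fun setT (fun p : R * rseq R => F (scons p.1 p.2)).
  exact: (measurableT_comp mF mcons).
have mFxh m : measurable_fun setT (fun p : R * rseq R => F (scons (v m 0%N + p.1)%R p.2)).
  apply: (measurableT_comp mF); apply: (@measurableT_comp _ _ _ _ _ _ _ _
    (fun p : R * rseq R => ((v m 0%N + p.1)%R, p.2))  mcons).
  by apply/measurable_fun_pair => //=; exact: measurable_funD.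
have mFxv m : measurable_fun setT
    (fun p : R * rseq R => F (scons p.1 (fun j => v m j.+1 + p.2 j)%R)).
  apply: (measurableT_comp mF); apply: (@measurableT_comp _ _ _ _ _ _ _ _
    (fun p : R * rseq R => (p.1, (fun j => v m j.+1 + p.2 j)%R : rseq R)) mcons).
  by apply/measurable_fun_pair => //=; exact: (measurableT_comp (mv m)).
have mFxhv m : measurable_fun setT
    (fun p : R * rseq R => F (scons (v m 0%N + p.1)%R (fun j => v m j.+1 + p.2 j)%R)).
  apply: (measurableT_comp mF); apply: (@measurableT_comp _ _ _ _ _ _ _ _
    (fun p : R * rseq R => ((v m 0%N + p.1)%R, (fun j => v m j.+1 + p.2 j)%R : rseq R)) mcons).
  apply/measurable_fun_pair => //=; first exact: measurable_funD.
  exact: (measurableT_comp (mv m)).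
have mdist (G H : R * rseq R -> R) : measurable_fun setT G -> measurable_fun setT H ->
    measurable_fun setT (fun p => (`|G p - H p|)%:E).
  move=> mG mH; apply/measurable_EFinP; apply: measurableT_comp => //.
  exact: measurable_funB.
have shiftE m (G : (nat -> R) -> \bar R) : dep n G ->
    measurable_fun setT (G : rseq R -> \bar R) -> (forall s, 0 <= G s) ->
    \int[lebs R n]_s G (fun j => v m j.+1 + s j)%R = \int[lebs R n]_s G s.
  move=> dG mG G0; rewrite -[RHS](@integral_affine R n (fun j => v m j.+1) 1%R)//.
  rewrite expr1n mul1e; apply: eq_integral => s _; congr G; apply/funext => j.
  by rewrite mul1r.
have dFx x : dep n (fun s => F (scons x s)).
  by move=> s t st; apply: dF => -[|j]//=; exact: st.
have dbl (y : \bar R) : y + y = 2%:E * y by rewrite -mule2n -mule_natl.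
pose a1 m s := \int[mu]_x (`|F (scons (v m 0%N + x)%R s) - F (scons x s)|)%:E.
pose a2 m x := \int[lebs R n]_s
  (`|F (scons x (fun j => v m j.+1 + s j)%R) - F (scons x s)|)%:E.
have Foo' : \int[mu]_x \int[lebs R n]_s (F (scons x s))%:E < +oo.
  rewrite -(@integral_lebsS R n (fun s => (F s)%:E))//.
  exact/measurable_EFinP.
have Foo2 : \int[lebs R n]_s \int[mu]_x (F (scons x s))%:E < +oo.
  have := @fubini_tonelli _ _ _ _ R mu (lebs R n) (fun p => (F (scons p.1 p.2))%:E).
  move=> /(_ _ _) <- //; last by move=> x; rewrite lee_fin.
  exact/measurable_EFinP.
have c1 : \int[lebs R n]_s a1 m s @[m --> \oo] --> 0.
  apply: (@cvg_integral0 _ _ R (lebs R n) _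
    (fun s => 2%:E * \int[mu]_x (F (scons x s))%:E)).
  - move=> m.
    exact: (@measurable_integral_mu _ (rseq R)
      (fun p => (`|F (scons (v m 0%N + p.1)%R p.2) - F (scons p.1 p.2)|)%:E) (mdist _ _ _ _) (fun=> _)).
  - apply: measurable_funeM.
    apply: (@measurable_integral_mu _ (rseq R)
      (fun p => (F (scons p.1 p.2))%:E)) => [|p];
        [exact/measurable_EFinP|by rewrite lee_fin].
  - by move=> m s; exact: integral_ge0.
  - move=> m s; rewrite /a1.
    have m1s : measurable_fun setT (fun x : R => F (scons x s)).
      exact: (measurableT_comp mF (measurable_sconsr s)).
    have m1s' : measurable_fun setT (fun x : R => F (scons (v m 0%N + x)%R s)).
      by apply: (measurableT_comp m1s); exact: measurable_funD.
    apply: le_trans (integral_dist_le mu m1s' m1s _ _) _ => //.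
    suff -> : \int[mu]_x (F (scons (v m 0%N + x)%R s))%:E = \int[mu]_x (F (scons x s))%:E.
      by rewrite dbl.
    rewrite -[RHS](@integral_affine1 R (v m 0%N) 1%R (fun x => (F (scons x s))%:E))//.
    + by rewrite mul1e; apply: eq_integral => x _; rewrite mul1r.
    + exact/measurable_EFinP.
    + by move=> x; rewrite lee_fin.
  - apply: int2_lty => //.
    + apply: (@measurable_integral_mu _ (rseq R)
        (fun p => (F (scons p.1 p.2))%:E)) => [|p];
        [exact/measurable_EFinP|by rewrite lee_fin].
    + by move=> s; apply: integral_ge0 => x _; rewrite lee_fin.
  - move=> s bs; apply: (translation_L1_1 (g := fun x => F (scons x s))) => //.
      exact: (measurableT_comp mF (measurable_sconsr s)).
    have i0 : 0 <= \int[mu]_x (F (scons x s))%:E.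
      by apply: integral_ge0 => x _; rewrite lee_fin.
    by apply: le_lt_trans bs; rewrite -[leLHS]mul1e lee_wpmul2r// lee_fin ler1n.
have c2 : \int[mu]_x a2 m x @[m --> \oo] --> 0.
  apply: (@cvg_integral0 _ (measurableTypeR R) R mu _
    (fun x => 2%:E * \int[lebs R n]_s (F (scons x s))%:E)).
  - move=> m.
    exact: (@measurable_integral_lebs _ R n
      (fun p => (`|F (scons p.1 (fun j => v m j.+1 + p.2 j)%R) - F (scons p.1 p.2)|)%:E) (mdist _ _ _ _) (fun=> _)).
  - apply: measurable_funeM.
    apply: (@measurable_integral_lebs _ R n
      (fun p => (F (scons p.1 p.2))%:E)) => [|p]; last by rewrite lee_fin.
    exact/measurable_EFinP.
  - by move=> m s; exact: integral_ge0.
  - move=> m x; rewrite /a2.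
    have m1x' : measurable_fun setT (fun s : rseq R => F (scons x (fun j => v m j.+1 + s j)%R)).
      exact: (measurableT_comp (m1 x) (mv m)).
    apply: le_trans (integral_dist_le (lebs R n) m1x' (m1 x) _ _) _ => //.
    rewrite (shiftE m (fun s => (F (scons x s))%:E)) => [|s t st||s]; first 
      by rewrite dbl.
    + by rewrite (dFx _ _ _ st).
    + exact/measurable_EFinP.
    + by rewrite lee_fin.
  - apply: int2_lty => //.
    + apply: (@measurable_integral_lebs _ R n
        (fun p => (F (scons p.1 p.2))%:E)) => [|p]; last by rewrite lee_fin.
      exact/measurable_EFinP.
    + by move=> s; apply: integral_ge0 => x _; rewrite lee_fin.
  - move=> x bx; apply: (IH (fun s => F (scons x s)) (fun m j => v m j.+1)) => //.
    have i0 : 0 <= \int[lebs R n]_s (F (scons x s))%:E.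
      by apply: integral_ge0 => s _; rewrite lee_fin.
    by apply: le_lt_trans bx; rewrite -[leLHS]mul1e lee_wpmul2r// lee_fin ler1n.
have := cvgeD _ c1 c2; rewrite adde0 => /(_ _ isT).
apply: squeeze_cvge; last exact: cvg_cst.
apply: nearW => m; apply/andP; split; first exact: integral_ge0.
have mFvm : measurable_fun setT (fun s : rseq R => F (fun j => v m j + s j)%R).
  apply: (measurableT_comp mF); apply: measurable_into => i; apply: measurable_funD => //.
  exact: measurable_coord.
rewrite integral_lebsS; [|by apply/measurable_EFinP; apply: measurableT_comp => //;
  exact: measurable_funB|by move=> s; rewrite lee_fin].
(* Here the other coordinates are shifted in both terms; for fixed x this common shift is removed by
   translation invariance of [lebs n], which leaves the integral of [a1]. *)
rewrite -[X in _ <= X + _](_ : \int[mu]_x \int[lebs R n]_s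
    (`|F (scons (v m 0%N + x)%R (fun j => v m j.+1 + s j)%R) -
      F (scons x (fun j => v m j.+1 + s j)%R)|)%:E = _); last first.
  rewrite /a1 -(@fubini_tonelli _ _ _ _ R mu (lebs R n)
    (fun p => (`|F (scons (v m 0%N + p.1)%R p.2) - F (scons p.1 p.2)|)%:E))//;
    last exact: mdist.
  apply: eq_integral => x _.
  apply: (shiftE m (fun s => (`|F (scons (v m 0%N + x)%R s) - F (scons x s)|)%:E)) => //.
    by move=> s t st; rewrite (dFx _ _ _ st) (dFx _ _ _ st).
  apply/measurable_EFinP; apply: measurableT_comp => //; exact: measurable_funB.
rewrite -ge0_integralD//=; first last.
- exact: (@measurable_integral_lebs _ R n
      (fun p => (`|F (scons p.1 (fun j => v m j.+1 + p.2 j)%R) - F (scons p.1 p.2)|)%:E) (mdist _ _ _ _) (fun=> _)).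
- by move=> x _; exact: integral_ge0.
- exact: (@measurable_integral_lebs _ R n
      (fun p => (`|F (scons (v m 0%N + p.1)%R (fun j => v m j.+1 + p.2 j)%R) -
      F (scons p.1 (fun j => v m j.+1 + p.2 j)%R)|)%:E) (mdist _ _ _ _) (fun=> _)).
- by move=> x _; exact: integral_ge0.
apply: le_integral_nomeas => x; first exact: integral_ge0.
rewrite [leLHS](_ : _ = \int[lebs R n]_s (`|F (scons (v m 0%N + x)%R (fun j => v m j.+1 + s j)%R) -
   F (scons x s)|)%:E).
  apply: integral_dist_triangle.
  - exact: (measurableT_comp (m1 (v m 0%N + x)%R) (mv m)).
  - exact: (measurableT_comp (m1 x) (mv m)).
  - exact: m1.
apply: eq_integral => s _; congr (`|F _ - _|%:E); apply/funext => -[|j]//.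
Qed.
End translation.

(** * Points as blocks of coordinates, and Borel functions of them *)

Section blocks.
Variable R : realType.
Local Open Scope ereal_scope.
Local Notation mu := (@lebesgue_measure R).

Lemma measurable_diag a b : measurable [set s : rseq R | s a = s b].
Proof.
rewrite (_ : [set _ | _] = (fun s : rseq R => s a - s b)%R @^-1` [set 0%R]).
  rewrite -[X in measurable X]setTI.
  by apply: measurable_funB => //; exact: measurable_coord.
by apply/seteqP; split => s /= => [->|/subr0_eq//]; rewrite subrr.
Qed.

(** If a is the first coordinate, fixing the others confines it to a single point, a Lebesgue null
    set; otherwise the first coordinate is dropped and induction applies. *)
Lemma null_diag n a b : (a < b < n)%N -> lebs R n [set s | s a = s b] = 0.
Proof.
elim: n a b => [|n IH] a b; first by rewrite ltn0 andbF.
move=> /andP[]; case: b => // b ab bn.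
have mD := measurable_diag a b.+1.
rewrite -(setIT [set s | _]) -integral_indic// integral_lebsS//; last exact/measurable_EFinP/measurable_indic.
case: a ab mD => [|a] ab mD.
  have := @fubini_tonelli _ _ _ _ R mu (lebs R n)
     (fun p => (\1_[set s : rseq R | s 0%N = s b.+1] (scons p.1 p.2))%:E).
  move=> /= /(_ _ _) ->.
  - apply: integral0_eq => s _ /=; rewrite /fubini_G/=.
    transitivity (\int[mu]_x (\1_[set s b] x)%:E).
      by apply: eq_integral => x _; rewrite !indicE; congr (_%:R%:E); congr nat_of_bool; apply/idP/idP; rewrite !inE.
    by rewrite integral_indic// setIT; exact: lebesgue_measure_set1.
  - apply/measurable_EFinP.
    apply: (@measurableT_comp _ _ _ _ _ _ (\1_[set s : rseq R | s 0%N = s b.+1] : rseq R -> R)).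
      exact: measurable_indic.
    exact: measurable_scons.
  - by move=> x; rewrite lee_fin.
apply: integral0_eq => x _.
rewrite -[RHS](IH a b) ?ltnS//; last exact/andP.
rewrite -[X in _ = _ X](setIT [set s | _]) -integral_indic//; last exact: measurable_diag.
Qed.

Definition blk d i (s : nat -> R) : 'rV[R]_d := \row_(j < d) s (i * d + j)%N.

(** Coordinatewise measurability; [borel_comp] turns it into measurability of compositions with a
    function that is Borel for the topology of row vectors. *)
Definition vmeas d' (T : measurableType d') d (g : T -> 'rV[R]_d) :=
  forall j, measurable_fun setT (fun t => g t ord0 j : R).

Lemma vmeas_blk d i : vmeas (blk d i : rseq R -> 'rV[R]_d).
Proof.
move=> j; rewrite (_ : (fun _ => _) = (fun t : rseq R => t (i * d + j)%N)).
  exact: measurable_coord.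
by apply/funext => t; rewrite mxE.
Qed.

(** An open set is the union of the countably many balls it contains with rational centre and radius
    1 / (n + 1). The norm is the sup norm, so such a ball is a box and its preimage is a finite
    intersection of conditions on single coordinates. *)
Lemma vmeas_open d' (T : measurableType d') d (g : T -> 'rV[R]_d) (U : set 'rV[R]_d) :
  vmeas g -> open U -> measurable (g @^-1` U).
Proof.
move=> mg oU.
pose qv (q : 'rV[rat]_d) : 'rV[R]_d := map_mx ratr q.
pose Q (x : 'rV[rat]_d * nat) : set T := if `[< ball (qv x.1) x.2.+1%:R^-1 `<=` U >]
  then g @^-1` ball (qv x.1) x.2.+1%:R^-1 else set0.
have -> : g @^-1` U = \bigcup_n (if (unpickle n : option ('rV[rat]_d * nat)) is Some x then Q x else set0).
  apply/seteqP; split => t /=; last first.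
    move=> [n _]; case: unpickle => // x; rewrite /Q; case: asboolP => // xU; exact: xU.
  move=> Ugt.
  have [e /= e0 eU] : exists2 e, (0 < e)%R & ball (g t) e `<=` U.
    by have /nbhs_ballP[e e0 eU] := open_nbhs_nbhs (conj oU Ugt); exists e.
  have [n ne] : exists n, (n.+1%:R^-1 < e / 2 :> R)%R.
    exists (Num.truncn (e/2)^-1); rewrite invf_plt ?posrE//; last exact: divr_gt0.
    exact: truncnS_gt.
  have qx (x : R) : exists q : rat, (`|ratr q - x| < n.+1%:R^-1)%R.
    have /rat_in_itvoo[q] : (x - n.+1%:R^-1 < x + n.+1%:R^-1)%R.
      by rewrite ltrD2l gtrN.
    by rewrite in_itv/= => qx; exists q; rewrite ltr_distl.
  pose q : 'rV[rat]_d := \row_j (projT1 (cid (qx (g t ord0 j)))).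
  have bq j : (`|qv q ord0 j - g t ord0 j| < n.+1%:R^-1)%R.
    by rewrite /qv !mxE; case: cid.
  exists (pickle (q, n)) => //; rewrite pickleK /Q ifT /=; last first.
    apply/asboolP => y [_ qy]; apply: eU; split=> // i j.
    rewrite !ord1; have := qy ord0 j; have := bq j; rewrite /ball/= => h1 h2.
    rewrite -(subrK (qv q ord0 j) (g t ord0 j)) -addrA.
    apply: le_lt_trans (ler_normD _ _) _; rewrite (splitr e) ltrD//.
      by rewrite distrC (lt_trans h1).
    exact: lt_trans ne.
  by split=> [|i j]; rewrite ?invr_gt0// !ord1; exact: bq.
apply: bigcupT_measurable => n; case: unpickle => // x; rewrite /Q; case: asboolP => // _.
rewrite (_ : g @^-1` _ = \bigcap_(j in [set: 'I_d])
   (fun t => `|qv x.1 ord0 j - g t ord0 j|)%R @^-1` [set y | (y < x.2.+1%:R^-1)%R]).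
  apply: fin_bigcap_measurable => // j _; rewrite -[X in measurable X]setTI.
  have mj : measurable_fun setT (fun t => `|qv x.1 ord0 j - g t ord0 j|)%R.
    by apply: measurableT_comp => //; apply: measurable_funB => //; exact: mg.
  apply: mj => //; rewrite (_ : [set y | _] = `]-oo, (x.2.+1%:R^-1)%R[%classic)//.
apply/seteqP; split => t /= => [[_ h] j _|h]; first exact: h.
by split=> [|i j]; rewrite ?invr_gt0// ord1; exact: (h j).
Qed.

Lemma borel_comp d' (T : measurableType d') d (g : T -> 'rV[R]_d) (f : 'rV[R]_d -> R) :
  borel_measurable f -> vmeas g -> measurable_fun setT (fun t => f (g t)).
Proof.
move=> bf mg.
have mB B : <<s (@open 'rV[R]_d) >> B -> measurable (g @^-1` B).
  suff : <<s (@open 'rV[R]_d) >> `<=` [set B | measurable (g @^-1` B)] by exact.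
  apply: smallest_sub; last by move=> U; exact: vmeas_open.
  split => /=.
  - by rewrite preimage_set0; exact: measurable0.
  - by move=> A mA; rewrite setTD preimage_setC; exact: measurableC.
  - by move=> A mA; rewrite preimage_bigcup; exact: bigcupT_measurable.
apply: (@measurability _ _ T R setT (fun t => f (g t)) (@RGenOpens.G R)).
  exact: RGenOpens.measurableE.
move=> _ [_ [a [b ->]] <-]; rewrite setTI.
by apply: (mB (f @^-1` `]a, b[%classic)); apply: bf; exact: interval_open.
Qed.

End blocks.

(** * Circumcenters *)

Section circum.
Variable R : realType.
Implicit Types d k : nat.

Lemma edist_ge0 d (x y : 'rV[R]_d) : 0 <= edist x y.
Proof. exact: sqrtr_ge0. Qed.

Lemma edist_sq d (x y : 'rV[R]_d) : edist x y ^+ 2 = \sum_(i < d) (x 0 i - y 0 i) ^+ 2.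
Proof. by rewrite sqr_sqrtr// sumr_ge0// => i _; exact: sqr_ge0. Qed.

Lemma edistC d (x y : 'rV[R]_d) : edist x y = edist y x.
Proof. by congr Num.sqrt; apply: eq_bigr => i _; rewrite -sqrrN opprB. Qed.

Lemma edist_scale d (a : 'rV[R]_d) (c : R) (x y : 'rV[R]_d) : 0 <= c ->
  edist (a + c *: x) (a + c *: y) = c * edist x y.
Proof.
move=> c0; transitivity (Num.sqrt (c ^+ 2) * edist x y); last by rewrite sqrtr_sqr ger0_norm.
rewrite /Pilot.Defs.edist -sqrtrM ?sqr_ge0// mulr_sumr; congr Num.sqrt; apply: eq_bigr => i _; rewrite !mxE; ring.
Qed.

Lemma coord_le_edist d (x y : 'rV[R]_d) j : `|x 0 j - y 0 j| <= edist x y.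
Proof.
rewrite -sqrtr_sqr ler_sqrt; last by apply: sumr_ge0 => i _; exact: sqr_ge0.
by rewrite (bigD1 j)//= lerDl sumr_ge0// => i _; exact: sqr_ge0.
Qed.

Definition edges d k (z : 'I_k.+1 -> 'rV[R]_d) : 'M[R]_(k, d) :=
  \matrix_(i < k) (z (lift ord0 i) - z ord0).

Definition gram d k (z : 'I_k.+1 -> 'rV[R]_d) : 'M[R]_k := edges z *m (edges z)^T.

Definition gramdiag d k (z : 'I_k.+1 -> 'rV[R]_d) : 'rV[R]_k := \row_i gram z i i.

(* Barycentric coordinates, at the vertices other than [z ord0], of the circumcenter. *)
Definition bary d k (z : 'I_k.+1 -> 'rV[R]_d) : 'rV[R]_k :=
  2^-1 *: (gramdiag z *m ((\det (gram z))^-1 *: \adj (gram z))).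

(** A closed formula replacing the chosen point [circumcenter]: it is rational in the coordinates,
    hence measurable. For a singular Gram matrix the inverse determinant is 0 and the value is
    [z ord0]. *)
Definition cc d k (z : 'I_k.+1 -> 'rV[R]_d) : 'rV[R]_d := z ord0 + bary z *m edges z.

Definition crad d k (z : 'I_k.+1 -> 'rV[R]_d) : R := edist (cc z) (z ord0).

(** A nonzero Gram determinant is affine independence; the other two conditions are positivity of
    all k + 1 barycentric coordinates of the circumcenter, that of [z ord0] being 1 minus the sum of
    the others. *)
Definition good d k (z : 'I_k.+1 -> 'rV[R]_d) : bool :=
  [&& \det (gram z) != 0, [forall i, 0 < bary z 0 i] & \sum_i bary z 0 i < 1].

Lemma sqnorm_eq0 d (v : 'rV[R]_d) : v *m v^T = 0 -> v = 0.
Proof.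
move=> /matrixP /(_ 0 0); rewrite !mxE => /eqP.
rewrite psumr_eq0 => [/allP h|i _]; last by rewrite mxE -expr2 sqr_ge0.
apply/rowP => j; rewrite mxE.
by have := h j (mem_index_enum _); rewrite mxE mulf_eq0 orbb => /eqP.
Qed.

(** With A the matrix of edges, v A A^T = 0 gives |v A|^2 = 0 and so v A = 0; the Gram matrix is
    therefore invertible exactly when the rows of A are free. *)
Lemma aff_indep_det d k (z : 'I_k.+1 -> 'rV[R]_d) : aff_indep z <-> \det (gram z) != 0.
Proof.
rewrite /aff_indep -/(edges z); split => [rk|]; last first.
  rewrite -unitfE -unitmxE => /mxrank_unit rG; apply/eqP; rewrite eqn_leq rank_leq_row/=.
  by rewrite -[X in (X <= _)%N]rG mxrankM_maxl.
have fA : row_free (edges z) by rewrite /row_free rk.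
rewrite -unitfE -unitmxE -row_free_unit -kermx_eq0.
apply/eqP/row_matrixP => i; rewrite row0; set v := row i _.
have vG : v *m gram z = 0.
  by apply/eqP; rewrite -sub_kermx row_sub.
have : v *m edges z = 0.
  by apply: sqnorm_eq0; rewrite trmx_mul mulmxA -(mulmxA v) vG mul0mx.
by move/eqP; rewrite mulmx_free_eq0// => /eqP.
Qed.

Lemma baryP d k (z : 'I_k.+1 -> 'rV[R]_d) (v : 'rV[R]_k) : \det (gram z) != 0 ->
  2 *: (v *m gram z) = gramdiag z <-> v = bary z.
Proof.
move=> d0; rewrite /bary; split => [<-|->].
  rewrite -scalemxAl scalerA mulVf ?scale1r ?pnatr_eq0// -scalemxAr -mulmxA mul_mx_adj.
  by rewrite mul_mx_scalar scalerA mulVf// scale1r.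
rewrite -scalemxAl scalerA mulfV ?scale1r ?pnatr_eq0// -scalemxAr -scalemxAl -mulmxA mul_adj_mx.
by rewrite mul_mx_scalar scalerA mulVf// scale1r.
Qed.

Lemma sum_lift d k (z : 'I_k.+1 -> 'rV[R]_d) (t : 'I_k.+1 -> R) : \sum_i t i = 1 ->
  \sum_i t i *: z i = z ord0 + (\row_i t (lift ord0 i)) *m edges z.
Proof.
rewrite big_ord_recl => t1; rewrite big_ord_recl /= mulmx_sum_row.
have -> : \sum_i (\row_i0 t (lift ord0 i0)) 0 i *: row i (edges z) =
   \sum_(i < k) (t (lift ord0 i) *: z (lift ord0 i)) - (\sum_(i < k) t (lift ord0 i)) *: z ord0.
  rewrite scaler_suml -sumrB; apply: eq_bigr => i _.
  by rewrite mxE rowK scalerBr.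
have -> : t ord0 = 1 - \sum_(i < k) t (lift ord0 i) by rewrite -t1 addrK.
by rewrite scalerBl scale1r addrAC addrA.
Qed.

Lemma edist_dot d (x y : 'rV[R]_d) : edist x y ^+ 2 = ((x - y) *m (x - y)^T) 0 0.
Proof. by rewrite edist_sq mxE; apply: eq_bigr => i _; rewrite !mxE expr2. Qed.

(** Expanding squares, |c - z_i|^2 = |c - z_0|^2 - 2 (v G)_i + G_ii with G the Gram matrix, so
    equidistance is a linear system in v. *)
Lemma equidistP d k (z : 'I_k.+1 -> 'rV[R]_d) (v : 'rV[R]_k) (c : 'rV[R]_d) :
  c = z ord0 + v *m edges z ->
  (forall i j, edist c (z i) = edist c (z j)) <-> 2 *: (v *m gram z) = gramdiag z.
Proof.
move=> cE.
have sqE i : edist c (z (lift ord0 i)) ^+ 2 =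
    edist c (z ord0) ^+ 2 - 2 * (v *m gram z) 0 i + gramdiag z 0 i.
  have ciE : c - z (lift ord0 i) = v *m edges z - row i (edges z).
    by rewrite rowK cE; apply/rowP => j; rewrite !mxE; ring.
  have c0E : c - z ord0 = v *m edges z by rewrite cE addrC addKr.
  have gE : gramdiag z 0 i = gram z i i by rewrite mxE.
  rewrite gE; set w := (v *m gram z) 0 i; set g := gram z i i.
  rewrite !edist_dot ciE c0E linearB/= mulmxBl !mulmxBr !mxE.
  rewrite [X in _ - X - _](_ : _ = w); last first.
    by rewrite /w /gram mulmxA !mxE; apply: eq_bigr => j _; rewrite !mxE.
  rewrite [X in _ - (X - _)](_ : _ = w); last first.
    rewrite /w /gram mulmxA !mxE; apply: eq_bigr => j _; rewrite !mxE mulrC.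
    by congr (_ * _); rewrite !mxE.
  rewrite [X in _ - (_ - X)](_ : _ = g); last first.
    by rewrite /g /gram !mxE; apply: eq_bigr => j _; rewrite !mxE.
  by ring.
split => [eqd|eG].
  apply/rowP => i; rewrite [LHS]mxE; have := sqE i; rewrite (eqd _ ord0); lra.
suff eq0 i : edist c (z i) = edist c (z ord0) by move=> i j; rewrite !eq0.
case: (unliftP ord0 i) => [j ->|->//].
apply/eqP; rewrite -(eqrXn2 (n := 2))// ?edist_ge0// sqE -eG [in X in _ + X]mxE.
by rewrite subrK.
Qed.

(** In coordinates v along the edges, a point of the affine hull is equidistant from the vertices
    exactly when v solves a linear system whose only solution is [bary z]. *)
Lemma circumcenterE d k (z : 'I_k.+1 -> 'rV[R]_d) : aff_indep z -> circumcenter z = cc z.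
Proof.
move=> /aff_indep_det d0.
pose t (i : 'I_k.+1) := if unlift ord0 i is Some j then bary z 0 j else 1 - \sum_j bary z 0 j.
have tl i : t (lift ord0 i) = bary z 0 i by rewrite /t liftK.
have t1 : \sum_i t i = 1.
  by rewrite big_ord_recl (eq_bigr _ (fun i _ => tl i)) /t unlift_none subrK.
have tcc : cc z = \sum_i t i *: z i.
  by rewrite sum_lift// /cc; congr (_ + _ *m _); apply/rowP => i; rewrite [RHS]mxE tl.
apply: xget_unique.
  split; first by exists t.
  by apply/(equidistP (v := bary z)) => //; exact/baryP.
move=> c [[u [u1 ->]]]; rewrite sum_lift// => eqd.
rewrite /cc; congr (_ + _ *m _); apply/baryP => //.
exact: (equidistP (erefl (z ord0 + _ *m edges z))).1 eqd.
Qed.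

Lemma goodP d k (z : 'I_k.+1 -> 'rV[R]_d) :
  good z <-> aff_indep z /\ in_open_simplex z (circumcenter z).
Proof.
split=> [/and3P[d0 /forallP b0 b1]|[ai]].
  have ai : aff_indep z by exact/aff_indep_det.
  split => //; rewrite circumcenterE//.
  pose t (i : 'I_k.+1) := if unlift ord0 i is Some j then bary z 0 j else 1 - \sum_j bary z 0 j.
  have tl i : t (lift ord0 i) = bary z 0 i by rewrite /t liftK.
  have t1 : \sum_i t i = 1.
    by rewrite big_ord_recl (eq_bigr _ (fun i _ => tl i)) /t unlift_none subrK.
  exists t; split; [|split => //].
    by move=> i; rewrite /t; case: unliftP => [j _|_]; rewrite ?subr_gt0.
  by rewrite sum_lift// /cc; congr (_ + _ *m _); apply/rowP => i; rewrite [RHS]mxE tl.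
have d0 := (aff_indep_det z).1 ai.
rewrite circumcenterE// => -[t [t0 [t1]]]; rewrite sum_lift// => /addrI.
have fA : row_free (edges z) by rewrite /row_free ai.
move=> /(row_free_inj fA) bE.
rewrite /good d0 /=; apply/andP; split.
  by apply/forallP => i; rewrite bE mxE.
rewrite bE; under eq_bigr do rewrite mxE.
by move: t1 (t0 ord0); rewrite big_ord_recl; lra.
Qed.

Lemma good_edist d k (z : 'I_k.+1 -> 'rV[R]_d) i : good z -> edist (cc z) (z i) = crad z.
Proof.
move=> /and3P[d0 _ _].
have [_ /(_ _ i ord0)] := equidistP (erefl (cc z)).
by apply; exact/baryP.
Qed.

Lemma critical_good d k (z : 'I_k.+1 -> 'rV[R]_d) c rho :
  aff_indep z -> in_open_simplex z c -> (forall i, edist c (z i) = rho) ->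
  [/\ good z, c = cc z & rho = crad z].
Proof.
move=> ai sc eqd.
have cE : c = cc z.
  have [t [t0 [t1 cE]]] := sc; move: (cE); rewrite sum_lift// => cE'.
  rewrite cE' /cc; congr (_ + _ *m _); apply/baryP; first exact/aff_indep_det.
  by apply/(equidistP cE') => i j; rewrite !eqd.
have gz : good z by apply/goodP; split => //; rewrite circumcenterE// -cE.
by split => //; rewrite -(good_edist ord0 gz) -cE.
Qed.

(** A criterion symmetric in the vertices, whereas the definition singles out [ord0]; invariance
    under permutations follows from it. *)
Lemma aff_indepP d k (z : 'I_k.+1 -> 'rV[R]_d) : aff_indep z <->
  forall t : 'I_k.+1 -> R, \sum_i t i = 0 -> \sum_i t i *: z i = 0 -> forall i, t i = 0.
Proof.
have key (t : 'I_k.+1 -> R) : \sum_i t i = 0 ->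
    \sum_i t i *: z i = (\row_i t (lift ord0 i)) *m edges z.
  rewrite big_ord_recl => /eqP; rewrite addr_eq0 => /eqP t0.
  rewrite big_ord_recl /= mulmx_sum_row t0 scaleNr scaler_suml addrC -sumrB.
  by apply: eq_bigr => i _; rewrite mxE rowK scalerBr.
split => [ai t t0|H].
  have fA : row_free (edges z) by rewrite /row_free ai.
  rewrite key// => /eqP; rewrite mulmx_free_eq0// => /eqP/rowP tl.
  have tl0 i : t (lift ord0 i) = 0 by have := tl i; rewrite !mxE.
  move=> i; case: (unliftP ord0 i) => [j ->//|->].
  by move: t0; rewrite big_ord_recl big1 ?addr0.
apply/eqP; rewrite -/(row_free (edges z)) -kermx_eq0; apply/eqP/row_matrixP => i.
rewrite row0; set v := row i _.
have vA : v *m edges z = 0 by apply/eqP; rewrite -sub_kermx row_sub.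
pose t (i : 'I_k.+1) := if unlift ord0 i is Some j then v 0 j else - \sum_j v 0 j.
have tl j : t (lift ord0 j) = v 0 j by rewrite /t liftK.
have t0 : \sum_i t i = 0.
  by rewrite big_ord_recl (eq_bigr _ (fun i _ => tl i)) /t unlift_none addNr.
apply/rowP => j; rewrite [RHS]mxE -tl; apply: H => //.
by rewrite key// -[RHS]vA; congr (_ *m _); apply/rowP => l; rewrite [LHS]mxE tl.
Qed.

Lemma aff_indep_perm d k (z : 'I_k.+1 -> 'rV[R]_d) (s : {perm 'I_k.+1}) :
  aff_indep z -> aff_indep (z \o s).
Proof.
move=> /aff_indepP H; apply/aff_indepP => t t0 tz i.
have := H (t \o (s^-1)%g) _ _ (s i); rewrite /= permK; apply.
  by rewrite (reindex_inj (@perm_inj _ s)) /=; under eq_bigr do rewrite permK.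
rewrite (reindex_inj (@perm_inj _ s)) /= -[RHS]tz.
by apply: eq_bigr => j _; rewrite permK.
Qed.

Lemma simplex_perm d k (z : 'I_k.+1 -> 'rV[R]_d) (s : {perm 'I_k.+1}) c :
  in_open_simplex z c -> in_open_simplex (z \o s) c.
Proof.
move=> [t [t0 [t1 ->]]]; exists (t \o s); split => [i|]; first exact: t0.
by split; [rewrite -t1 [RHS](reindex_inj (@perm_inj _ s))|
  rewrite (reindex_inj (@perm_inj _ s))].
Qed.

Section measurability.
Variables (d' : measure_display) (T : measurableType d').

Lemma measurable_det n (M : T -> 'M[R]_n) :
  (forall i j, measurable_fun setT (fun t => M t i j : R)) ->
  measurable_fun setT (fun t => \det (M t) : R).
Proof.
move=> mM; apply: measurable_sum => s; apply: measurable_funM => //.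
by apply: measurable_prod => i _; exact: mM.
Qed.

(** The inverse is g times the power -1 of g^2, a measurable power taken at a nonnegative argument;
    where g vanishes both expressions are 0. *)
Lemma measurable_inv (g : T -> R) :
  measurable_fun setT g -> measurable_fun setT (fun t => (g t)^-1 : R).
Proof.
move=> mg; rewrite (_ : (fun _ => _) = (fun t => g t * (g t ^+ 2) `^ (-1))).
  apply: measurable_funM => //; apply: (measurableT_comp (measurable_powR (-1))).
  exact: measurable_funX.
apply/funext => t; rewrite powR_inv1 ?sqr_ge0// expr2.
have [->|g0] := eqVneq (g t) 0; first by rewrite invr0 !mul0r.
by rewrite invfM mulrA mulfV// mul1r.
Qed.

Lemma vmeas_add d (g h : T -> 'rV[R]_d) : vmeas g -> vmeas h -> vmeas (fun t => g t + h t).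
Proof.
move=> mg mh j; rewrite (_ : (fun _ => _) = (fun t => g t ord0 j + h t ord0 j)).
  by apply: measurable_funD; [exact: mg|exact: mh].
by apply/funext => t; rewrite mxE.
Qed.

Lemma vmeas_scale d (c : T -> R) (g : T -> 'rV[R]_d) : measurable_fun setT c ->
  vmeas g -> vmeas (fun t => c t *: g t).
Proof.
move=> mc mg j; rewrite (_ : (fun _ => _) = (fun t => c t * g t ord0 j)).
  by apply: measurable_funM; [exact: mc|exact: mg].
by apply/funext => t; rewrite mxE.
Qed.

Lemma measurable_edist d (g h : T -> 'rV[R]_d) : vmeas g -> vmeas h ->
  measurable_fun setT (fun t => edist (g t) (h t)).
Proof.
move=> mg mh; apply: (@measurableT_comp _ _ _ _ _ _ (@Num.sqrt R)).
  by apply: continuous_measurable_fun; exact: sqrt_continuous.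
apply: measurable_sum => i; apply: measurable_funX; apply: measurable_funB.
  exact: mg.
exact: mh.
Qed.

Variables (d k : nat) (Z : T -> 'I_k.+1 -> 'rV[R]_d).
Hypothesis mZ : forall i, vmeas (fun t => Z t i).

Lemma measurable_edges i j : measurable_fun setT (fun t => edges (Z t) i j : R).
Proof.
rewrite (_ : (fun _ => _) = (fun t => Z t (lift ord0 i) ord0 j - Z t ord0 ord0 j)).
  by apply: measurable_funB; exact: mZ.
by apply/funext => t; rewrite !mxE.
Qed.

Lemma measurable_gram i j : measurable_fun setT (fun t => gram (Z t) i j : R).
Proof.
rewrite (_ : (fun _ => _) = (fun t => \sum_l edges (Z t) i l * edges (Z t) j l)).
  by apply: measurable_sum => l; apply: measurable_funM; exact: measurable_edges.
by apply/funext => t; rewrite mxE; apply: eq_bigr => l _; rewrite [X in _ * X]mxE.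
Qed.

Lemma measurable_bary i : measurable_fun setT (fun t => bary (Z t) ord0 i : R).
Proof.
rewrite (_ : (fun _ => _) = (fun t => 2^-1 * \sum_l gram (Z t) l l *
   ((\det (gram (Z t)))^-1 * ((-1) ^+ (i + l) * \det (row' i (col' l (gram (Z t)))))))).
  apply: measurable_funM => //; apply: measurable_sum => l.
  apply: measurable_funM; first exact: measurable_gram.
  apply: measurable_funM.
    by apply: measurable_inv; apply: measurable_det => *; exact: measurable_gram.
  apply: measurable_funM => //; apply: measurable_det => a b.
  rewrite (_ : (fun _ => _) = (fun t => gram (Z t) (lift i a) (lift l b))).
    exact: measurable_gram.
  by apply/funext => t; rewrite mxE [LHS]mxE.
apply/funext => t; rewrite mxE [X in _ * X]mxE; congr (_ * _).
by apply: eq_bigr => l _; rewrite mxE; congr (_ * _); rewrite mxE; congr (_ * _); rewrite mxE.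
Qed.

Lemma measurable_good : measurable_fun setT (fun t => good (Z t)).
Proof.
apply: measurable_and.
  apply: measurable_neg; apply: measurable_fun_eqr => //.
  by apply: measurable_det => *; exact: measurable_gram.
apply: measurable_and; last first.
  by apply: measurable_fun_ltr => //; apply: measurable_sum => i; exact: measurable_bary.
apply: (measurable_fun_bool true); rewrite setTI.
rewrite (_ : _ @^-1` _ = \bigcap_(i in [set: 'I_k]) [set t | 0 < bary (Z t) ord0 i]).
  apply: fin_bigcap_measurable => // i _.
  rewrite (_ : [set _ | _] = (fun t => 0 < bary (Z t) ord0 i) @^-1` [set true]).
    rewrite -[X in measurable X]setTI.
    by apply: measurable_fun_ltr => //; exact: measurable_bary.
  by apply/seteqP; split.
apply/seteqP; split => t /=; first by move=> /forallP h i _; exact: h.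
by move=> h; apply/forallP => i; exact: h.
Qed.

Lemma vmeas_cc : vmeas (fun t => cc (Z t)).
Proof.
apply: vmeas_add; first exact: mZ.
move=> j; rewrite (_ : (fun _ => _) = (fun t => \sum_l bary (Z t) ord0 l * edges (Z t) l j)).
  apply: measurable_sum => l; apply: measurable_funM; first exact: measurable_bary.
  exact: measurable_edges.
by apply/funext => t; rewrite mxE.
Qed.

Lemma measurable_crad : measurable_fun setT (fun t => crad (Z t)).
Proof. by apply: measurable_edist; [exact: vmeas_cc|exact: mZ]. Qed.

End measurability.

Section equivariance.
Variables (d k : nat) (z : 'I_k.+1 -> 'rV[R]_d) (a : 'rV[R]_d) (c : R).
Hypothesis c0 : 0 < c.
Let z' := fun i => a + c *: z i.

Let edgesE : edges z' = c *: edges z.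
Proof. by apply/row_matrixP => i; rewrite linearZ/= !rowK /z' opprD addrACA subrr add0r scalerBr. Qed.

Let gramE : gram z' = c ^+ 2 *: gram z.
Proof. by rewrite /gram edgesE linearZ/= -scalemxAl -scalemxAr scalerA. Qed.

Let detE : (\det (gram z') != 0) = (\det (gram z) != 0).
Proof. by rewrite gramE detZ mulf_eq0 -exprM expf_eq0 gt_eqF// andbF. Qed.

(** The Gram matrix and its diagonal are both multiplied by c^2, so the linear system for the
    barycentric coordinates is unchanged. *)
Let baryE : \det (gram z) != 0 -> bary z' = bary z.
Proof.
move=> d0; apply/esym/baryP; first by rewrite detE.
have [_ /(_ erefl) H] := baryP (bary z) d0.
have -> : gramdiag z' = c ^+ 2 *: gramdiag z by apply/rowP => i; rewrite [LHS]mxE gramE [LHS]mxE [RHS]mxE [in RHS]mxE.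
by rewrite gramE -H -scalemxAr !scalerA mulrC.
Qed.

Lemma good_affine : good z' = good z.
Proof.
apply/and3P/and3P => -[d0 b1 b2].
  have dz : \det (gram z) != 0 by rewrite -detE.
  by split; [|rewrite -(baryE dz)|rewrite -(baryE dz)].
by split; [rewrite detE|rewrite (baryE d0)|rewrite (baryE d0)].
Qed.

Lemma cc_affine : good z -> cc z' = a + c *: cc z.
Proof.
move=> /and3P[d0 _ _]; rewrite /cc (baryE d0) edgesE -scalemxAr scalerDr.
by rewrite addrA.
Qed.

Lemma crad_affine : good z -> crad z' = c * crad z.
Proof. by move=> gz; rewrite /crad (cc_affine gz); exact: edist_scale (ltW c0). Qed.

End equivariance.
End circum.

(** * Counting critical points *)

Section count.
Variable R : realType.

Lemma esum_finType (T : finType) (A : set T) (p : pred T) : (forall t, A t <-> p t) ->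
  (\esum_(t in A) 1 = (\sum_t (p t)%:R)%:E :> \bar R)%E.
Proof.
move=> Ap; rewrite esum_mkcond esum_fset//; last by move=> i _; case: ifP.
rewrite (_ : [set: T] = [set` index_enum T]); last first.
  by apply/seteqP; split => t //= _; rewrite mem_index_enum.
rewrite -fsbig_seq ?index_enum_uniq// -sumEFin; apply: eq_bigr => t _.
  case: ifPn; first by rewrite inE => /Ap ->.
  by rewrite notin_setE => /Ap /negP/negbTE ->.
exact: finite_finset.
Qed.

Variables (d k m : nat).

(** Each set of k + 1 indices is listed by exactly one increasing tuple, so that no simplex is
    counted twice. *)
Definition increasing (t : k.+1.-tuple 'I_m) : bool := sorted ltn (map val t).

Definition sel (x : 'I_m -> 'rV[R]_d) (t : k.+1.-tuple 'I_m) : 'I_k.+1 -> 'rV[R]_d :=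
  fun i => x (tnth t i).

Definition crit_ind (r : R) (x : 'I_m -> 'rV[R]_d) (t : k.+1.-tuple 'I_m) : bool :=
  [&& good (sel x t), crad (sel x t) <= r &
    [forall j, (j \notin t) ==> (crad (sel x t) < edist (cc (sel x t)) (x j))]].

Lemma increasing_uniq t : increasing t -> uniq t.
Proof.
move=> /(sorted_uniq ltn_trans ltnn); rewrite map_inj_uniq//; exact: val_inj.
Qed.

Variables (r : R) (x : 'I_m -> 'rV[R]_d).
Hypothesis xinj : injective x.
Let P := [seq x i | i <- enum 'I_m].

Let memP i : x i \in P. Proof. by rewrite map_f// mem_enum. Qed.

Lemma crit_ind_edist t j : crit_ind r x t ->
  (crad (sel x t) <= edist (cc (sel x t)) (x j)) /\
  ((edist (cc (sel x t)) (x j) == crad (sel x t)) = (j \in t)).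
Proof.
move=> /and3P[g _ /forallP /(_ j)/implyP h].
have [jt|jt] := boolP (j \in t).
  have /tnthP[i ji] := jt.
  have jE : x j = sel x t i by rewrite /sel -ji.
  by rewrite jE good_edist// eqxx.
by have {}h := h jt; rewrite ltW// gt_eqF.
Qed.

(** Taking circumcenters is a bijection from the increasing tuples satisfying [crit_ind] to the
    critical points: the center determines the radius, as its distance to the sample, and then the
    tuple, as the indices of the points at that distance. *)
Lemma Ncrit_count :
  Ncrit k r P = (\sum_(t : k.+1.-tuple 'I_m | increasing t) (crit_ind r x t)%:R)%:E.
Proof.
pose A : set (k.+1.-tuple 'I_m) := [set t | increasing t && crit_ind r x t].
have AE : (\esum_(t in A) 1 = (\sum_(t : k.+1.-tuple 'I_m | increasing t) (crit_ind r x t)%:R)%:E :> \bar R)%E.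
  rewrite (@esum_finType _ _ (fun t => increasing t && crit_ind r x t))//.
  by rewrite [in RHS]big_mkcond; congr EFin; apply: eq_bigr => t _; case: increasing.
rewrite -AE -(@esum_image _ _ _ A (fun t => cc (sel x t)) (fun=> 1%E)); last first.
  move=> t t' /set_mem/andP[it ct] /set_mem/andP[it' ct'] ctt.
  have crE : crad (sel x t) = crad (sel x t').
    apply/eqP; rewrite eq_le; apply/andP; split.
      have [le1 _] := crit_ind_edist (tnth t' ord0) ct.
      by apply: le_trans le1 _; rewrite ctt; exact: lexx.
    have [le1 _] := crit_ind_edist (tnth t ord0) ct'.
    by apply: le_trans le1 _; rewrite -ctt; exact: lexx.
  apply: val_inj; apply: (inj_map val_inj).
  apply: (irr_sorted_eq ltn_trans ltnn) => //.
  have tt j : (j \in t) = (j \in t').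
    have [_ <-] := crit_ind_edist j ct; have [_ <-] := crit_ind_edist j ct'.
    by rewrite ctt crE.
  by move=> j; apply/mapP/mapP => -[i it1 ->]; exists i => //; [rewrite -tt|rewrite tt].
congr esum; apply/seteqP; split => c /=.
  move=> [rho [[[_ minrho] [y [yinj [yP [ai [eqd [far sc]]]]]]] rr]].
  have /choice[j jE] i : exists j, y i = x j by have /mapP[j _ ->] := yP i; exists j.
  have jinj : injective j by move=> a b ab; apply: yinj; rewrite !jE ab.
  pose leI (a b : 'I_m) := (a <= b)%N.
  (* The vertices of a critical point come in arbitrary order; sorting their indices gives the
     increasing tuple, and the properties of the simplex are carried along the sorting
     permutation. *)
  have szs : size (sort leI (codom j)) == k.+1 by rewrite size_sort size_codom card_ord.
  pose t : k.+1.-tuple 'I_m := Tuple szs.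
  have uc : uniq (codom j) by apply/injectiveP.
  have tinc : increasing t.
    rewrite /increasing ltn_sorted_uniq_leq map_inj_uniq ?sort_uniq ?uc; last exact: val_inj.
    by rewrite sorted_map; apply: (sort_sorted (leT := leI)) => a b; exact: leq_total.
  have /tuple_permP[s sE] : perm_eq t [tuple j i | i < k.+1].
    by rewrite /= perm_sort /= codomE enumT.
  have tE i : tnth t i = j (s i).
    have -> : t = [tuple tnth [tuple j i | i < k.+1] (s i) | i < k.+1] by exact: val_inj.
    by rewrite !tnth_mktuple.
  have selE : sel x t = y \o s by apply/funext => i; rewrite /sel tE/= jE.
  have [gz cE rE] : [/\ good (sel x t), c = cc (sel x t) & rho = crad (sel x t)].
    apply: critical_good.
    - by rewrite selE; exact: aff_indep_perm.
    - by rewrite selE; exact: simplex_perm.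
    - by rewrite selE => i; exact: eqd.
  exists t; last exact: esym.
  rewrite /A /mkset tinc andTb; apply/and3P; split; [exact: gz|by rewrite -rE|].
  apply/forallP => l; apply/implyP => lt; rewrite -rE -cE; apply: far => // i.
  rewrite jE; apply: contraNneq lt => /xinj ->.
  by apply/tnthP; exists ((s^-1)%g i); rewrite tE permKV.
move=> [t /andP[it ct] <-]; have /and3P[g cr _] := ct.
exists (crad (sel x t)); split => //; split.
  split; first by exists (x (tnth t ord0)).
  by move=> _ /mapP[j _ ->]; have [] := crit_ind_edist j ct.
exists (sel x t); split.
  by move=> a b /xinj; exact: (tuple_uniqP _ (increasing_uniq it)).
split; first by move=> i; exact: memP.
have [ai sc] := (goodP _).1 g.
split => //; split; first by move=> i; exact: good_edist.
split; last by rewrite -circumcenterE.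
move=> _ /mapP[j _ ->] jt; have [le1 e1] := crit_ind_edist j ct.
rewrite lt_neqAle le1 andbT eq_sym e1; apply/tnthP => -[i ji].
by have := jt i; rewrite ji eqxx.
Qed.

End count.

(** * Splitting off and relabelling points *)

Section palm_tools.
Variable R : realType.
Local Open Scope ereal_scope.

Lemma blk_scat_l d n i (s t : nat -> R) : (i < n)%N -> blk d i (scat (n * d) s t) = blk d i s.
Proof.
move=> ilt; apply/rowP => j; rewrite !mxE /scat ifT//.
by apply: (@leq_trans (i * d + d)); rewrite ?ltn_add2l// -mulSnr leq_mul2r ilt orbT.
Qed.

Lemma blk_scat_r d n i (s t : nat -> R) : blk d (n + i) (scat (n * d) s t) = blk d i t.
Proof.
apply/rowP => j; rewrite !mxE /scat ifF; first by rewrite mulnDl -addnA addKn.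
by apply/negbTE; rewrite -leqNgt mulnDl -addnA leq_addr.
Qed.

Lemma dep_blk d (T : Type) n i (g : 'rV[R]_d -> T) : (i < n)%N -> dep (n * d) (fun s => g (blk d i s)).
Proof.
move=> ilt s t st; congr g; apply/rowP => j; rewrite !mxE; apply: st.
by apply: (@leq_trans (i * d + d)); rewrite ?ltn_add2l// -mulSnr leq_mul2r ilt orbT.
Qed.

Lemma iint_prod d l (phi : 'rV[R]_d -> R) q :
  (forall i, measurable_fun setT (fun s : rseq R => phi (blk d i s))) ->
  (forall v, 0 <= phi v)%R ->
  \int[lebs R d]_s (phi (blk d 0 s))%:E = q%:E ->
  iint (l * d) (fun t => (\prod_(j < l) phi (blk d j t))%:E) = (q ^+ l)%:E.
Proof.
move=> mphi phi0 iphi; elim: l => [|l IH]; first by rewrite /= big_ord0.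
rewrite mulSn iint_add.
have mprod : measurable_fun setT (fun t : rseq R => (\prod_(j < l) phi (blk d j t))%:E).
  by apply/measurable_EFinP; apply: measurable_prod => j _; exact: mphi.
have prod0 (t : nat -> R) : (0 <= \prod_(j < l) phi (blk d j t))%R.
  by apply: prodr_ge0 => j _; exact: phi0.
transitivity (iint d (fun s => (phi (blk d 0 s))%:E * (q ^+ l)%:E)).
  congr iint; apply/funext => s; rewrite -IH.
  rewrite [RHS](_ : _ = (phi (blk d 0 s))%:E * \int[lebs R (l * d)]_t (\prod_(j < l) phi (blk d j t))%:E).
    rewrite -ge0_integralZl//; last 2 first.
    - by move=> t _; rewrite lee_fin.
    - by rewrite lee_fin.
      rewrite -iint_lebs//; last by move=> t; rewrite mule_ge0 ?lee_fin.
      congr iint; apply/funext => t; rewrite big_ord_recl -EFinM.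
      have := @blk_scat_l d 1 0 s t; rewrite mul1n => ->//; congr (_ * _)%:E.
      apply: eq_bigr => j _; congr phi; have := @blk_scat_r d 1 j s t.
      by rewrite mul1n.
      exact: measurable_funeM.
  by rewrite iint_lebs// => t; rewrite lee_fin.
rewrite iint_lebs; last by move=> s; rewrite mule_ge0 ?lee_fin// exprn_ge0// -lee_fin -iphi integral_ge0// => t _; rewrite lee_fin.
  rewrite ge0_integralZr//.
  - by rewrite iphi -EFinM exprS.
  - exact/measurable_EFinP.
  - by move=> s _; rewrite lee_fin.
  - by rewrite lee_fin exprn_ge0// -lee_fin -iphi integral_ge0// => t _; rewrite lee_fin.
by apply: emeasurable_funM => //; exact/measurable_EFinP.
Qed.

(** Coordinate p belongs to point p / d, at position p mod d; permuting the points moves the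
    quotient and keeps the remainder. *)
Lemma blk_perm d m (sigma : {perm 'I_m}) :
  exists p : {perm 'I_(m * d)}, forall (s : nat -> R) (i : 'I_m),
    blk d i (permseq p s) = blk d (sigma i) s.
Proof.
have [->|d0] := posnP d.
  by exists 1%g => s i; apply/rowP => -[].
have pd (p : 'I_(m * d)) : (p %/ d < m)%N by rewrite ltn_divLR.
pose q (p : 'I_(m * d)) : 'I_m := Ordinal (pd p).
have bnd (i : 'I_m) j : (j < d)%N -> (i * d + j < m * d)%N.
  move=> jd; apply: (@leq_trans (i * d + d)); rewrite ?ltn_add2l//.
  by rewrite -mulSnr leq_mul2r ltn_ord orbT.
pose g (p : 'I_(m * d)) : 'I_(m * d) := Ordinal (bnd (sigma (q p)) (p %% d)%N (ltn_pmod p d0)).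
have ginj : injective g.
  move=> a b /(congr1 val) /= ab.
  have /(congr1 (divn^~ d)) := ab; rewrite !divnMDl// !(divn_small (ltn_pmod _ d0)) !addn0 => /val_inj/perm_inj/(congr1 val)/= ab1.
  have /(congr1 (modn^~ d)) := ab; rewrite !modnMDl !modn_mod => ab2.
  by apply: val_inj => /=; rewrite (divn_eq a d) (divn_eq b d) ab1 ab2.
exists (perm ginj) => s i; apply/rowP => j; rewrite !mxE /permseq.
rewrite (insubT (fun x => (x < m * d)%N) (bnd i j (ltn_ord j))) permE /=; congr s.
rewrite modnMDl (modn_small (ltn_ord j)); congr (_ * _ + _)%N; congr (val (sigma _)).
by apply: val_inj; rewrite /= divnMDl// (divn_small (ltn_ord j)) addn0.
Qed.

(** The tuple is completed to a listing of all indices by appending the missing ones. *)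
Lemma perm_tuple m k (t : k.-tuple 'I_m) : uniq t ->
  exists s : {perm 'I_m}, forall (i : 'I_k) (j : 'I_m), i = j :> nat -> s j = tnth t i.
Proof.
move=> ut; have [m0|m0] := posnP m.
  by exists 1%g => i j; have := ltn_ord j; rewrite [X in (_ < X)%N]m0.
pose i0 := Ordinal m0.
pose l := t ++ [seq j <- enum 'I_m | j \notin t].
have ul : uniq l.
  rewrite cat_uniq ut filter_uniq ?enum_uniq// andbT; apply/hasPn => j.
  by rewrite mem_filter => /andP[].
have sl : size l = m.
  rewrite -[RHS](size_enum_ord m); apply/perm_size/uniq_perm => //; first exact: enum_uniq.
  by move=> j; rewrite mem_cat mem_filter mem_enum andbT orbN.
have inj : injective (fun j : 'I_m => nth i0 l j).
  move=> a b /eqP; rewrite nth_uniq ?sl// => /eqP; exact: val_inj.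
exists (perm inj) => i j ij; rewrite permE -ij nth_cat size_tuple ltn_ord.
by rewrite -tnth_nth.
Qed.

End palm_tools.

(** * The mean count as an integral over simplices *)

Section palm.
Variables (R : realType) (d k : nat) (f : 'rV[R]_d -> R).
Hypothesis d0 : (0 < d)%N.
Hypothesis bf : bounded_density f.
Local Open Scope ereal_scope.

Lemma density_ge0 x : (0 <= f x)%R. Proof. by have [_ []] := bf. Qed.
Hint Resolve density_ge0 : core.

Lemma measurable_density d' (T : measurableType d') (g : T -> 'rV[R]_d) :
  vmeas g -> measurable_fun setT (fun t => f (g t)).
Proof. by move=> mg; apply: borel_comp => //; have [] := bf. Qed.

Lemma integral_density : \int[lebs R d]_s (f (blk d 0 s))%:E = 1.
Proof.
have [_ [_ [_]]] := bf; rewrite /intRd => <-; rewrite iint_lebs//.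
- by apply/measurable_EFinP; apply: measurable_density; exact: (@vmeas_blk R d 0%N).
- by move=> s; rewrite lee_fin.
Qed.

Definition ballmass (c : 'rV[R]_d) (rho : R) : R :=
  fine (\int[lebs R d]_s (f (blk d 0 s) * (edist c (blk d 0 s) <= rho)%R%:R)%:E).

Lemma measurable_bool_nat d' (T : measurableType d') (b : T -> bool) :
  measurable_fun setT b -> measurable_fun setT (fun t => (b t)%:R : R).
Proof.
move=> mb; rewrite (_ : (fun _ => _) = (fun t => if b t then 1%R else 0%R)).
  exact: measurable_fun_ifT.
by apply/funext => t; case: (b t).
Qed.

Lemma measurable_fun_ler d' (T : measurableType d') (g h : T -> R) :
  measurable_fun setT g -> measurable_fun setT h -> measurable_fun setT (fun t => (g t <= h t)%R).
Proof.
move=> mg mh; rewrite (_ : (fun _ => _) = (fun t => ~~ (h t < g t)%R)).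
  by apply: measurable_neg; exact: measurable_fun_ltr.
by apply/funext => t; rewrite leNgt.
Qed.

Let mball d' (T : measurableType d') (c : T -> 'rV[R]_d) (rho : T -> R) :
  vmeas c -> measurable_fun setT rho ->
  measurable_fun setT (fun p : T * rseq R =>
    (f (blk d 0 p.2) * (edist (c p.1) (blk d 0 p.2) <= rho p.1)%R%:R)%:E).
Proof.
move=> mc mrho.
have mb : vmeas (fun p : T * rseq R => blk d 0 p.2).
  by move=> j; exact: (measurableT_comp (@vmeas_blk R d 0%N j)).
apply/measurable_EFinP; apply: measurable_funM; first exact: measurable_density.
apply: measurable_bool_nat; apply: measurable_fun_ler.
  by apply: measurable_edist => // j; exact: (measurableT_comp (mc j)).
exact: (measurableT_comp mrho).
Qed.

Let mball1 c rho : measurable_fun setT (fun s : rseq R =>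
    (f (blk d 0 s) * (edist c (blk d 0 s) <= rho)%R%:R)%:E).
Proof.
apply/measurable_EFinP; apply: measurable_funM.
  apply: measurable_density; exact: vmeas_blk.
apply: measurable_bool_nat; apply: measurable_fun_ler => //.
by apply: measurable_edist; [move=> j|exact: vmeas_blk].
Qed.

Lemma ballmassE c rho :
  \int[lebs R d]_s (f (blk d 0 s) * (edist c (blk d 0 s) <= rho)%R%:R)%:E = (ballmass c rho)%:E.
Proof.
rewrite fineK// ge0_fin_numE; last by apply: integral_ge0 => s _; rewrite lee_fin mulr_ge0.
apply: (@le_lt_trans _ _ 1); last by rewrite ltry.
rewrite -integral_density; apply: le_integral_nomeas => s; rewrite lee_fin ?mulr_ge0//.
by rewrite ler_piMr// lern1 leq_b1.
Qed.

Lemma ballmass_ge0 c rho : (0 <= ballmass c rho)%R.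
Proof. by apply: fine_ge0; apply: integral_ge0 => s _; rewrite lee_fin mulr_ge0. Qed.

Lemma outmassE c rho :
  \int[lebs R d]_s (f (blk d 0 s) * (rho < edist c (blk d 0 s))%R%:R)%:E = (1 - ballmass c rho)%:E.
Proof.
rewrite EFinB -ballmassE; apply/esym/eqP; rewrite -integral_density.
have -> : \int[lebs R d]_s (f (blk d 0 s))%:E =
   \int[lebs R d]_s ((f (blk d 0 s) * (rho < edist c (blk d 0 s))%R%:R)%:E +
     (f (blk d 0 s) * (edist c (blk d 0 s) <= rho)%R%:R)%:E).
  apply: eq_integral => s _; rewrite -EFinD -mulrDr ltNge.
  by case: (_ <= _)%R; rewrite /= ?addr0 ?add0r mulr1.
rewrite ge0_integralD//=; first last.
- by move=> s _; rewrite lee_fin mulr_ge0.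
- apply/measurable_EFinP; apply: measurable_funM.
    apply: measurable_density; exact: vmeas_blk.
  apply: measurable_bool_nat; apply: measurable_fun_ltr => //.
  by apply: measurable_edist; [move=> j|exact: vmeas_blk].
- by move=> s _; rewrite lee_fin mulr_ge0.
by rewrite addeK// ballmassE.
Qed.

Lemma ballmass_le1 c rho : (ballmass c rho <= 1)%R.
Proof.
rewrite -subr_ge0 -lee_fin -outmassE; apply: integral_ge0 => s _.
by rewrite lee_fin mulr_ge0.
Qed.

Lemma measurable_ballmass d' (T : measurableType d') (c : T -> 'rV[R]_d) (rho : T -> R) :
  vmeas c -> measurable_fun setT rho -> measurable_fun setT (fun t => ballmass (c t) (rho t)).
Proof.
move=> mc mrho; apply/measurable_EFinP.
rewrite (_ : _ \o _ = fun t => \int[lebs R d]_s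
   (f (blk d 0 s) * (edist (c t) (blk d 0 s) <= rho t)%R%:R)%:E); last first.
  by apply/funext => t; rewrite /= ballmassE.
apply: (@measurable_integral_lebs R _ T d (fun p =>
   (f (blk d 0 p.2) * (edist (c p.1) (blk d 0 p.2) <= rho p.1)%R%:R)%:E)).
  exact: mball.
by move=> p; rewrite lee_fin mulr_ge0.
Qed.

Definition pts (s : nat -> R) : 'I_k.+1 -> 'rV[R]_d := fun i => blk d i s.

Definition palm_int (r : R) l := \int[lebs R (k.+1 * d)]_s
  ((good (pts s) && (crad (pts s) <= r)%R)%:R * (\prod_(i < k.+1) f (blk d i s)) *
    (1 - ballmass (cc (pts s)) (crad (pts s))) ^+ l)%:E.

Lemma vmeas_pts i : vmeas (fun s : rseq R => pts s i).
Proof. exact: vmeas_blk. Qed.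

Variable r : R.

Section fixed_m.
Variable m : nat.

Definition config (s : nat -> R) : 'I_m -> 'rV[R]_d := fun i => blk d i s.

Definition crit_weight (t : k.+1.-tuple 'I_m) (s : nat -> R) : R :=
  ((crit_ind r (config s) t)%:R * \prod_(i < m) f (blk d i s))%R.

Lemma crit_weight_ge0 t s : (0 <= crit_weight t s)%R.
Proof. by rewrite mulr_ge0// prodr_ge0. Qed.

Lemma measurable_crit_weight t : measurable_fun setT (crit_weight t : rseq R -> R).
Proof.
have msel i : vmeas (fun s : rseq R => sel (config s) t i) by exact: vmeas_blk.
apply: measurable_funM; last first.
  by apply: measurable_prod => i _; apply: measurable_density; exact: vmeas_blk.
apply: measurable_bool_nat; apply: measurable_and; first exact: measurable_good.
apply: measurable_and.
  by apply: measurable_fun_ler => //; exact: measurable_crad.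
apply: (measurable_fun_bool true); rewrite setTI.
rewrite (_ : _ @^-1` _ = \bigcap_(j in [set j | j \notin t])
   ((fun s : rseq R => crad (sel (config s) t) < edist (cc (sel (config s) t)) (config s j))%R @^-1` [set true])).
  apply: fin_bigcap_measurable => [|j _]; first exact: finite_finset.
  rewrite -[X in measurable X]setTI; apply: measurable_fun_ltr => //.
    exact: measurable_crad.
  by apply: measurable_edist; [exact: vmeas_cc|exact: vmeas_blk].
apply/seteqP; split => s /=; first by move=> /forallP h j jt; have /implyP := h j; exact.
by move=> h; apply/forallP => j; apply/implyP => jt; exact: h.
Qed.

(** Coinciding points share their first coordinate, so a finite union of diagonals contains all
    ties; it is written as a countable union to use countable subadditivity. *)
Lemma null_ties : lebs R (m * d) (\bigcup_(p in [set p : 'I_m * 'I_m | (p.1 < p.2)%N])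
  [set s | s (p.1 * d)%N = s (p.2 * d)%N]) = 0.
Proof.
set F := fun p : 'I_m * 'I_m => [set s : rseq R | s (p.1 * d)%N = s (p.2 * d)%N].
have mN : measurable (\bigcup_(p in [set p : 'I_m * 'I_m | (p.1 < p.2)%N]) F p).
  by apply: fin_bigcup_measurable => [|p _]; [exact: finite_finset|exact: measurable_diag].
apply: (measure_negligible mN).
pose G n := if (unpickle n : option ('I_m * 'I_m)) is Some p then
  (if (p.1 < p.2)%N then F p else set0) else set0.
apply: (@negligibleS _ _ _ _ (\bigcup_n G n)).
  by move=> s [p /= pp Fps]; exists (pickle p) => //; rewrite /G pickleK pp.
apply: negligible_bigcup => n; rewrite /G; case: unpickle => [p|]; last exact: negligible_set0.
case: ifPn => [pp|_]; last exact: negligible_set0.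
apply/negligibleP; first exact: measurable_diag.
by apply: null_diag; rewrite !ltn_pmul2r// pp ltn_ord.
Qed.

(** The counting formula requires distinct points, hence holds off the null set N. To avoid
    measurability of [Ncrit] on N, the integrand is squeezed between two measurable functions: the
    finite sum with value 0 on N, and the sum increased by +oo on N. *)
Lemma ENbin_weights :
  ENbin k f r m = \sum_(t : k.+1.-tuple 'I_m | increasing t)
    \int[lebs R (m * d)]_s (crit_weight t s)%:E.
Proof.
pose F2 (s : nat -> R) := (\sum_(t : k.+1.-tuple 'I_m | increasing t) crit_weight t s)%R.
have F20 s : (0 <= F2 s)%R by apply: sumr_ge0 => t _; exact: crit_weight_ge0.
have mF2 : measurable_fun setT (F2 : rseq R -> R).
  rewrite (_ : F2 = fun s => \sum_(t <- enum [pred t : k.+1.-tuple 'I_m | increasing t]) crit_weight t s)%R.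
    by apply: measurable_sum => t; exact: measurable_crit_weight.
  by apply/funext => s; rewrite big_enum.
transitivity (\int[lebs R (m * d)]_s (F2 s)%:E); last first.
  under eq_integral do rewrite -sumEFin.
  rewrite -big_enum/= -ge0_integral_sum//.
  - by apply: eq_integral => s _; rewrite big_enum.
  - by move=> t; apply/measurable_EFinP; exact: measurable_crit_weight.
  - by move=> t s _; rewrite lee_fin crit_weight_ge0.
set N := \bigcup_(p in [set p : 'I_m * 'I_m | (p.1 < p.2)%N])
  [set s : rseq R | s (p.1 * d)%N = s (p.2 * d)%N].
have mN : measurable N.
  by apply: fin_bigcup_measurable => [|p _]; [exact: finite_finset|exact: measurable_diag].
have NF s : ~ N s -> (Ncrit k r [seq config s i | i <- enum 'I_m] * (\prod_(i < m) f (config s i))%:E) = (F2 s)%:E.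
  move=> Ns; rewrite Ncrit_count; last first.
    have key (i j : 'I_m) : (i < j)%N -> config s i <> config s j.
      move=> ij e; apply: Ns; exists (i, j) => //=.
      by move/rowP: e => /(_ (Ordinal d0)); rewrite !mxE /= !addn0.
    move=> i j ij; apply: val_inj; case: (ltngtP i j) => //.
      by move=> /key; rewrite ij.
    by move=> /key; rewrite ij.
  by rewrite -EFinM mulr_suml.
have F10 s : 0 <= Ncrit k r [seq config s i | i <- enum 'I_m] * (\prod_(i < m) f (config s i))%:E.
  rewrite mule_ge0 ?lee_fin ?prodr_ge0//; exact: esum_ge0.
apply/eqP; rewrite eq_le; apply/andP; split.
- apply: (@le_trans _ _ (iint (m * d) (fun s => (F2 s)%:E + (if s \in N then +oo else 0)))).
    apply: le_iint => s; first exact: F10.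
    case: ifPn => sN; first by rewrite addey ?leey.
    by rewrite notin_setE in sN; rewrite adde0 -NF.
  have mI : measurable_fun setT (fun s : rseq R => if s \in N then +oo else 0 : \bar R).
    apply: measurable_fun_ifT => //; apply: (measurable_fun_bool true).
    rewrite setTI (_ : _ @^-1` _ = N)//; apply/seteqP; split => s /=; first exact: set_mem.
    exact: mem_set.
  have I0 (s : nat -> R) : 0 <= (if s \in N then +oo else 0 : \bar R).
    by case: ifP.
  rewrite iint_lebs; last by move=> s; rewrite adde_ge0 ?lee_fin.
    rewrite ge0_integralD//; [|by move=> s _; rewrite lee_fin|exact/measurable_EFinP].
    rewrite [X in _ + X](_ : _ = 0) ?adde0//.
    rewrite (@ae_eq_integral _ _ _ (lebs R (m * d)) setT (cst 0))// ?integral0//.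
    exists N; split => //; first exact: null_ties.
    move=> s /= h; apply: contrapT => sN; apply: h => _.
    by rewrite memNset.
  by apply: emeasurable_funD => //; exact/measurable_EFinP.
- have mI : measurable_fun setT (fun s : rseq R => if s \in N then 0 else (F2 s)%:E).
    apply: measurable_fun_ifT => //; last exact/measurable_EFinP.
    apply: (measurable_fun_bool true).
    rewrite setTI (_ : _ @^-1` _ = N)//; apply/seteqP; split => s /=; first exact: set_mem.
    exact: mem_set.
  have I0 (s : nat -> R) : 0 <= (if s \in N then 0 else (F2 s)%:E).
    by case: ifP => // _; rewrite lee_fin.
  apply: (@le_trans _ _ (iint (m * d) (fun s => if s \in N then 0 else (F2 s)%:E))).
    rewrite iint_lebs// (@ae_eq_integral _ _ _ (lebs R (m * d)) setT (fun s => (if s \in N then 0 else (F2 s)%:E)))//.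
      exact/measurable_EFinP.
    exists N; split => //; first exact: null_ties.
    move=> s /= h; apply: contrapT => sN; apply: h => _.
    by rewrite memNset.
  apply: le_iint => // s; case: ifPn => sN; first exact: F10.
  by rewrite notin_setE in sN; rewrite -NF.
Qed.

(** A relabelling moves t to the first k + 1 indices. For fixed vertices, each of the other m - k -
    1 points independently avoids the closed circumscribed ball with probability 1 - [ballmass]. *)
Lemma integral_crit_weight t : increasing t ->
  \int[lebs R (m * d)]_s (crit_weight t s)%:E = palm_int r (m - k.+1).
Proof.
move=> inct; have ut := increasing_uniq inct.
have km : (k.+1 <= m)%N.
  by rewrite -(card_ord m) -(size_tuple t) -(card_uniqP ut) max_card.
pose t0 : k.+1.-tuple 'I_m := [tuple widen_ord km i | i < k.+1].
have [sigma sigmaE] := perm_tuple ut.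
have [p pE] := @blk_perm R d m sigma.
(* The product of the densities is symmetric, and the condition on the points outside the tuple only
   involves membership, which sigma transports from t0 to t. *)
have wE s : crit_weight t s = crit_weight t0 (permseq p s).
  have cE (i : 'I_m) : config (permseq p s) i = config s (sigma i) by exact: pE.
  have selE : sel (config (permseq p s)) t0 = sel (config s) t.
    apply/funext => i; rewrite /sel cE tnth_mktuple; congr (config s _).
    exact: sigmaE.
  rewrite /crit_weight /crit_ind selE; congr (_%:R * _)%R.
    congr nat_of_bool; congr [&& _, _ & _].
    have t0t j : (j \in t0) = (sigma j \in t).
      apply/tnthP/tnthP => -[i ji]; exists i.
        by apply: sigmaE; rewrite ji tnth_mktuple.
      rewrite tnth_mktuple; apply: (@perm_inj _ sigma); rewrite ji.
      by apply/esym/sigmaE.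
    apply/forallP/forallP => h j.
      by rewrite t0t cE; exact: h.
    by have := h ((sigma^-1)%g j); rewrite t0t cE permKV.
  rewrite (reindex_inj (@perm_inj _ sigma)).
  by apply: eq_bigr => i _; rewrite pE.
under eq_integral do rewrite wE.
rewrite (integral_perm p (F := fun s => (crit_weight t0 s)%:E)); last 2 first.
- by apply/measurable_EFinP; exact: measurable_crit_weight.
- by move=> s; rewrite lee_fin crit_weight_ge0.
rewrite -iint_lebs; last 2 first.
- by apply/measurable_EFinP; exact: measurable_crit_weight.
- by move=> s; rewrite lee_fin crit_weight_ge0.
set l := (m - k.+1)%N; have mE : m = (k.+1 + l)%N by rewrite subnKC.
pose A (s : nat -> R) := ((good (pts s) && (crad (pts s) <= r)%R)%:R *
   (\prod_(i < k.+1) f (blk d i s)))%R.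
pose phi (s : nat -> R) v := (f v * (crad (pts s) < edist (cc (pts s)) v)%R%:R)%R.
have A0 s : (0 <= A s)%R by rewrite mulr_ge0// prodr_ge0.
have phi0 s v : (0 <= phi s v)%R by rewrite mulr_ge0.
have mphi s i : measurable_fun setT (fun u : rseq R => phi s (blk d i u)).
  apply: measurable_funM; first by apply: measurable_density; exact: vmeas_blk.
  apply: measurable_bool_nat; apply: measurable_fun_ltr => //.
  by apply: measurable_edist; [move=> j|exact: vmeas_blk].
have prodE (s u : nat -> R) : crit_weight t0 (scat (k.+1 * d) s u) =
    (A s * \prod_(j < l) phi s (blk d j u))%R.
  have selE : sel (config (scat (k.+1 * d) s u)) t0 = pts s.
    apply/funext => i; rewrite /sel /config tnth_mktuple /= blk_scat_l//.
  rewrite /crit_weight /crit_ind selE.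
  have -> : (\prod_(i < m) f (blk d i (scat (k.+1 * d) s u)))%R =
      (\prod_(i < k.+1) f (blk d i s) * \prod_(j < l) f (blk d j u))%R.
    rewrite -(big_mkord xpredT (fun i => f (blk d i (scat (k.+1 * d) s u)))) mE big_mkord.
    rewrite big_split_ord; congr (_ * _)%R; apply: eq_bigr => i _.
      by rewrite /= blk_scat_l.
    by rewrite /= blk_scat_r.
  have allE : [forall j, (j \notin t0) ==> (crad (pts s) < edist (cc (pts s))
      (config (scat (k.+1 * d) s u) j))%R] =
      [forall j : 'I_l, (crad (pts s) < edist (cc (pts s)) (blk d j u))%R].
    apply/forallP/forallP => h j.
      have jm : (k.+1 + j < m)%N by rewrite mE ltn_add2l.
      have := h (Ordinal jm); rewrite /config /= blk_scat_r => /implyP; apply.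
      apply/tnthP => -[i]; rewrite tnth_mktuple => /(congr1 val) /= ji.
      by have := ltn_ord i; rewrite -ji ltnNge leq_addr.
    apply/implyP => jt.
    have kj : (k.+1 <= j)%N.
      rewrite leqNgt; apply: contra jt => jk; apply/tnthP; exists (Ordinal jk).
      by rewrite tnth_mktuple; exact: val_inj.
    have jl : (j - k.+1 < l)%N by rewrite ltn_sub2r// (leq_ltn_trans kj).
    have := h (Ordinal jl); rewrite /config.
    by rewrite -[in X in _ -> X](subnKC kj) blk_scat_r.
  rewrite allE /A /phi big_split /= -!mulrA.
  have -> : (\prod_(j < l) (crad (pts s) < edist (cc (pts s)) (blk d j u))%R%:R)%R =
     [forall j : 'I_l, (crad (pts s) < edist (cc (pts s)) (blk d j u))%R]%:R :> R.
    have [/forallP h|/forallPn[j jn]] :=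
      boolP [forall j : 'I_l, (crad (pts s) < edist (cc (pts s)) (blk d j u))%R].
      by rewrite big1// => j _; rewrite h.
    by rewrite (bigD1 j)//= (negbTE jn) mul0r.
  rewrite andbA -mulnb natrM; ring.
rewrite (_ : (m * d = k.+1 * d + l * d)%N); last by rewrite mE mulnDl.
rewrite iint_add /palm_int -iint_lebs; last 2 first.
- apply/measurable_EFinP; apply: measurable_funM; first apply: measurable_funM.
  + apply: measurable_bool_nat; apply: measurable_and; first exact: (measurable_good vmeas_pts).
    by apply: measurable_fun_ler => //; exact: (measurable_crad vmeas_pts).
  + by apply: measurable_prod => i _; apply: measurable_density; exact: vmeas_blk.
  + apply: measurable_funX; apply: measurable_funB => //; apply: measurable_ballmass.
      exact: (vmeas_cc vmeas_pts).
    exact: (measurable_crad vmeas_pts).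
- move=> s; rewrite lee_fin mulr_ge0//; first by rewrite mulr_ge0// prodr_ge0.
  by rewrite exprn_ge0// subr_ge0 ballmass_le1.
congr iint; apply/funext => s.
under [X in iint _ X]eq_fun do rewrite prodE.
rewrite iint_lebs; last 2 first.
- apply/measurable_EFinP; apply: measurable_funM => //.
  by apply: measurable_prod => i _; exact: mphi.
- by move=> t1; rewrite lee_fin mulr_ge0// prodr_ge0.
under eq_integral do rewrite EFinM.
rewrite ge0_integralZl//; last 3 first.
- by apply/measurable_EFinP; apply: measurable_prod => i _; exact: mphi.
- by move=> t1 _; rewrite lee_fin prodr_ge0.
- by rewrite lee_fin.
rewrite -iint_lebs; last 2 first.
- by apply/measurable_EFinP; apply: measurable_prod => i _; exact: mphi.
- by move=> t1; rewrite lee_fin prodr_ge0.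
rewrite [RHS]EFinM; congr (_ * _); apply: iint_prod => //; exact: outmassE.
Qed.

(** All increasing tuples contribute equally and their number is the binomial coefficient. For m <=
    k that coefficient is 0, so the truncated difference m - k - 1 does no harm. *)
Lemma ENbin_palm : ENbin k f r m = 'C(m, k.+1)%:R%:E * palm_int r (m - k.+1).
Proof.
rewrite ENbin_weights (eq_bigr _ (fun t => @integral_crit_weight t)).
rewrite -card_ltn_sorted_tuples mule_natl.
rewrite (eq_bigl (fun t => t \in finset (fun t : k.+1.-tuple 'I_m => sorted ltn (map val t)))); last first.
  by move=> t; rewrite finset.inE.
rewrite big_const.
set n := (X in iter X); set n' := (X in _ = _ *+ X).
have -> : n = n' by apply: eq_card => t; rewrite !inE.
by elim: n' => [|n' IH]; [|rewrite iterS IH muleS].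
Qed.

End fixed_m.
End palm.

(** * Rescaling and the limit for a fixed simplex *)

Lemma iint_mulS (R : realType) d k (F : (nat -> R) -> \bar R) :
  iint (k.+1 * d) F = iint d (fun s => iint (k * d) (fun t => F (scat d s t))).
Proof. by rewrite mulSn iint_add. Qed.

Section scale.
Variables (R : realType) (d k : nat) (f : 'rV[R]_d -> R).
Hypothesis d0 : (0 < d)%N.
Hypothesis bf : bounded_density f.
Local Open Scope ereal_scope.
Let f0 := density_ge0 bf.
Local Hint Resolve f0 : core.

(** Q p stands for the weight of the event that no other point falls in a circumscribed ball of mass
    p. The choice (1 - p)^l gives [palm_int] at l, and exp(- n p) gives the Poisson process. *)
Definition palm_gen (r : R) (Q : R -> R) := \int[lebs R (k.+1 * d)]_s
  ((good (@pts R d k s) && (crad (@pts R d k s) <= r)%R)%:R *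
    (\prod_(i < k.+1) f (blk d i s)) *
    Q (ballmass f (cc (@pts R d k s)) (crad (@pts R d k s))))%:E.

Definition ypts (y : nat -> R) : 'I_k.+1 -> 'rV[R]_d := with0 (fun i : 'I_k => blk d i y).

Definition scaled_weight (a : R) (Q : R -> R) (y : nat -> R) (x : 'rV[R]_d) : R :=
  (f x * (\prod_(i < k) f (x + a *: blk d i y)) *
    Q (ballmass f (x + a *: cc (ypts y)) (a * crad (ypts y))))%R.

Lemma vmeas_ypts i : vmeas (fun y : rseq R => ypts y i).
Proof.
rewrite /ypts /with0; case: unliftP => [j _|_]; first exact: vmeas_blk.
by move=> j; rewrite (_ : (fun _ => _) = cst 0%R)//; apply/funext => y; rewrite mxE.
Qed.

Variables (Q : R -> R).
Hypothesis mQ : measurable_fun setT Q.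
Hypothesis Q0 : forall p : R, (0 <= p <= 1)%R -> (0 <= Q p)%R.

Let Qb c rho : (0 <= Q (ballmass f c rho))%R.
Proof. by apply: Q0; rewrite ballmass_ge0//= ballmass_le1. Qed.

Lemma scaled_weight_ge0 (a : R) y x : (0 <= scaled_weight a Q y x)%R.
Proof. by rewrite !mulr_ge0// prodr_ge0. Qed.

Lemma measurable_scaled_weight (a : R) :
  measurable_fun setT (fun p : rseq R * rseq R => scaled_weight a Q p.1 (blk d 0 p.2)).
Proof.
have mb : vmeas (fun p : rseq R * rseq R => blk d 0 p.2).
  by move=> j; exact: (measurableT_comp (@vmeas_blk R d 0%N j)).
have mc : vmeas (fun p : rseq R * rseq R => cc (ypts p.1)).
  by move=> j; exact: (measurableT_comp (@vmeas_cc _ _ _ _ _ _ vmeas_ypts j)).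
have mr : measurable_fun setT (fun p : rseq R * rseq R => crad (ypts p.1)).
  exact: (measurableT_comp (measurable_crad vmeas_ypts)).
have my i : vmeas (fun p : rseq R * rseq R => blk d i p.1).
  by move=> j; exact: (measurableT_comp (@vmeas_blk R d i j)).
have mcst : measurable_fun setT (fun p : rseq R * rseq R => a) by exact: measurable_cst.
apply: measurable_funM.
  apply: measurable_funM; first exact: (measurable_density bf).
  apply: measurable_prod => i _; apply: (measurable_density bf).
  by apply: vmeas_add => //; apply: vmeas_scale.
apply: (measurableT_comp mQ); apply: measurable_ballmass => //.
  by apply: vmeas_add => //; exact: vmeas_scale.
exact: measurable_funM.
Qed.

(* Substitution of x + a y_i for the vertices other than the first one, x. *)
Lemma palm_scale (a r : R) : (0 < a)%R ->
  palm_gen r Q = (a ^+ (k * d))%:E * \int[lebs R (k * d)]_y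
    ((good (ypts y) && (a * crad (ypts y) <= r)%R)%:R%:E *
     \int[lebs R d]_x (scaled_weight a Q y (blk d 0 x))%:E).
Proof.
move=> a0.
pose W (z : 'I_k.+1 -> 'rV[R]_d) : R := ((good z && (crad z <= r)%R)%:R * (\prod_(i < k.+1) f (z i)) *
    Q (ballmass f (cc z) (crad z)))%R.
have W0 z : (0 <= W z)%R by rewrite !mulr_ge0// prodr_ge0.
have mW d' (T : measurableType d') (Z : T -> 'I_k.+1 -> 'rV[R]_d) :
    (forall i, vmeas (fun t => Z t i)) -> measurable_fun setT (fun t => W (Z t)).
  move=> mZ; apply: measurable_funM; first apply: measurable_funM.
  - apply: measurable_bool_nat; apply: measurable_and; first exact: (measurable_good mZ).
    by apply: measurable_fun_ler => //; exact: (measurable_crad mZ).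
  - by apply: measurable_prod => i _; apply: (measurable_density bf); exact: mZ.
  - apply: (measurableT_comp mQ); apply: measurable_ballmass => //.
      exact: (vmeas_cc mZ).
    exact: (measurable_crad mZ).
pose Z (x u : nat -> R) : 'I_k.+1 -> 'rV[R]_d :=
  fun i => if unlift ord0 i is Some j then blk d j u else blk d 0 x.
have mZ i : vmeas (fun p : rseq R * rseq R => Z p.1 p.2 i).
  rewrite /Z; case: unliftP => [j _|_] l.
    exact: (measurableT_comp (@vmeas_blk R d j l)).
  exact: (measurableT_comp (@vmeas_blk R d 0%N l)).
have mZ2 x i : vmeas (fun u : rseq R => Z x u i).
  rewrite /Z; case: unliftP => [j _|_] l; first exact: vmeas_blk.
  exact: measurable_cst.
pose Y (x y : nat -> R) (i : 'I_k.+1) : 'rV[R]_d := (blk d 0 x + a *: ypts y i)%R.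
have mY i : vmeas (fun p : rseq R * rseq R => Y p.1 p.2 i).
  apply: vmeas_add.
    by move=> l; exact: (measurableT_comp (@vmeas_blk R d 0%N l)).
  apply: vmeas_scale; first exact: measurable_cst.
  by move=> l; exact: (measurableT_comp (vmeas_ypts i l)).
have WY x y : W (Y x y) = ((good (ypts y) && (a * crad (ypts y) <= r)%R)%:R *
    scaled_weight a Q y (blk d 0 x))%R.
  rewrite /W /scaled_weight (good_affine _ _ a0).
  have [gy|] := boolP (good (ypts y)); last by rewrite /= !mul0r.
  rewrite (crad_affine _ a0 gy) (cc_affine _ a0 gy) -!mulrA; congr (_ * _)%R.
  rewrite big_ord_recl -!mulrA; congr (_ * (_ * _))%R.
    by rewrite /Y /ypts /with0 unlift_none scaler0 addr0.
  by apply: eq_bigr => i _; rewrite /Y /ypts /with0 liftK.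
have -> : palm_gen r Q = \int[lebs R (k.+1 * d)]_s (W (@pts R d k s))%:E by [].
clearbody W.
rewrite -iint_lebs; last 2 first.
- by apply/measurable_EFinP; apply: mW => i; exact: vmeas_blk.
- by move=> s; rewrite lee_fin.
transitivity (iint d (fun x => iint (k * d) (fun t => (W (@pts R d k (scat d x t)))%:E))).
  exact: (@iint_mulS R d k (fun s => (W (@pts R d k s))%:E)).
transitivity (iint d (fun x => (a ^+ (k * d))%:E * \int[lebs R (k * d)]_y (W (Y x y))%:E)).
  congr iint; apply/funext => x.
  have -> : (fun t => (W (@pts R d k (scat d x t)))%:E) = (fun t => (W (Z x t))%:E).
    apply/funext => t; congr (W _)%:E; apply/funext => i; rewrite /pts /Z.
    case: unliftP => [j ->|->].
      by have := @blk_scat_r R d 1 j x t; rewrite mul1n.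
    by have := @blk_scat_l R d 1 0 x t; rewrite mul1n => ->.
  rewrite iint_lebs; last 2 first.
  - by apply/measurable_EFinP; exact: mW.
  - by move=> s; rewrite lee_fin.
  (* All k blocks are translated by the same point x, so coordinate j moves by x (j mod d); this is
     the translation given to [integral_affine]. *)
  apply/esym; apply: etrans; last first.
    apply: (@integral_affine R (k * d) (fun j => x (j %% d)%N) a (fun t => (W (Z x t))%:E) a0).
  - move=> s t st; congr (W _)%:E; apply/funext => i; rewrite /Z; case: unliftP => // j _.
    exact: (@dep_blk R d _ k j id).
  - by apply/measurable_EFinP; exact: mW.
  - by move=> s; rewrite lee_fin.
  congr (_ * _); apply: eq_integral => y _; congr (W _)%:E; apply/esym/funext => i.
  rewrite /Z /Y /ypts /with0; case: unliftP => [j _|_]; last by rewrite scaler0 addr0.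
  apply/rowP => l; rewrite !mxE modnMDl (modn_small (ltn_ord l)).
  by congr (x _ + _)%R.
have mWY : measurable_fun setT (fun p : rseq R * rseq R => (W (Y p.1 p.2))%:E).
  by apply/measurable_EFinP; exact: mW.
have ad0 : 0 <= (a ^+ (k * d))%:E by rewrite lee_fin exprn_ge0// ltW.
have WYi x : 0 <= \int[lebs R (k * d)]_y (W (Y x y))%:E.
  by apply: integral_ge0 => y _; rewrite lee_fin.
have mWYi : measurable_fun setT (fun x : rseq R => \int[lebs R (k * d)]_y (W (Y x y))%:E).
  apply: (@measurable_integral_lebs R _ (rseq R) (k * d) (fun p => (W (Y p.1 p.2))%:E)) => //.
  by move=> p; rewrite lee_fin.
rewrite iint_lebs; last 2 first.
- exact: measurable_funeM.
- by move=> x; rewrite mule_ge0.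
rewrite ge0_integralZl//; congr (_ * _).
have := @fubini_tonelli _ _ _ _ R (lebs R d) (lebs R (k * d)) (fun p => (W (Y p.1 p.2))%:E).
move=> ->//; last by move=> p; rewrite lee_fin.
apply: eq_integral => y _; rewrite /fubini_G/=.
rewrite -ge0_integralZl//; last 2 first.
- apply/measurable_EFinP.
  have /= := @measurableT_comp _ _ _ _ _ _ _ _ (fun x : rseq R => (y, x)) (measurable_scaled_weight a).
  by apply; exact: measurable_pair1.
- by move=> x _; rewrite lee_fin scaled_weight_ge0.
by apply: eq_integral => x _; rewrite WY EFinM.
Qed.

End scale.

(** * Elementary inequalities *)

Section real_bounds.
Variable R : realType.
Implicit Types (M p : R).

Lemma dist_prod_pow M k (g : 'I_k -> R) (g0 : R) : 1 <= M -> 0 <= g0 <= M ->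
  (forall i, 0 <= g i <= M) ->
  `|\prod_(i < k) g i - g0 ^+ k| <= M ^+ k * \sum_(i < k) `|g i - g0|.
Proof.
move=> M1 /andP[g00 g0M]; have M0 : 0 <= M by rewrite (le_trans _ M1).
elim: k g => [|k IH] g gM; first by rewrite !big_ord0 expr0 subrr normr0 mulr0.
rewrite !big_ord_recl.
rewrite (_ : _ - _ = g ord0 * (\prod_(i < k) g (lift ord0 i) - g0 ^+ k) +
  (g ord0 - g0) * g0 ^+ k); last by rewrite exprS; ring.
apply: le_trans (ler_normD _ _) _; rewrite !normrM.
rewrite mulrDr [leRHS]addrC; apply: lerD.
  have /andP[gi0 giM] := gM ord0; rewrite ger0_norm// exprS -mulrA.
  by apply: ler_pM => //; apply: IH => i; exact: gM.
rewrite mulrC; apply: ler_wpM2r => //; rewrite ger0_norm ?exprn_ge0//.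
apply: (@le_trans _ _ (M ^+ k)); first exact: lerXn2r.
by rewrite exprS ler_peMl// exprn_ge0.
Qed.

Lemma expRN_lipschitz (a b : R) : 0 <= a -> 0 <= b -> `|expR (- a) - expR (- b)| <= `|a - b|.
Proof.
wlog ab : a b / a <= b => [H a0 b0|a0 b0].
  by have /orP[ab|ba] := le_total a b; [|rewrite distrC [leRHS]distrC]; exact: H.
rewrite ger0_norm ?subr_ge0 ?ler_expR ?lerN2// distrC ger0_norm ?subr_ge0//.
have -> : expR (- a) - expR (- b) = expR (- a) * (1 - expR (- (b - a))).
  by rewrite mulrBr mulr1 -expRD; congr (_ - expR _); ring.
have e1 : expR (- a) <= 1 by rewrite expR_le1 oppr_le0.
have e2 : 1 - expR (- (b - a)) <= b - a.
  by have := expR_ge1Dx (- (b - a)); lra.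
have e3 : 0 <= 1 - expR (- (b - a)) by rewrite subr_ge0 expR_le1 oppr_le0 subr_ge0.
by apply: le_trans e2; rewrite ler_piMl.
Qed.

(** The second term keeps its factor f0: with f0 = f x, a bound on |q - e| that is constant in x
    becomes integrable. *)
Lemma dist_mul_bound M k (f0 P F q e : R) : 1 <= M -> 0 <= f0 <= M -> 0 <= q <= 1 ->
  0 <= F <= M ^+ k ->
  `|f0 * P * q - f0 * F * e| <= M * `|P - F| + f0 * M ^+ k * `|q - e|.
Proof.
move=> M1 /andP[f00 f0M] /andP[q0 q1] /andP[F0 FM].
rewrite (_ : _ - _ = f0 * q * (P - F) + f0 * F * (q - e)); last by ring.
apply: le_trans (ler_normD _ _) _; rewrite !normrM.
rewrite (ger0_norm f00) (ger0_norm q0) (ger0_norm F0); apply: lerD.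
  by apply: ler_wpM2r => //; rewrite -[leRHS]mulr1; apply: ler_pM.
by apply: ler_wpM2r => //; apply: ler_wpM2l.
Qed.

End real_bounds.

Section L1_limits.
Local Open Scope ereal_scope.

Lemma cvg_integral_dist d (T : measurableType d) (R : realType)
    (m : {measure set T -> \bar R}) (g_ : nat -> T -> R) (g : T -> R) :
  (forall n, measurable_fun setT (g_ n)) -> measurable_fun setT g ->
  (forall n x, 0 <= g_ n x)%R -> (forall x, 0 <= g x)%R ->
  \int[m]_x (g x)%:E < +oo ->
  \int[m]_x (`|g_ n x - g x|)%:E @[n --> \oo] --> 0 ->
  \int[m]_x (g_ n x)%:E @[n --> \oo] --> \int[m]_x (g x)%:E.
Proof.
move=> mg_ mg g_0 g0 goo dist0.
have I0 : 0 <= \int[m]_x (g x)%:E by apply: integral_ge0 => x _; rewrite lee_fin.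
have Ifin : \int[m]_x (g x)%:E \is a fin_num by rewrite ge0_fin_numE.
have D0 n : 0 <= \int[m]_x (`|g_ n x - g x|)%:E by exact: integral_ge0.
have md n : measurable_fun setT (fun x => (`|g_ n x - g x|)%:E).
  by apply/measurable_EFinP; apply: measurableT_comp => //; exact: measurable_funB.
have up n : \int[m]_x (g_ n x)%:E <= \int[m]_x (g x)%:E + \int[m]_x (`|g_ n x - g x|)%:E.
  rewrite -ge0_integralD//; [|by move=> x _; rewrite lee_fin|exact/measurable_EFinP].
  apply: le_integral_nomeas => x; rewrite -?EFinD lee_fin//.
  by have := ler_norm (g_ n x - g x)%R; lra.
have lo n : \int[m]_x (g x)%:E <= \int[m]_x (g_ n x)%:E + \int[m]_x (`|g_ n x - g x|)%:E.
  rewrite -ge0_integralD//; [|by move=> x _; rewrite lee_fin|exact/measurable_EFinP].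
  apply: le_integral_nomeas => x; rewrite -?EFinD lee_fin//.
  by have := ler_norm (g x - g_ n x)%R; rewrite distrC; lra.
apply: (@squeeze_cvge _ _ _ _
  (fun n => \int[m]_x (g x)%:E - \int[m]_x (`|g_ n x - g x|)%:E) _
  (fun n => \int[m]_x (g x)%:E + \int[m]_x (`|g_ n x - g x|)%:E)).
- have := (cvge0P D0).1 dist0 _ ltr01; apply: filterS => n dn.
  have dfin : \int[m]_x (`|g_ n x - g x|)%:E \is a fin_num.
    by rewrite ge0_fin_numE// (le_lt_trans dn)// ltry.
  by rewrite up andbT leeBlDr.
- rewrite -[X in _ --> X]sube0; apply: cvgeB => //; first exact: fin_num_adde_defl.
  exact: cvg_cst.
- rewrite -[X in _ --> X]adde0; apply: cvgeD => //; first exact: fin_num_adde_defl.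
  exact: cvg_cst.
Qed.

End L1_limits.

(** * The inner integral for a fixed simplex *)

Section inner_limit.
Variables (R : realType) (d k : nat) (f : 'rV[R]_d -> R).
Hypothesis d0 : (0 < d)%N.
Hypothesis bf : bounded_density f.
Local Open Scope ereal_scope.
Let f0 := density_ge0 bf.
Local Hint Resolve f0 : core.

Let mf : measurable_fun setT (fun s : rseq R => f (blk d 0 s)).
Proof. by apply: (measurable_density bf); exact: vmeas_blk. Qed.

Lemma blkD (v : nat -> R) (a : R) (x : nat -> R) :
  blk d 0 (fun j => v j + a * x j)%R = (blk d 0 v + a *: blk d 0 x)%R.
Proof. by apply/rowP => j; rewrite !mxE. Qed.

Definition unrow (v : 'rV[R]_d) (j : nat) : R := if insub j is Some i then v ord0 i else 0%R.

Lemma blk_unrow v : blk d 0 (unrow v) = v.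
Proof. by apply/rowP => j; rewrite !mxE /unrow mul0n add0n valK. Qed.

Lemma dep_blk0 (T : Type) (g : 'rV[R]_d -> T) : dep d (fun s => g (blk d 0 s)).
Proof. by have := @dep_blk R d T 1 0 g; rewrite mul1n; exact. Qed.

Lemma integral_shift (v : 'rV[R]_d) (a : R) (G : 'rV[R]_d -> \bar R) : (0 < a)%R ->
  measurable_fun setT (fun s : rseq R => G (blk d 0 s)) -> (forall x, 0 <= G x) ->
  (a ^+ d)%:E * \int[lebs R d]_s G (v + a *: blk d 0 s)%R = \int[lebs R d]_s G (blk d 0 s).
Proof.
move=> a0 mG G0; rewrite -(@integral_affine R d (unrow v) a (fun s => G (blk d 0 s)))//.
  by congr (_ * _); apply: eq_integral => s _; rewrite blkD blk_unrow.
exact: dep_blk0.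
Qed.

(** The L1 modulus of continuity of f. *)
Definition tau (v : 'rV[R]_d) := \int[lebs R d]_s (`|f (blk d 0 s + v)%R - f (blk d 0 s)|)%:E.

Lemma tau_ge0 v : 0 <= tau v. Proof. exact: integral_ge0. Qed.

Lemma vmeas_blkD d' (T : measurableType d') (v : T -> 'rV[R]_d) (w : T -> rseq R) :
  vmeas v -> measurable_fun setT w -> vmeas (fun t => (blk d 0 (w t) + v t)%R).
Proof.
move=> mv mw; apply: vmeas_add => // j.
exact: (measurableT_comp (@vmeas_blk R d 0%N j)).
Qed.

Let mfD v : measurable_fun setT (fun s : rseq R => f (blk d 0 s + v)%R).
Proof.
apply: (measurable_density bf); apply: vmeas_blkD => //.
Qed.

Lemma tau_le2 v : tau v <= 2%:E.
Proof.
apply: le_trans (integral_dist_le (lebs R d) (mfD v) mf _ _) _ => //.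
have := @integral_shift v 1%R (fun x => (f x)%:E) ltr01.
rewrite expr1n mul1e integral_density// => H.
rewrite [X in X + _](_ : _ = 1) -?EFinD//.
rewrite -[RHS]H//; last exact/measurable_EFinP.
by apply: eq_integral => s _; rewrite scale1r addrC.
Qed.

Lemma tau_cvg0 (a : nat -> R) (v : 'rV[R]_d) : a n @[n --> \oo] --> 0%R ->
  tau (a n *: v) @[n --> \oo] --> 0.
Proof.
move=> ca.
have e n : \int[lebs R d]_s (`|f (blk d 0 (fun j => a n * unrow v j + s j)%R) - f (blk d 0 s)|)%:E = tau (a n *: v).
  apply: eq_integral => s _; congr (`|f _ - _|)%:E.
  rewrite -[in RHS](blk_unrow v); apply/rowP => j; rewrite !mxE; ring.
under eq_fun do rewrite -e.
apply: (@translation_L1 R d (fun s => f (blk d 0 s)) (fun n j => a n * unrow v j)%R) => //.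
- exact: dep_blk0.
- by rewrite integral_density// ltry.
- by move=> j; rewrite -[X in _ --> X](mul0r (unrow v j)); apply: cvgMl.
Qed.

Lemma measurable_tau (a : R) : measurable_fun setT (fun w : rseq R => tau (a *: blk d 0 w)).
Proof.
apply: (@measurable_integral_lebs R _ (rseq R) d
  (fun p => (`|f (blk d 0 p.2 + a *: blk d 0 p.1)%R - f (blk d 0 p.2)|)%:E)) => [|p]; last by rewrite lee_fin.
apply/measurable_EFinP; apply: measurableT_comp => //; apply: measurable_funB.
  apply: (measurable_density bf); apply: vmeas_blkD => //.
  apply: vmeas_scale; first exact: measurable_cst.
  by move=> j; exact: (measurableT_comp (@vmeas_blk R d 0%N j)).
exact: (measurableT_comp mf).
Qed.

Section fixed_simplex.
Variables (c : 'rV[R]_d) (rho : R) (y : 'I_k -> 'rV[R]_d) (a : nat -> R)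
  (Q : nat -> R -> R) (lam M vol : R).
Hypothesis a0 : forall n, (0 < a n)%R.
Hypothesis ca : a n @[n --> \oo] --> 0%R.
Hypothesis cna : (n%:R * a n ^+ d)%R @[n --> \oo] --> lam.
Hypothesis lam0 : (0 <= lam)%R.
Hypothesis M1 : (1 <= M)%R.
Hypothesis fM : forall x, (f x <= M)%R.
Hypothesis volE : \int[lebs R d]_s ((edist c (blk d 0 s) <= rho)%R%:R)%:E = vol%:E.
Hypothesis mQ : forall n, measurable_fun setT (Q n).
Hypothesis Q01 : forall n (p : R), (0 <= p <= 1)%R -> (0 <= Q n p <= 1)%R.
Hypothesis Qexp : forall K e : R, (0 < e)%R -> \forall n \near \oo,
  forall p : R, (0 <= p <= 1)%R -> (n%:R * p <= K)%R -> (`|Q n p - expR (- (n%:R * p))| <= e)%R.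

Let ind (w : 'rV[R]_d) : R := (edist c w <= rho)%R%:R.
Let M0 : (0 <= M)%R. Proof. exact: le_trans M1. Qed.
Let Mk j : (0 <= M ^+ j)%R. Proof. exact: exprn_ge0. Qed.
Let vol0 : (0 <= vol)%R.
Proof. by rewrite -lee_fin -volE; apply: integral_ge0 => s _; rewrite lee_fin. Qed.

Let mind : measurable_fun setT (fun s : rseq R => ind (blk d 0 s)).
Proof.
apply: measurable_bool_nat; apply: measurable_fun_ler => //.
apply: measurable_edist; last exact: vmeas_blk.
by move=> j; exact: measurable_cst.
Qed.

Let mx n (x : 'rV[R]_d) : measurable_fun setT (fun s : rseq R => f (x + a n *: blk d 0 s)%R).
Proof.
apply: (measurable_density bf); apply: vmeas_add; first by move=> j; exact: measurable_cst.
by apply: vmeas_scale; [exact: measurable_cst|exact: vmeas_blk].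
Qed.

(** Not normalised by the volume: it is to be compared with f x * vol. *)
Let avg n x : R := fine (\int[lebs R d]_s (f (x + a n *: blk d 0 s)%R * ind (blk d 0 s))%:E).

Let int_le n (g : 'rV[R]_d -> R) (C : R) : (0 <= C)%R -> (forall w, 0 <= g w <= C)%R ->
  measurable_fun setT (fun s : rseq R => g (blk d 0 s)) ->
  \int[lebs R n]_s (g (blk d 0 s) * ind (blk d 0 s))%:E <=
  C%:E * \int[lebs R n]_s (ind (blk d 0 s))%:E.
Proof.
move=> C0 gC mg; rewrite -ge0_integralZl//; last 2 first.
- exact/measurable_EFinP.
- by move=> s _; rewrite lee_fin.
apply: le_integral_nomeas => s; have /andP[g0 gle] := gC (blk d 0 s).
  by rewrite lee_fin mulr_ge0.
by rewrite -EFinM lee_fin ler_wpM2r.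
Qed.

Let avgE n x : \int[lebs R d]_s (f (x + a n *: blk d 0 s)%R * ind (blk d 0 s))%:E = (avg n x)%:E.
Proof.
rewrite fineK// ge0_fin_numE; last by apply: integral_ge0 => s _; rewrite lee_fin mulr_ge0.
apply: le_lt_trans (@int_le d (fun w => f (x + a n *: w)%R) M M0 _ _) _ => //.
  by move=> w; rewrite f0 fM.
by rewrite volE -EFinM ltry.
Qed.

Let avg_ge0 n x : (0 <= avg n x)%R.
Proof. by rewrite -lee_fin -avgE; apply: integral_ge0 => s _; rewrite lee_fin mulr_ge0. Qed.

Let avg_le n x : (avg n x <= M * vol)%R.
Proof.
rewrite -lee_fin -avgE EFinM -volE; apply: (@int_le d (fun w => f (x + a n *: w)%R)) => //.
by move=> w; rewrite f0 fM.
Qed.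

(** The map w -> x + a_n w carries the fixed ball of center c and radius rho onto the ball in
    question, with Jacobian a_n^d. *)
Let ballmass_avg n x : ballmass f (x + a n *: c)%R (a n * rho) = (a n ^+ d * avg n x)%R.
Proof.
apply: EFin_inj; rewrite -ballmassE// EFinM -avgE.
have := @integral_shift x (a n) (fun v => (f v * (edist (x + a n *: c)%R v <= a n * rho)%R%:R)%:E) (a0 n).
move=> <-; last 2 first.
- apply/measurable_EFinP; apply: measurable_funM => //.
  apply: measurable_bool_nat; apply: measurable_fun_ler => //.
  apply: measurable_edist; last exact: vmeas_blk.
  by move=> j; exact: measurable_cst.
- by move=> v; rewrite lee_fin mulr_ge0.
congr (_ * _); apply: eq_integral => s _; congr (_ * _)%:E.
by rewrite edist_scale ?ler_pM2l// ltW.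
Qed.

Let err n x : R := fine (\int[lebs R d]_s (`|f (x + a n *: blk d 0 s)%R - f x| * ind (blk d 0 s))%:E).

Let mdx n x : measurable_fun setT (fun s : rseq R => `|f (x + a n *: blk d 0 s)%R - f x|%R).
Proof. by apply: measurableT_comp => //; exact: measurable_funB. Qed.

Let errE n x : \int[lebs R d]_s (`|f (x + a n *: blk d 0 s)%R - f x| * ind (blk d 0 s))%:E = (err n x)%:E.
Proof.
rewrite fineK// ge0_fin_numE; last by apply: integral_ge0 => s _; rewrite lee_fin mulr_ge0.
apply: le_lt_trans (@int_le d (fun w => `|f (x + a n *: w)%R - f x|)%R (M + M)%R _ _ _) _ => //.
- by rewrite addr_ge0.
- move=> w; rewrite normr_ge0/= (le_trans (ler_normB _ _))// !ger0_norm//.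
  exact: lerD.
- by rewrite volE -EFinM ltry.
Qed.

Let err_ge0 n x : (0 <= err n x)%R.
Proof. by rewrite -lee_fin -errE; apply: integral_ge0 => s _; rewrite lee_fin mulr_ge0. Qed.

Let volM x : \int[lebs R d]_s (f x * ind (blk d 0 s))%:E = (f x * vol)%:E.
Proof.
under eq_integral do rewrite EFinM.
rewrite ge0_integralZl//; last 3 first.
- exact/measurable_EFinP.
- by move=> s _; rewrite lee_fin.
- by rewrite lee_fin.
by rewrite volE.
Qed.

Let avg_err n x : (`|avg n x - f x * vol| <= err n x)%R.
Proof.
have m1 : measurable_fun setT (fun s : rseq R => (f (x + a n *: blk d 0 s)%R * ind (blk d 0 s))%:E).
  by apply/measurable_EFinP; exact: measurable_funM.
have m2 : measurable_fun setT (fun s : rseq R => (`|f (x + a n *: blk d 0 s)%R - f x| * ind (blk d 0 s))%:E).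
  by apply/measurable_EFinP; exact: measurable_funM.
have m3 : measurable_fun setT (fun s : rseq R => (f x * ind (blk d 0 s))%:E).
  by apply/measurable_EFinP; exact: measurable_funM.
rewrite ler_distl; apply/andP; split.
  rewrite lerBlDr -lee_fin EFinD -volM -avgE -errE -ge0_integralD//; last 2 first.
  - by move=> s _; rewrite lee_fin mulr_ge0.
  - by move=> s _; rewrite lee_fin mulr_ge0.
  apply: le_integral_nomeas => s; first by rewrite lee_fin mulr_ge0.
  rewrite -EFinD -mulrDl lee_fin ler_wpM2r//.
  by have := ler_norm (f x - f (x + a n *: blk d 0 s)%R)%R; rewrite distrC; lra.
rewrite -lee_fin EFinD -volM -avgE -errE -ge0_integralD//; last 2 first.
- by move=> s _; rewrite lee_fin mulr_ge0.
- by move=> s _; rewrite lee_fin mulr_ge0.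
apply: le_integral_nomeas => s; first by rewrite lee_fin mulr_ge0.
rewrite -EFinD -mulrDl lee_fin ler_wpM2r//.
by have := ler_norm (f (x + a n *: blk d 0 s)%R - f x)%R; lra.
Qed.

Let merr2 n : measurable_fun setT (fun p : rseq R * rseq R =>
  (`|f (blk d 0 p.1 + a n *: blk d 0 p.2)%R - f (blk d 0 p.1)| * ind (blk d 0 p.2))%:E).
Proof.
apply/measurable_EFinP; apply: measurable_funM; last exact: (measurableT_comp mind).
apply: measurableT_comp => //; apply: measurable_funB; last exact: (measurableT_comp mf).
apply: (measurable_density bf); apply: vmeas_blkD => //.
apply: vmeas_scale; first exact: measurable_cst.
by move=> j; exact: (measurableT_comp (@vmeas_blk R d 0%N j)).
Qed.

Let merr n : measurable_fun setT (fun x : rseq R => (err n (blk d 0 x))%:E).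
Proof.
rewrite (_ : (fun _ => _) = fun x : rseq R => \int[lebs R d]_s
  (`|f (blk d 0 x + a n *: blk d 0 s)%R - f (blk d 0 x)| * ind (blk d 0 s))%:E); last first.
  by apply/funext => x; rewrite errE.
apply: (@measurable_integral_lebs R _ (rseq R) d (fun p =>
  (`|f (blk d 0 p.1 + a n *: blk d 0 p.2)%R - f (blk d 0 p.1)| * ind (blk d 0 p.2))%:E)).
  exact: merr2.
by move=> p; rewrite lee_fin mulr_ge0.
Qed.

(** By Tonelli, the integral over x becomes the integral of [tau (a n w)] over w in the fixed ball.
    It vanishes pointwise and is bounded by 2, so dominated convergence applies. *)
Let err_cvg0 : \int[lebs R d]_x (err n (blk d 0 x))%:E @[n --> \oo] --> 0.
Proof.
have e n : \int[lebs R d]_x (err n (blk d 0 x))%:E =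
    \int[lebs R d]_s ((ind (blk d 0 s))%:E * tau (a n *: blk d 0 s)).
  under eq_integral do rewrite -errE.
  have := @fubini_tonelli _ _ _ _ R (lebs R d) (lebs R d) (fun p =>
    (`|f (blk d 0 p.1 + a n *: blk d 0 p.2)%R - f (blk d 0 p.1)| * ind (blk d 0 p.2))%:E).
  move=> ->; last 2 first.
  - exact: merr2.
  - by move=> p; rewrite lee_fin mulr_ge0.
  apply: eq_integral => s _; rewrite /fubini_G/=.
  under eq_integral do rewrite mulrC EFinM.
  rewrite ge0_integralZl//; last 2 first.
  - apply/measurable_EFinP; apply: measurableT_comp => //; apply: measurable_funB => //.
  - by rewrite lee_fin.
under eq_fun do rewrite e.
apply: (@cvg_integral0 _ _ R (lebs R d) _ (fun s => (2 * ind (blk d 0 s))%:E)).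
- move=> n; apply: emeasurable_funM; first exact/measurable_EFinP.
  exact: measurable_tau.
- by apply/measurable_EFinP; exact: measurable_funM.
- by move=> n s; rewrite mule_ge0 ?lee_fin// tau_ge0.
- move=> n s; rewrite mulrC EFinM; apply: lee_wpmul2l; first by rewrite lee_fin.
  exact: tau_le2.
- under eq_integral do rewrite EFinM.
  by apply: int2_lty; [exact/measurable_EFinP|move=> s; rewrite lee_fin|rewrite volE ltry].
- move=> s _; rewrite -[X in _ --> X](mule0 (ind (blk d 0 s))%:E).
  by apply: cvgeZl => //; exact: tau_cvg0.
Qed.

Let inner_weight n (x : 'rV[R]_d) : R :=
  (f x * (\prod_(i < k) f (x + a n *: y i)) * Q n (ballmass f (x + a n *: c) (a n * rho)))%R.

Let inner_weight_limit (x : 'rV[R]_d) : R := (f x ^+ k.+1 * expR (- (lam * vol * f x)))%R.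

(** The three terms come from replacing the densities at the vertices by f x; replacing Q by the
    exponential and n a_n^d by lam; and replacing the integral of f over the ball by f x * vol. Each
    has a small integral over x. *)
Let weight_bound n (x : 'rV[R]_d) (e : R) : (0 <= e)%R ->
  (`|n%:R * a n ^+ d - lam| <= e)%R -> (n%:R * a n ^+ d <= lam + 1)%R ->
  (forall p : R, (0 <= p <= 1)%R -> (n%:R * p <= (lam + 1) * (M * vol))%R ->
     (`|Q n p - expR (- (n%:R * p))| <= e)%R) ->
  (`|inner_weight n x - inner_weight_limit x| <=
    M ^+ k.+1 * (\sum_(i < k) `|f (x + a n *: y i) - f x|) +
    f x * (M ^+ k * (e + e * (vol * M))) + M ^+ k.+1 * (lam + 1) * err n x)%R.
Proof.
move=> e0 nae nale Qe; set p := ballmass f (x + a n *: c)%R (a n * rho)%R.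
have p01 : (0 <= p <= 1)%R by rewrite ballmass_ge0//= ballmass_le1.
have na0 : (0 <= n%:R * a n ^+ d)%R by rewrite mulr_ge0// exprn_ge0// ltW.
have npE : (n%:R * p = n%:R * a n ^+ d * avg n x)%R by rewrite /p ballmass_avg mulrA.
have np0 : (0 <= n%:R * p)%R by rewrite npE mulr_ge0.
(* From [avg_le] and n a_n^d <= lam + 1: n p stays in the range where the uniform approximation of Q
   n applies. *)
have npK : (n%:R * p <= (lam + 1) * (M * vol))%R by rewrite npE ler_pM.
have fx : (0 <= f x <= M)%R by rewrite f0 fM.
have fk : (0 <= f x ^+ k <= M ^+ k)%R by rewrite exprn_ge0//= lerXn2r// nnegrE.
have Qd : (`|Q n p - expR (- (lam * vol * f x))| <=
    e + ((lam + 1) * err n x + e * (vol * M)))%R.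
  rewrite -(subrK (expR (- (n%:R * p))) (Q n p)) -addrA.
  apply: le_trans (ler_normD _ _) _; apply: lerD; first exact: Qe.
  apply: le_trans (expRN_lipschitz _ _) _ => //; first by rewrite !mulr_ge0.
  rewrite npE (_ : _ - _ = n%:R * a n ^+ d * (avg n x - f x * vol) +
    (n%:R * a n ^+ d - lam) * (vol * f x))%R; last by ring.
  apply: le_trans (ler_normD _ _) _; rewrite normrM (normrM (_ - lam)%R); apply: lerD.
    by rewrite ger0_norm//; apply: ler_pM.
  apply: ler_pM => //; rewrite ger0_norm ?mulr_ge0//; exact: ler_wpM2l.
rewrite /inner_weight -/p /inner_weight_limit exprS.
have := @dist_mul_bound R M k (f x) (\prod_(i < k) f (x + a n *: y i)%R)
  (f x ^+ k) (Q n p) (expR (- (lam * vol * f x))) M1 fx (Q01 _ p01) fk.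
move=> /le_trans; apply.
have b1 : (M * `|\prod_(i < k) f (x + a n *: y i)%R - f x ^+ k| <=
   M ^+ k.+1 * (\sum_(i < k) `|f (x + a n *: y i)%R - f x|))%R.
  rewrite exprS -mulrA; apply: ler_wpM2l => //; apply: dist_prod_pow => // i.
  by rewrite f0 fM.
have b2 : (f x * M ^+ k * `|Q n p - expR (- (lam * vol * f x))| <=
    f x * M ^+ k * (e + ((lam + 1) * err n x + e * (vol * M))))%R.
  by apply: ler_wpM2l => //; rewrite mulr_ge0.
have b3 : (f x * M ^+ k * ((lam + 1) * err n x) <= M ^+ k.+1 * (lam + 1) * err n x)%R.
  rewrite -mulrA (mulrA _ (_ + _)%R) mulrA exprS -!mulrA.
  by apply: ler_wpM2r => //; rewrite mulr_ge0// mulr_ge0// addr_ge0.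
by move: b1 b2 b3; rewrite !mulrDr; lra.
Qed.

Lemma cvg_inner :
  \int[lebs R d]_x (inner_weight n (blk d 0 x))%:E @[n --> \oo] -->
  \int[lebs R d]_x (inner_weight_limit (blk d 0 x))%:E.
Proof.
have mi n : measurable_fun setT (fun x : rseq R => inner_weight n (blk d 0 x)).
  have mb (v : 'rV[R]_d) : vmeas (fun x : rseq R => (blk d 0 x + a n *: v)%R).
    by apply: vmeas_blkD => // j; exact: measurable_cst.
  apply: measurable_funM; first apply: measurable_funM => //.
    by apply: measurable_prod => i _; apply: (measurable_density bf).
  by apply: (measurableT_comp (mQ n)); apply: measurable_ballmass.
have ml : measurable_fun setT (fun x : rseq R => inner_weight_limit (blk d 0 x)).
  apply: measurable_funM; first exact: measurable_funX.
  apply: measurableT_comp => //; apply: measurableT_comp => //.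
  exact: measurable_funM.
have il0 x : (0 <= inner_weight_limit x)%R by rewrite mulr_ge0 ?expR_ge0// exprn_ge0.
apply: cvg_integral_dist => //.
- move=> n x; rewrite !mulr_ge0// ?prodr_ge0//.
  by have /andP[] : (0 <= Q n (ballmass f (blk d 0 x + a n *: c)%R (a n * rho)) <= 1)%R
    by apply: Q01; rewrite ballmass_ge0//= ballmass_le1.
- apply: (@le_lt_trans _ _ ((M ^+ k)%:E * \int[lebs R d]_x (f (blk d 0 x))%:E)).
    rewrite -ge0_integralZl//; last 3 first.
    + exact/measurable_EFinP.
    + by move=> x _; rewrite lee_fin.
    + by rewrite lee_fin.
    apply: le_integral_nomeas => x; rewrite -?EFinM lee_fin//.
    rewrite /inner_weight_limit exprSr -mulrA; apply: ler_pM => //.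
    - by rewrite exprn_ge0.
    - by rewrite mulr_ge0// expR_ge0.
    - by rewrite lerXn2r// nnegrE.
    - by rewrite ler_piMr// expR_le1 oppr_le0 !mulr_ge0.
  by rewrite integral_density// mule1 ltry.
apply/cvge0P => [n|e e0]; first by apply: integral_ge0.
(* The total coefficient of del when the k translation errors, the errors in Q and in n a_n^d, and
   the integrated ball error are each at most del. *)
pose C := (M ^+ k.+1 * k%:R + M ^+ k * (1 + vol * M) + M ^+ k.+1 * (lam + 1))%R.
have C0 : (0 < C)%R.
  have : (0 < M ^+ k.+1 * (lam + 1))%R.
    by rewrite mulr_gt0 ?exprn_gt0 ?(lt_le_trans ltr01)// lerDr.
  have : (0 <= M ^+ k.+1 * k%:R)%R by rewrite mulr_ge0.
  have : (0 <= M ^+ k * (1 + vol * M))%R by rewrite mulr_ge0// addr_ge0// mulr_ge0.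
  by rewrite /C; lra.
(* The 1 ensures n a_n^d <= lam + 1, as [weight_bound] requires. *)
pose del := Num.min 1%R (e / C)%R.
have del0 : (0 < del)%R by rewrite /del lt_min ltr01 divr_gt0.
have delC : (del * C <= e)%R.
  by rewrite -ler_pdivlMr// /del ge_min lexx orbT.
have del1 : (del <= 1)%R by rewrite /del ge_min lexx.
have E1 : \forall n \near \oo, forall i : 'I_k, tau (a n *: y i) <= del%:E.
  apply: filter_forall => i.
  by apply: ((cvge0P (fun n => tau_ge0 (a n *: y i))).1 (tau_cvg0 (y i) ca)).
have E2 : \forall n \near \oo, (`|n%:R * a n ^+ d - lam| <= del)%R.
  by have /cvgrPdist_le /(_ _ del0) := cna; apply: filterS => n; rewrite distrC.
have err0 n : 0 <= \int[lebs R d]_x (err n (blk d 0 x))%:E.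
  by apply: integral_ge0 => x _; rewrite lee_fin.
have E3 := (cvge0P err0).1 err_cvg0 _ del0.
have E4 := Qexp ((lam + 1) * (M * vol)) del0.
near=> n.
have t1 : forall i : 'I_k, tau (a n *: y i) <= del%:E by near: n; exact: E1.
have t2 : (`|n%:R * a n ^+ d - lam| <= del)%R by near: n; exact: E2.
have t3 : \int[lebs R d]_x (err n (blk d 0 x))%:E <= del%:E by near: n; exact: E3.
have t4 : forall p : R, (0 <= p <= 1)%R -> (n%:R * p <= (lam + 1) * (M * vol))%R ->
   (`|Q n p - expR (- (n%:R * p))| <= del)%R by near: n; exact: E4.
have t5 : (n%:R * a n ^+ d <= lam + 1)%R.
  by have := ler_norm (n%:R * a n ^+ d - lam)%R; lra.
pose B1 x := ((M ^+ k.+1)%:E * \sum_(i < k) (`|f (x + a n *: y i)%R - f x|)%:E).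
pose B2 x := (M ^+ k * (del + del * (vol * M)))%R%:E * (f x)%:E.
pose B3 x := (M ^+ k.+1 * (lam + 1))%R%:E * (err n x)%:E.
have mB1i i : measurable_fun setT (fun x : rseq R => (`|f (blk d 0 x + a n *: y i)%R - f (blk d 0 x)|)%:E).
  by apply/measurable_EFinP; apply: measurableT_comp => //; exact: measurable_funB.
have mB1 : measurable_fun setT (fun x : rseq R => B1 (blk d 0 x)).
  by apply: measurable_funeM; apply: emeasurable_sum => i; exact: mB1i.
have mB2 : measurable_fun setT (fun x : rseq R => B2 (blk d 0 x)).
  by apply: measurable_funeM; exact/measurable_EFinP.
have mB3 : measurable_fun setT (fun x : rseq R => B3 (blk d 0 x)).
  by apply: measurable_funeM; exact: merr.
have B10 x : 0 <= B1 x by rewrite mule_ge0 ?lee_fin// sume_ge0.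
have B20 x : 0 <= B2 x.
  by rewrite mule_ge0 ?lee_fin// mulr_ge0// addr_ge0 ?mulr_ge0// ltW.
have c30 : (0 <= M ^+ k.+1 * (lam + 1))%R by rewrite mulr_ge0// addr_ge0.
have B30 x : 0 <= B3 x by rewrite mule_ge0 ?lee_fin//.
apply: (@le_trans _ _ (\int[lebs R d]_x (B1 (blk d 0 x) + (B2 (blk d 0 x) + B3 (blk d 0 x))))).
  apply: le_integral_nomeas => x; first by rewrite lee_fin.
  rewrite /B1 /B2 /B3 sumEFin -!EFinM -!EFinD lee_fin.
  by apply: le_trans (weight_bound (blk d 0 x) (ltW del0) t2 t5 t4) _; lra.
rewrite ge0_integralD//; last 2 first.
- by move=> x _; rewrite adde_ge0.
- exact: emeasurable_funD.
rewrite ge0_integralD//.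
have -> : \int[lebs R d]_x B1 (blk d 0 x) = (M ^+ k.+1)%:E * \sum_(i < k) tau (a n *: y i).
  rewrite ge0_integralZl//; last 3 first.
  - by apply: emeasurable_sum => i; exact: mB1i.
  - by move=> x _; rewrite sume_ge0.
  - by rewrite lee_fin.
  by rewrite ge0_integral_sum.
have -> : \int[lebs R d]_x B2 (blk d 0 x) = (M ^+ k * (del + del * (vol * M)))%R%:E.
  rewrite ge0_integralZl//; last 3 first.
  - exact/measurable_EFinP.
  - by move=> x _; rewrite lee_fin.
  - by rewrite lee_fin mulr_ge0// addr_ge0 ?mulr_ge0// ltW.
  by rewrite integral_density// mule1.
have -> : \int[lebs R d]_x B3 (blk d 0 x) = (M ^+ k.+1 * (lam + 1))%R%:E * \int[lebs R d]_x (err n (blk d 0 x))%:E.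
  rewrite ge0_integralZl//; last by move=> x _; rewrite lee_fin.
apply: (@le_trans _ _ ((M ^+ k.+1)%:E * (k%:R * del)%:E + ((M ^+ k * (del + del * (vol * M)))%R%:E +
  (M ^+ k.+1 * (lam + 1))%R%:E * del%:E))); last first.
  rewrite -!EFinM -!EFinD lee_fin; apply: le_trans delC; rewrite /C le_eqVlt.
  by apply/orP; left; apply/eqP; ring.
apply: leeD; last by apply: leeD => //; apply: lee_wpmul2l => //; rewrite lee_fin.
apply: lee_wpmul2l; first by rewrite lee_fin.
rewrite [leRHS](_ : _ = \sum_(i < k) del%:E).
  by apply: lee_sum => i _; exact: t1.
by rewrite sumEFin sumr_const card_ord mulr_natl.
Unshelve. all: by end_near. Qed.

End fixed_simplex.
End inner_limit.

(** * Integrable bounds *)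

Section volume.
Variable R : realType.
Local Open Scope ereal_scope.
Local Notation mu := (@lebesgue_measure R).

Lemma integral_lebs1 (phi : R -> R) : measurable_fun setT phi -> (forall x, 0 <= phi x)%R ->
  \int[lebs R 1]_s (phi (s 0%N))%:E = \int[mu]_x (phi x)%:E.
Proof.
move=> mphi phi0; have mp : measurable_fun setT (fun s : rseq R => (phi (s 0%N))%:E).
  by apply/measurable_EFinP; apply: (measurableT_comp mphi); exact: measurable_coord.
rewrite (@integral_lebsS R 0 (fun s => (phi (s 0%N))%:E))//; last by move=> s; rewrite lee_fin.
apply: eq_integral => x _.
rewrite (@integral_lebs0 R (fun s => (phi (scons x s 0%N))%:E))//; exact: (@measurable_cst _ _ (rseq R) _ setT (phi x)%:E).
Qed.

Lemma integral_prod_coord n (phi : R -> R) (q : R) : measurable_fun setT phi ->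
  (forall x, 0 <= phi x)%R -> \int[mu]_x (phi x)%:E = q%:E ->
  \int[lebs R n]_s (\prod_(j < n) phi (s j))%:E = (q ^+ n)%:E.
Proof.
move=> mphi phi0 qE.
pose Phi (v : 'rV[R]_1) : R := phi (v ord0 ord0).
have b1 j (s : nat -> R) : Phi (blk 1 j s) = phi (s j).
  by rewrite /Phi mxE muln1 addn0.
have mPhi i : measurable_fun setT (fun s : rseq R => Phi (blk 1 i s)).
  rewrite (_ : (fun _ => _) = fun s => phi (s i)).
    by apply: (measurableT_comp mphi); exact: measurable_coord.
  by apply/funext => s; rewrite b1.
have := @iint_prod R 1 n Phi q mPhi (fun v => phi0 _).
rewrite muln1 => <-; last by under eq_integral do rewrite b1; rewrite integral_lebs1.
rewrite iint_lebs.
- by apply: eq_integral => s _; congr EFin; apply: eq_bigr => j _; rewrite b1.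
- by apply/measurable_EFinP; apply: measurable_prod => j _; exact: mPhi.
- by move=> s; rewrite lee_fin prodr_ge0// => j _; exact: phi0.
Qed.

Lemma integral_prod_coord_lty n (phi : R -> R) : measurable_fun setT phi ->
  (forall x, 0 <= phi x)%R -> \int[mu]_x (phi x)%:E < +oo ->
  \int[lebs R n]_s (\prod_(j < n) phi (s j))%:E < +oo.
Proof.
move=> mphi phi0 phioo.
rewrite (@integral_prod_coord n phi (fine (\int[mu]_x (phi x)%:E)))//; first by rewrite ltry.
rewrite fineK// ge0_fin_numE//; apply: integral_ge0 => x _; by rewrite lee_fin.
Qed.

Lemma box_volume n (B : R) : (0 < B)%R ->
  \int[lebs R n]_s (\prod_(j < n) (`|s j| <= B)%R%:R)%:E = ((B + B) ^+ n)%:E.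
Proof.
move=> B0; have mB : measurable_fun setT (fun x : R => ((`|x| <= B)%R%:R : R)).
  by apply: measurable_bool_nat; apply: measurable_fun_ler => //; exact: measurableT_comp.
apply: (@integral_prod_coord n (fun x => (`|x| <= B)%R%:R) _ mB) => //.
rewrite (_ : (fun x => _) = (fun x => (\1_(`[(- B)%R, B]%classic : set R) x)%:E)).
  rewrite integral_indic// setIT.
  have := @lebesgue_measure_itv R `[(- B)%R, B]; rewrite /= => ->.
  by rewrite lte_fin gtrN// -EFinD opprK.
by apply/funext => x; rewrite indicE mem_setE in_itv/= ler_norml.
Qed.

Lemma integral_opp (g : R -> \bar R) : measurable_fun setT g -> (forall x, 0 <= g x) ->
  \int[mu]_x g (- x)%R = \int[mu]_x g x.
Proof.
move=> mg g0.
have mN : measurable_fun setT (-%R : R -> measurableTypeR R) by exact: measurable_funN.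
rewrite -[X in \int[mu]_(x in X) g (- x)%R](preimage_setT (-%R : R -> measurableTypeR R)).
rewrite -ge0_integral_pushforward//=.
by apply: eq_measure_integral => //= A mA _; exact: lebesgue_measureN.
Qed.

(** Since |x|^d >= |x| - 1, the integrand is at most e^kap / kap times the sum of the exponential
    densities of rate kap at x and at -x. *)
Lemma expR_pow_lty d (kap : R) : (0 < d)%N -> (0 < kap)%R ->
  \int[mu]_x (expR (- (kap * `|x| ^+ d)))%:E < +oo.
Proof.
move=> d0 kap0.
pose p : R -> R := exponential_pdf kap.
have p0 x : (0 <= p x)%R by apply: exponential_pdf_ge0; exact: ltW.
have mp : measurable_fun setT (EFin \o p).
  by apply/measurable_EFinP; exact: measurable_exponential_pdf.
have mpN : measurable_fun setT (fun x : R => (p (- x)%R)%:E).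
  by apply: (measurableT_comp mp); exact: measurable_funN.
have ip : \int[mu]_x (p x)%:E = 1 by exact: integral_exponential_pdf.
pose C := (expR kap / kap)%R.
have C0 : (0 <= C)%R by rewrite divr_ge0 ?expR_ge0// ltW.
apply: (@le_lt_trans _ _ (C%:E * \int[mu]_x ((p x)%:E + (p (- x)%R)%:E))); last first.
  rewrite (@ge0_integralD _ _ _ mu setT measurableT (EFin \o p) (fun x => (p (- x)%R)%:E))//.
  - rewrite (@integral_opp (EFin \o p))//=.
    + by rewrite ip -EFinD -EFinM ltry.
    + by move=> x; rewrite lee_fin.
  - by move=> x _; rewrite lee_fin.
rewrite -ge0_integralZl//; last 2 first.
- exact: emeasurable_funD.
- by move=> x _; rewrite adde_ge0 ?lee_fin.
apply: le_integral_nomeas => x; first by rewrite lee_fin expR_ge0.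
rewrite -EFinD -EFinM lee_fin.
have xd : (`|x| - 1 <= `|x| ^+ d)%R.
  have [x1|x1] := lerP 1%R `|x|.
    by apply: (@le_trans _ _ `|x|%R); [lra|rewrite -[leLHS]expr1 ler_weXn2l].
  by apply: (@le_trans _ _ 0%R); [lra|rewrite exprn_ge0].
have e1 : (expR (- (kap * `|x| ^+ d)) <= expR kap * expR (- kap * `|x|))%R.
  rewrite -expRD ler_expR.
  have : (kap * (`|x| - 1) <= kap * `|x| ^+ d)%R by rewrite ler_pM2l.
  by rewrite mulrBr mulr1; lra.
apply: le_trans e1 _; rewrite /C -mulrA; apply: ler_wpM2l; first exact: expR_ge0.
rewrite ler_pdivlMl// /p.
have [x0|x0] := leP 0%R x.
  by rewrite (exponential_pdfE _ x0) ger0_norm// lerDl; exact: p0.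
have nx0 : (0 <= - x)%R by rewrite oppr_ge0 ltW.
by rewrite (exponential_pdfE _ nx0) ltr0_norm// lerDr; exact: p0.
Qed.

Lemma ball_volume d (c : 'rV[R]_d) (rho : R) : (0 < rho)%R ->
  \int[lebs R d]_s ((edist c (blk d 0 s) <= rho)%R%:R)%:E = (omega R d * rho ^+ d)%:E.
Proof.
move=> rho0.
have mind (c' : 'rV[R]_d) (r' : R) : measurable_fun setT (fun s : rseq R => ((edist c' (blk d 0 s) <= r')%R%:R : R)%:E).
  apply/measurable_EFinP; apply: measurable_bool_nat; apply: measurable_fun_ler => //.
  by apply: measurable_edist; [move=> j; exact: measurable_cst|exact: vmeas_blk].
have o : \int[lebs R d]_s ((edist 0%R (blk d 0 s) <= 1)%R%:R)%:E = (omega R d)%:E.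
  rewrite /omega /intRd.
  have -> : iint d (fun s => (if (edist (\row_j s j) (0%R : 'rV[R]_d) <= 1)%R then 1%R else 0%R)%:E) =
      \int[lebs R d]_s ((edist 0%R (blk d 0 s) <= 1)%R%:R)%:E.
    rewrite iint_lebs.
    - by apply: eq_integral => s _; rewrite edistC; congr EFin; case: ifP.
    - have := mind 0%R 1%R; apply: eq_measurable_fun => s _.
      by rewrite edistC; congr EFin; case: ifP.
    - by move=> s; rewrite lee_fin; case: ifP.
  rewrite fineK// ge0_fin_numE; last by apply: integral_ge0 => s _; rewrite lee_fin.
  (* The unit ball lies in the cube [-1, 1]^d, so its volume is finite and [fine] in the definition
     of [omega] loses nothing. *)
  apply: (@le_lt_trans _ _ (\int[lebs R d]_s (\prod_(j < d) (`|s j| <= 1)%R%:R)%:E)); last first.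
    by rewrite box_volume// ltry.
  apply: le_integral_nomeas => s; rewrite lee_fin//.
  case: (boolP (edist _ _ <= 1)%R) => [s1|_]; last by rewrite prodr_ge0.
  rewrite big1// => j _; have := coord_le_edist 0%R (blk d 0 s) j.
  by rewrite !mxE sub0r normrN mul0n add0n => /le_trans ->.
have := @integral_shift R d c rho (fun v => ((edist c v <= rho)%R%:R)%:E) rho0.
move=> <-//; rewrite mulrC EFinM -o; congr (_ * _); apply: eq_integral => s _.
have := @edist_scale R d c rho 0%R (blk d 0 s) (ltW rho0).
rewrite scaler0 addr0 => ->; congr (_%:R)%:E; congr nat_of_bool.
by rewrite -[X in (_ <= X)%R]mulr1 ler_pM2l.
Qed.

(** The cube of half-side 1 / d lies in the unit ball, as d (1/d)^2 <= 1. *)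
Lemma omega_gt0 d : (0 < d)%N -> (0 < omega R d)%R.
Proof.
move=> d0; have dR : (0 < d%:R :> R)%R by rewrite ltr0n.
have := @ball_volume d 0%R 1%R ltr01; rewrite expr1n mulr1 => oE.
have B0 : (0 < (d%:R)^-1 :> R)%R by rewrite invr_gt0.
rewrite -lte_fin -oE; apply: (@lt_le_trans _ _ (((d%:R)^-1 + (d%:R)^-1) ^+ d)%:E).
  by rewrite lte_fin exprn_gt0// addr_gt0.
rewrite -box_volume//; apply: le_integral_nomeas => s; first by rewrite lee_fin prodr_ge0.
rewrite lee_fin.
have [/forallP sB|/forallPn[j sj]] := boolP [forall j : 'I_d, (`|s j| <= (d%:R)^-1)%R]; last first.
  by rewrite (bigD1 j)//= (negbTE sj) mul0r.
rewrite big1 => [|j _]; last by rewrite sB.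
rewrite (_ : (edist _ _ <= 1)%R = true)// -[leRHS]sqrtr1 ler_sqrt//.
apply: (@le_trans _ _ (\sum_(i < d) (d%:R)^-1)%R); last first.
  by rewrite sumr_const card_ord -[X in (X <= _)%R]mulr_natl mulfV// gt_eqF.
apply: ler_sum => i _; rewrite !mxE sub0r sqrrN mul0n add0n -real_normK ?num_real//.
apply: (@le_trans _ _ `|s i|%R); last exact: sB.
rewrite expr2 ler_piMr//; apply: le_trans (sB i) _.
by rewrite invf_le1// ler1n.
Qed.

(** With radius 0 all vertices coincide and the Gram matrix vanishes, and for k > 0 its determinant
    is then 0. *)
Lemma crad_gt0 d k (z : 'I_k.+1 -> 'rV[R]_d) : (0 < k)%N -> good z -> (0 < crad z)%R.
Proof.
move=> k0 gz; rewrite lt_neqAle edist_ge0 andbT; apply/eqP => c0.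
have zE i : z i = cc z.
  apply/rowP => j; have := coord_le_edist (cc z) (z i) j.
  by rewrite good_edist// -c0 normr_le0 subr_eq0 => /eqP.
have ez : edges z = 0%R by apply/row_matrixP => i; rewrite rowK row0 !zE subrr.
case/and3P: gz; rewrite /gram ez mul0mx; case: k k0 z {zE ez c0} => // k _ z.
by rewrite det0 eqxx.
Qed.

(** The origin is a vertex, so every vertex lies within one diameter of it. *)
Lemma ypts_bound d k (y : nat -> R) j : (j < k * d)%N -> good (@ypts R d k y) ->
  (`|y j| <= 2 * crad (@ypts R d k y))%R.
Proof.
move=> jlt gz; have d0 : (0 < d)%N by case: d jlt gz => //; rewrite muln0.
have jk : (j %/ d < k)%N by rewrite ltn_divLR.
have := good_edist (lift ord0 (Ordinal jk)) gz; set z := @ypts R d k y => e1.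
pose o := Ordinal (ltn_pmod j d0).
have z1 : z (lift ord0 (Ordinal jk)) ord0 o = y j.
  by rewrite /z /ypts /with0 liftK !mxE /= -divn_eq.
have z0 : z ord0 ord0 o = 0%R by rewrite /z /ypts /with0 unlift_none !mxE.
have h1 := coord_le_edist (cc z) (z (lift ord0 (Ordinal jk))) o.
have h0 := coord_le_edist (cc z) (z ord0) o.
rewrite e1 z1 in h1; rewrite z0 subr0 in h0.
have := ler_normB (cc z ord0 o) (cc z ord0 o - y j)%R.
by rewrite subKr => /le_trans; apply; rewrite mulr2n mulrDl mul1r; exact: lerD.
Qed.

(** Summing |y_j|^d <= (2 crad)^d over the k d coordinates bounds crad^d below by the sum of the
    |y_j|^d divided by 2^d k d. The exponential is thus dominated by a product of functions of
    single coordinates, whose integral factorises. *)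
Lemma good_expR_le d k (y : nat -> R) (kap : R) : (0 < d)%N -> (0 < k)%N -> (0 < kap)%R ->
  ((good (@ypts R d k y))%:R * expR (- (kap * crad (@ypts R d k y) ^+ d)) <=
   \prod_(j < k * d) expR (- (kap / (2 ^+ d * (k * d)%:R) * `|y j| ^+ d)))%R.
Proof.
move=> d0 k0 kap0; have kd0 : (0 < k * d)%N by rewrite muln_gt0 k0.
have [gz|_] := boolP (good _); last by rewrite mul0r prodr_ge0// => j _; exact: expR_ge0.
rewrite mul1r -expR_sum ler_expR sumrN lerN2 -mulr_sumr.
set rho := crad _.
have rho0 : (0 < rho)%R by exact: crad_gt0.
have : (\sum_(j < k * d) `|y j| ^+ d <= \sum_(j < k * d) (2 * rho) ^+ d)%R.
  by apply: ler_sum => j _; apply: lerXn2r; rewrite ?nnegrE// ?mulr_ge0 ?(ltW rho0)//; exact: ypts_bound.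
rewrite sumr_const card_ord => S.
have kd : (0 < (2 ^+ d * (k * d)%:R : R))%R by rewrite mulr_gt0 ?exprn_gt0// ltr0n.
rewrite mulrAC ler_pdivrMr// -mulrA ler_pM2l//; apply: le_trans S _.
by rewrite -[leLHS]mulr_natr exprMn le_eqVlt; apply/orP; left; apply/eqP; ring.
Qed.

Lemma good_expR_lty d k (kap : R) : (0 < d)%N -> (0 < k)%N -> (0 < kap)%R ->
  \int[lebs R (k * d)]_y ((good (@ypts R d k y))%:R * expR (- (kap * crad (@ypts R d k y) ^+ d)))%:E < +oo.
Proof.
move=> d0 k0 kap0.
apply: (@le_lt_trans _ _ (\int[lebs R (k * d)]_y
    (\prod_(j < k * d) expR (- (kap / (2 ^+ d * (k * d)%:R) * `|y j| ^+ d))%R)%:E)).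
  apply: le_integral_nomeas => y; first by rewrite lee_fin mulr_ge0// expR_ge0.
  rewrite lee_fin; exact: (good_expR_le y d0 k0 kap0).
apply: (@integral_prod_coord_lty (k * d) (fun x => expR (- (kap / (2 ^+ d * (k * d)%:R) * `|x| ^+ d))%R)).
- apply: measurableT_comp => //; apply: measurable_funN; apply: measurable_funM => //.
  by apply: measurable_funX; exact: normr_measurable.
- by move=> x; exact: expR_ge0.
- apply: expR_pow_lty => //; rewrite divr_gt0// mulr_gt0 ?exprn_gt0// ltr0n muln_gt0.
  by rewrite k0.
Qed.

End volume.

(** * Ball masses over a convex support *)

Section convex_support.
Variables (R : realType) (d : nat) (K : set 'rV[R]_d).
Hypothesis cK : convex_set K.

Lemma convex_comb2 (t : R) x y : 0 <= t <= 1 -> K x -> K y -> K (t *: x + (1 - t) *: y).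
Proof.
move=> /andP[t0 t1] Kx Ky.
by have := cK (Itv01 t0 t1) (mem_set Kx) (mem_set Ky); rewrite /conv/= inE.
Qed.

Lemma convex_comb n (t : 'I_n.+1 -> R) (z : 'I_n.+1 -> 'rV[R]_d) :
  (forall i, 0 < t i) -> \sum_i t i = 1 -> (forall i, K (z i)) -> K (\sum_i t i *: z i).
Proof.
elim: n t z => [|n IH] t z t0 t1 Kz.
  by move: t1; rewrite !big_ord_recl !big_ord0 !addr0 => ->; rewrite scale1r.
rewrite big_ord_recl; pose S := \sum_(i < n.+1) t (lift ord0 i).
have {}t1 : t ord0 + S = 1 by rewrite -t1 big_ord_recl.
have S0 : 0 < S.
  by rewrite /S big_ord_recl ltr_pwDl// sumr_ge0// => i _; exact: ltW.
have -> : \sum_(i < n.+1) t (lift ord0 i) *: z (lift ord0 i) =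
    (1 - t ord0) *: \sum_(i < n.+1) (t (lift ord0 i) / S) *: z (lift ord0 i).
  rewrite scaler_sumr; apply: eq_bigr => i _; rewrite scalerA.
  have -> : 1 - t ord0 = S by rewrite -t1 addrC addKr.
  by rewrite mulrCA mulfV ?mulr1// gt_eqF.
apply: convex_comb2; first by rewrite ltW//=; move: (ltW S0); lra.
  exact: Kz.
apply: IH => [i||i]; last exact: Kz.
- by rewrite divr_gt0.
- by rewrite -mulr_suml mulfV// gt_eqF.
Qed.

End convex_support.

Section convex_mass.
Variables (R : realType) (d : nat) (f : 'rV[R]_d -> R).
Hypothesis bf : bounded_density f.
Hypothesis lf : lower_bounded f.
Hypothesis cf : convex_set (supp f).

Lemma supp_pos x : 0 < f x -> supp f x.
Proof. by move=> fx; apply: subset_closure. Qed.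

(* For c in the convex support, the homothety of centre c and ratio t <= 1 maps the
   support into itself and into the ball of centre c and radius t times its diameter. *)
Lemma convex_ballmass_ge : exists kap D : R, [/\ 0 < kap, 0 < D &
  forall c rho, supp f c -> 0 < rho <= D -> kap * rho ^+ d <= ballmass f c rho].
Proof.
have f0 := density_ge0 bf.
have [cK [m [m0 fm]]] := lf; have [_ [_ [[M fM] _]]] := bf.
have [B [Breal HB]] := compact_bounded cK.
pose B' : R := `|B| + 1; pose M' : R := `|M| + 1.
have B'0 : 0 < B' by rewrite ltr_wpDl.
have M'0 : 0 < M' by rewrite ltr_wpDl.
have fM' x : f x <= M' by rewrite (le_trans (fM x))// (le_trans (ler_norm _))// lerDl.
have KB x j : supp f x -> `|x 0 j| <= B'.
  move=> Kx; apply: le_trans (HB B' _ _ Kx).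
    by rewrite [leRHS]/Num.norm /= mx_normrE; apply/bigmax_geP; right => /=; exists (0, j).
  by rewrite (le_lt_trans (ler_norm _))// ltrDl.
(* Coordinates of points of the support are at most B' in absolute value, so D bounds its Euclidean
   diameter; adding 1 makes it positive. *)
pose D : R := Num.sqrt (d%:R * (B' + B') ^+ 2) + 1.
have D0 : 0 < D by rewrite ltr_wpDl.
have KD c x : supp f c -> supp f x -> edist c x <= D.
  move=> Kc Kx; apply: (@le_trans _ _ (Num.sqrt (d%:R * (B' + B') ^+ 2))); last by rewrite lerDl.
  rewrite ler_sqrt; last by rewrite mulr_ge0// sqr_ge0.
  apply: (@le_trans _ _ (\sum_(i < d) (B' + B') ^+ 2)); last first.
    by rewrite sumr_const card_ord mulr_natl.
  apply: ler_sum => i _; rewrite -real_normK ?num_real// lerXn2r ?nnegrE ?addr_ge0 ?(ltW B'0)//.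
  by apply: le_trans (ler_normB _ _) _; apply: lerD; exact: KB.
(* At the image of a support point u the density is at least m, hence at least m / M' times f u. As
   f has mass 1, the ball has mass at least t^d m / M' with t = rho / D. *)
exists (m / M' / D ^+ d), D; split => //; first by rewrite !divr_gt0// exprn_gt0.
move=> c rho Kc /andP[rho0 rhoD].
pose t := rho / D; have t0 : 0 < t by rewrite divr_gt0.
have t1 : t <= 1 by rewrite ler_pdivrMr// mul1r.
have tD : t * D = rho by rewrite /t divfK// gt_eqF.
rewrite -lee_fin -ballmassE//.
have := @integral_shift R d ((1 - t) *: c) t (fun v => (f v * (edist c v <= rho)%R%:R)%:E) t0.
move=> <-; last 2 first.
- apply/measurable_EFinP; apply: measurable_funM.
    by apply: (measurable_density bf); exact: vmeas_blk.
  apply: measurable_bool_nat; apply: measurable_fun_ler => //.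
  apply: measurable_edist; last exact: vmeas_blk.
  by move=> j; exact: measurable_cst.
- by move=> x; rewrite lee_fin mulr_ge0.
have -> : (m / M' / D ^+ d * rho ^+ d)%:E =
    ((t ^+ d)%:E * \int[lebs R d]_s ((m / M') * f (blk d 0 s))%:E)%E.
  under eq_integral do rewrite EFinM.
  rewrite ge0_integralZl//; last 3 first.
  - by apply/measurable_EFinP; apply: (measurable_density bf); exact: vmeas_blk.
  - by move=> x _; rewrite lee_fin.
  - by rewrite lee_fin divr_ge0// ltW.
  rewrite integral_density// mule1 -EFinM; congr EFin; rewrite /t expr_div_n; ring.
apply: lee_wpmul2l; first by rewrite lee_fin exprn_ge0// ltW.
apply: le_integral_nomeas => s; first by rewrite lee_fin mulr_ge0// divr_ge0// ltW.
rewrite lee_fin; set u := blk d 0 s.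
have [fu|fu] := ltP 0 (f u); last first.
  have -> : f u = 0 by apply/eqP; rewrite eq_le fu f0.
  by rewrite mulr0 mulr_ge0.
have Ku := supp_pos fu.
have Kv : supp f ((1 - t) *: c + t *: u).
  by rewrite addrC; apply: (convex_comb2 cf) => //; rewrite (ltW t0).
have -> : edist c ((1 - t) *: c + t *: u) <= rho.
  rewrite -[X in edist X _](_ : (1 - t) *: c + t *: c = c); last first.
    by rewrite -scalerDl subrK scale1r.
  by rewrite edist_scale ?(ltW t0)// -tD ler_pM2l//; exact: KD.
rewrite mulr1; apply: le_trans (fm _ Kv).
by rewrite mulrAC ler_pdivrMr// ler_pM2l.
Qed.

End convex_mass.

(** * Binomial and Poisson laws *)

Section count_laws.
Variable R : realType.
Implicit Types (p e K : R) (n k : nat).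

Lemma bernoulli_ge x n : 0 <= x <= 1 -> 1 - n%:R * x <= (1 - x) ^+ n :> R.
Proof.
move=> /andP[x0 x1]; elim: n => [|n IH]; first by rewrite mul0r subr0 expr0.
rewrite exprS; have y0 : 0 <= 1 - x by lra.
apply: le_trans (ler_wpM2l y0 IH); rewrite -natr1 mulrBr mulrDl mulrBl mulr1 !mul1r.
have : 0 <= x * (n%:R * x) by rewrite !mulr_ge0.
by lra.
Qed.

Lemma pow_1N_le n p : 0 <= p <= 1 -> (1 - p) ^+ n <= expR (- (n%:R * p)).
Proof.
move=> /andP[p0 p1]; rewrite -mulrN expRM_natl.
by rewrite lerXn2r ?nnegrE ?expR_ge0 ?subr_ge0//; exact: expR_ge1Dx.
Qed.

(* From 1 - p >= exp(-p) (1 - p ^ 2), i.e. 1 + p <= exp p, and Bernoulli's inequality. *)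
Lemma pow_1N_ge n p : 0 <= p <= 1 ->
  expR (- (n%:R * p)) * (1 - n%:R * p ^+ 2) <= (1 - p) ^+ n.
Proof.
move=> p01; have /andP[p0 p1] := p01.
have s01 : 0 <= p ^+ 2 <= 1 by rewrite sqr_ge0/= expr_le1.
apply: le_trans (ler_wpM2l (expR_ge0 _) (bernoulli_ge n s01)) _.
rewrite -mulrN expRM_natl -exprMn.
rewrite lerXn2r ?nnegrE ?mulr_ge0 ?expR_ge0 ?subr_ge0//; first by case/andP: s01.
rewrite -[leRHS]mul1r (_ : 1 - p ^+ 2 = (1 + p) * (1 - p)); last by ring.
rewrite mulrA ler_wpM2r ?subr_ge0// -[leRHS](expRxMexpNx_1 p) mulrC.
by rewrite ler_wpM2r ?expR_ge0// expR_ge1Dx.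
Qed.

(** For n p <= K both errors are of order 1 / n: from below, n p^2 <= K^2 / n; from above, the j
    missing factors cost at most e^(j p) - 1 <= j p e^j <= K j e^j / n. Their sum is C / n. *)
Lemma binomial_exp_cvg j K e : 0 < e -> \forall n \near \oo, forall p, 0 <= p <= 1 ->
  n%:R * p <= K -> `|(1 - p) ^+ (n - j) - expR (- (n%:R * p))| <= e.
Proof.
move=> e0; pose C := K ^+ 2 + K * j%:R * expR j%:R.
near=> n => p p01 npK; have /andP[p0 p1] := p01.
have n0 : 0 < n%:R :> R by rewrite ltr0n; near: n; exact: nbhs_infty_gt.
have jn : (j <= n)%N by near: n; exact: nbhs_infty_ge.
have Cn : C <= e * n%:R.
  rewrite -ler_pdivrMl// mulrC; near: n; exact: nbhs_infty_ger.
have np0 : 0 <= n%:R * p by rewrite mulr_ge0// ltW.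
have q1 : 1 - p <= 1 by lra.
have lo : - (n%:R * p ^+ 2) <= (1 - p) ^+ (n - j) - expR (- (n%:R * p)).
  have h1 : (1 - p) ^+ n <= (1 - p) ^+ (n - j).
    by apply: ler_wiXn2l; rewrite ?subr_ge0// leq_subr.
  have h2 := pow_1N_ge n p01; rewrite mulrBr mulr1 in h2.
  have h3 : expR (- (n%:R * p)) * (n%:R * p ^+ 2) <= n%:R * p ^+ 2.
    by apply: ler_piMl; rewrite ?mulr_ge0 ?sqr_ge0 ?expR_le1 ?oppr_le0// ltW.
  by lra.
have up : (1 - p) ^+ (n - j) - expR (- (n%:R * p)) <= p * j%:R * expR j%:R.
  apply: le_trans (lerB (pow_1N_le (n - j) p01) (lexx _)) _.
  have -> : - ((n - j)%:R * p) = - (n%:R * p) + j%:R * p by rewrite natrB//; ring.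
  rewrite expRD -[X in _ - X]mulr1 -mulrBr.
  have h1 : expR (j%:R * p) - 1 <= p * j%:R * expR j%:R.
    have := expR_ge1Dx (- (j%:R * p)); have := expRxMexpNx_1 (j%:R * p).
    set x := expR (j%:R * p); set y := expR _ => xy1 yle.
    have x0 : 0 <= x by exact: expR_ge0.
    apply: (@le_trans _ _ (x * (j%:R * p))).
      have := ler_wpM2l x0 yle; rewrite xy1; lra.
    rewrite mulrC [j%:R * p]mulrC; apply: ler_wpM2l; first by rewrite mulr_ge0.
    by rewrite ler_expR ler_piMr.
  have h2 : 0 <= p * j%:R * expR j%:R by rewrite !mulr_ge0 ?expR_ge0.
  have h3 : expR (- (n%:R * p)) <= 1 by rewrite expR_le1 oppr_le0.
  have h4 := expR_ge0 (- (n%:R * p)).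
  by apply: le_trans (ler_wpM2l h4 h1) _; exact: ler_piMl.
have K0 : 0 <= K by exact: le_trans npK.
have b1 : n%:R * p ^+ 2 <= e.
  rewrite -(ler_pM2r n0); apply: le_trans Cn.
  have : (n%:R * p) ^+ 2 <= K ^+ 2 by rewrite lerXn2r ?nnegrE.
  have : 0 <= K * j%:R * expR j%:R by rewrite !mulr_ge0 ?expR_ge0.
  by rewrite /C; set u := K ^+ 2; set v := _ * expR _; lra.
have b2 : p * j%:R * expR j%:R <= e.
  rewrite -(ler_pM2r n0); apply: le_trans Cn.
  have : n%:R * p * (j%:R * expR j%:R) <= K * (j%:R * expR j%:R).
    by rewrite ler_wpM2r// mulr_ge0 ?expR_ge0.
  have : 0 <= K ^+ 2 by rewrite sqr_ge0.
  by rewrite /C; set u := K ^+ 2; lra.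
by rewrite ler_norml; apply/andP; split; lra.
Unshelve. all: by end_near. Qed.

(** Once 2 j <= n, the exponent n - j is at least n / 2, and half of the exponential decay is enough
    for a dominating function. *)
Lemma binomial_exp_le j n p : 0 <= p <= 1 -> (j.*2 <= n)%N ->
  (1 - p) ^+ (n - j) <= expR (- (n%:R * p / 2)).
Proof.
move=> p01 jn; apply: le_trans (pow_1N_le _ p01) _; rewrite ler_expR lerN2.
have /andP[p0 _] := p01; rewrite mulrAC; apply: ler_wpM2r => //.
rewrite ler_pdivrMr// -natrM ler_nat muln2 doubleB -{1}(addnK n n) addnn.
by rewrite leq_sub2l.
Qed.

Local Open Scope ereal_scope.

Lemma nneseries_exp (x : R) : (0 <= x)%R -> \sum_(l <oo) (x ^+ l / l`!%:R)%:E = (expR x)%:E.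
Proof.
move=> x0; rewrite /expR -EFin_lim; last exact: is_cvg_series_exp_coeff.
by congr (limn _); apply/funext => m /=; rewrite -sumEFin.
Qed.

(** The mean of C(N, j) q^(N - j) for N Poisson of parameter n: terms with m < j vanish, and m = i +
    j leaves the exponential series of n q. *)
Lemma poisson_factorial_moment n j (q : R) : (0 <= q)%R ->
  \sum_(m <oo) (expR (- n%:R) * n%:R ^+ m / m`!%:R * ('C(m, j)%:R * q ^+ (m - j)))%:E =
  (n%:R ^+ j / j`!%:R * expR (- (n%:R * (1 - q))))%:E.
Proof.
move=> q0; pose u m : \bar R :=
  (expR (- n%:R) * n%:R ^+ m / m`!%:R * ('C(m, j)%:R * q ^+ (m - j)))%:E.
transitivity (\sum_(m <oo) u m); first by [].
have u0 m : 0 <= u m.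
  by rewrite lee_fin !mulr_ge0 ?expR_ge0 ?invr_ge0 ?exprn_ge0.
rewrite (@nneseries_split _ u 0 j); last by move=> k _; exact: u0.
rewrite big1_seq ?add0e; last first.
  move=> i; rewrite mem_index_iota add0n => /andP[_ /andP[_ ij]].
  by rewrite /u bin_small// mul0r mulr0.
rewrite add0n -(@nneseries_addn _ u j)//.
have uE i : u (i + j)%N = (n%:R ^+ j / j`!%:R * expR (- n%:R))%:E * ((n%:R * q) ^+ i / i`!%:R)%:E.
  rewrite /u addnK -EFinM; congr EFin; rewrite exprD exprMn.
  have fm : ((i + j)`!%:R = 'C(i + j, j)%:R * (j`!%:R * i`!%:R) :> R)%R.
    by rewrite -!natrM -(bin_fact (leq_addl i j)) addnK.
  have C0 : ('C(i + j, j)%:R != 0 :> R)%R by rewrite pnatr_eq0 -lt0n bin_gt0 leq_addl.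
  have f1 : (j`!%:R != 0 :> R)%R by rewrite pnatr_eq0 -lt0n fact_gt0.
  have f2 : (i`!%:R != 0 :> R)%R by rewrite pnatr_eq0 -lt0n fact_gt0.
  by rewrite fm; field; rewrite C0 f1 f2.
under eq_eseriesr do rewrite uE.
rewrite nneseriesZl; last first.
  by move=> i _; rewrite lee_fin divr_ge0// exprn_ge0// mulr_ge0.
rewrite nneseries_exp ?mulr_ge0// -EFinM; congr EFin.
by rewrite -[LHS]mulrA -expRD; congr (_ * expR _)%R; ring.
Qed.

End count_laws.

(** * The mean count for the Poisson process *)

Section poisson.
Variables (R : realType) (d k : nat) (f : 'rV[R]_d -> R).
Hypothesis d0 : (0 < d)%N.
Hypothesis bf : bounded_density f.
Local Open Scope ereal_scope.

(** All terms are nonnegative, so the Poisson series can be summed under the integral, where it is a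
    factorial moment with q = 1 - [ballmass]. *)
Lemma ENpois_palm (r : R) n : ENpois k f r n =
  (n%:R ^+ k.+1 / k.+1`!%:R)%:E * palm_gen k f r (fun p => expR (- (n%:R * p))).
Proof.
have f0 := density_ge0 bf.
pose A (s : nat -> R) : R := ((good (@pts R d k s) && (crad (@pts R d k s) <= r)%R)%:R *
    (\prod_(i < k.+1) f (blk d i s)))%R.
pose B (s : nat -> R) : R := ballmass f (cc (@pts R d k s)) (crad (@pts R d k s)).
have A0 s : (0 <= A s)%R by rewrite mulr_ge0// prodr_ge0.
have B1 s : (0 <= 1 - B s)%R by rewrite subr_ge0; exact: ballmass_le1.
have mA : measurable_fun setT (A : rseq R -> R).
  apply: measurable_funM.
    apply: measurable_bool_nat; apply: measurable_and; first exact: (measurable_good (@vmeas_pts R d k)).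
    by apply: measurable_fun_ler => //; exact: (measurable_crad (@vmeas_pts R d k)).
  by apply: measurable_prod => i _; apply: (measurable_density bf); exact: vmeas_blk.
have mB : measurable_fun setT (B : rseq R -> R).
  apply: measurable_ballmass => //; first exact: (vmeas_cc (@vmeas_pts R d k)).
  exact: (measurable_crad (@vmeas_pts R d k)).
pose w m : R := (expR (- n%:R) * n%:R ^+ m / m`!%:R * 'C(m, k.+1)%:R)%R.
have w0 m : (0 <= w m)%R.
  by rewrite /w !mulr_ge0 ?expR_ge0 ?invr_ge0 ?exprn_ge0.
pose g m (s : rseq R) : \bar R := (w m * (A s * (1 - B s) ^+ (m - k.+1)))%:E.
have mg0 m : measurable_fun setT (fun s : rseq R => (A s * (1 - B s) ^+ (m - k.+1))%R).
  by apply: measurable_funM => //; apply: measurable_funX; exact: measurable_funB.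
have mg m : measurable_fun setT (g m).
  by apply/measurable_EFinP; exact: measurable_funM.
have ABge0 m s : (0 <= A s * (1 - B s) ^+ (m - k.+1))%R by rewrite mulr_ge0// exprn_ge0.
have g0 m (s : rseq R) : 0 <= g m s by rewrite lee_fin mulr_ge0.
rewrite /ENpois.
transitivity (\sum_(m <oo) \int[lebs R (k.+1 * d)]_s g m s).
  apply: eq_eseriesr => m _; rewrite (ENbin_palm k d0 bf) muleA -EFinM /g.
  under [RHS]eq_integral do rewrite EFinM.
  rewrite ge0_integralZl//; last 3 first.
  - exact/measurable_EFinP.
  - by move=> s _; rewrite lee_fin.
  - by rewrite lee_fin.
rewrite -integral_nneseries//.
rewrite -ge0_integralZl//; last 2 first.
- apply/measurable_EFinP; apply: measurable_funM; first exact: mA.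
  apply: measurableT_comp => //; apply: measurableT_comp => //; exact: measurable_funM.
- by move=> s _; rewrite lee_fin mulr_ge0 ?expR_ge0//; exact: A0.
apply: eq_integral => s _; rewrite /g.
have gE m : (w m * (A s * (1 - B s) ^+ (m - k.+1)))%:E = (A s)%:E *
   (expR (- n%:R) * n%:R ^+ m / m`!%:R * ('C(m, k.+1)%:R * (1 - B s) ^+ (m - k.+1)))%:E.
  by rewrite -EFinM /w; congr EFin; ring.
under eq_eseriesr do rewrite gE.
rewrite nneseriesZl; last first.
  by move=> i _; rewrite lee_fin !mulr_ge0 ?expR_ge0 ?invr_ge0 ?exprn_ge0.
rewrite poisson_factorial_moment// subKr -!EFinM; congr EFin.
rewrite -/(A s) -/(B s); ring.
Qed.

End poisson.

(** * Limits of the rescaled integrals *)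

Section dominated.
Local Open Scope ereal_scope.

Lemma cvg_integral_dominated d (T : measurableType d) (R : realType)
    (m : {measure set T -> \bar R}) (g_ : nat -> T -> \bar R) (g : T -> \bar R) (H : T -> R) :
  (forall n, measurable_fun setT (g_ n)) -> (forall n x, 0 <= g_ n x) ->
  (\forall n \near \oo, forall x, g_ n x <= (H x)%:E) ->
  measurable_fun setT H -> \int[m]_x (H x)%:E < +oo ->
  (forall x, g_ n x @[n --> \oo] --> g x) ->
  \int[m]_x g_ n x @[n --> \oo] --> \int[m]_x g x.
Proof.
move=> mg g0 [N _ gH] mH Hoo gcvg.
have H0 x : (0 <= H x)%R by rewrite -lee_fin; apply: le_trans (g0 N x) (gH N _ x) => /=.
rewrite -(@cvg_shiftn N).
apply: (@dominated_cvg _ T R m setT measurableT (fun n => g_ (n + N)%N) g (EFin \o H)) => //.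
- by move=> x _; rewrite (@cvg_shiftn N (\bar R) (fun n => g_ n x)).
- apply/integrableP; split; first exact/measurable_EFinP.
  by under eq_integral => x _ do rewrite gee0_abs ?lee_fin//.
- by move=> n x _; rewrite gee0_abs//; apply: gH; rewrite /= leq_addl.
Qed.

End dominated.

Section palm_limit.
Variables (R : realType) (d k : nat) (f : 'rV[R]_d -> R).
Hypothesis d0 : (0 < d)%N.
Hypothesis k0 : (0 < k)%N.
Hypothesis bf : bounded_density f.
Local Open Scope ereal_scope.
Let f0 := density_ge0 bf.
Local Hint Resolve f0 : core.

Variables (M : R).
Hypothesis M1 : (1 <= M)%R.
Hypothesis fM : forall x, (f x <= M)%R.
Let M0 : (0 <= M)%R. Proof. exact: le_trans M1. Qed.

Let mf : measurable_fun setT (fun s : rseq R => f (blk d 0 s)).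
Proof. by apply: (measurable_density bf); exact: vmeas_blk. Qed.

Variables (a r : nat -> R) (Q : nat -> R -> R) (lam : R) (cut : (nat -> R) -> bool)
  (H : (nat -> R) -> R).
Hypothesis a0 : forall n, (0 < a n)%R.
Hypothesis ca : a n @[n --> \oo] --> 0%R.
Hypothesis cna : (n%:R * a n ^+ d)%R @[n --> \oo] --> lam.
Hypothesis lam0 : (0 <= lam)%R.
Hypothesis mQ : forall n, measurable_fun setT (Q n).
Hypothesis Q01 : forall n (p : R), (0 <= p <= 1)%R -> (0 <= Q n p <= 1)%R.
Hypothesis Qexp : forall K e : R, (0 < e)%R -> \forall n \near \oo,
  forall p : R, (0 <= p <= 1)%R -> (n%:R * p <= K)%R -> (`|Q n p - expR (- (n%:R * p))| <= e)%R.
Hypothesis cutP : forall y, \forall n \near \oo, (a n * crad (@ypts R d k y) <= r n)%R = cut y.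
Hypothesis mH : measurable_fun setT (H : rseq R -> R).
Hypothesis H0 : forall y, (0 <= H y)%R.
Hypothesis Hoo : \int[lebs R (k * d)]_y (H y)%:E < +oo.
Hypothesis domH : \forall n \near \oo, forall y,
  good (@ypts R d k y) -> (a n * crad (@ypts R d k y) <= r n)%R ->
  forall x, (scaled_weight k f (a n) (Q n) y x <= H y * f x)%R.

Let Q0 n p : (0 <= p <= 1)%R -> (0 <= Q n p)%R.
Proof. by move=> p01; have /andP[] := Q01 n p01. Qed.

(** Dominated convergence over the shapes y, with [cvg_inner] as pointwise limit. The function [cut]
    is the eventual truth value of the radius constraint, and the bound H y * f x integrates over x
    to H y because f has mass 1. *)
Lemma cvg_palm_gen :
  ((a n ^+ (k * d))^-1)%:E * palm_gen k f (r n) (Q n) @[n --> \oo] -->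
  \int[lebs R (k * d)]_y ((good (@ypts R d k y) && cut y)%:R%:E *
    \int[lebs R d]_x (f (blk d 0 x) ^+ k.+1 *
      expR (- (lam * (omega R d * crad (@ypts R d k y) ^+ d) * f (blk d 0 x))))%:E).
Proof.
pose g n (y : nat -> R) := (good (@ypts R d k y) && (a n * crad (@ypts R d k y) <= r n)%R)%:R%:E *
     \int[lebs R d]_x (scaled_weight k f (a n) (Q n) y (blk d 0 x))%:E.
have sw0 n y x : (0 <= scaled_weight k f (a n) (Q n) y x)%R.
  by apply: scaled_weight_ge0 => //; exact: Q0.
have -> : (fun n => ((a n ^+ (k * d))^-1)%:E * palm_gen k f (r n) (Q n)) =
    fun n => \int[lebs R (k * d)]_y g n y.
  apply/funext => n; rewrite (@palm_scale R d k f bf (Q n) (mQ n) (@Q0 n) (a n) (r n) (a0 n)).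
  by rewrite muleA -EFinM mulVf ?mul1e// gt_eqF// exprn_gt0.
apply: (@cvg_integral_dominated _ (rseq R) R (lebs R (k * d)) g _ H) => //.
- move=> n; apply: emeasurable_funM.
    apply/measurable_EFinP; apply: measurable_bool_nat; apply: measurable_and.
      exact: (measurable_good (@vmeas_ypts R d k)).
    apply: measurable_fun_ler => //; apply: measurable_funM => //.
    exact: (measurable_crad (@vmeas_ypts R d k)).
  apply: (@measurable_integral_lebs R _ (rseq R) d
    (fun p => (scaled_weight k f (a n) (Q n) p.1 (blk d 0 p.2))%:E)); last by move=> p; rewrite lee_fin.
  apply/measurable_EFinP; exact: measurable_scaled_weight.
- by move=> n y; rewrite mule_ge0 ?lee_fin//; apply: integral_ge0 => x _; rewrite lee_fin.
- have := domH; apply: filterS => n dn y; rewrite /g.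
  have [/andP[gy ry]|_] := boolP (_ && _); last by rewrite mul0e lee_fin.
  rewrite mul1e; apply: (@le_trans _ _ (\int[lebs R d]_x ((H y)%:E * (f (blk d 0 x))%:E))).
    by apply: le_integral_nomeas => x; rewrite -?EFinM lee_fin//; exact: dn.
  rewrite ge0_integralZl//; last 3 first.
  - exact/measurable_EFinP.
  - by move=> x _; rewrite lee_fin.
  - by rewrite lee_fin.
  by rewrite integral_density// mule1.
move=> y; have [gy|bad] := boolP (good (@ypts R d k y)); last first.
  by rewrite /g (negbTE bad) /= mul0e; under eq_fun do rewrite mul0e; exact: cvg_cst.
have rho0 := crad_gt0 k0 gy.
pose y' (i : 'I_k) : 'rV[R]_d := blk d i y.
have := @cvg_inner R d k f bf (cc (@ypts R d k y)) (crad (@ypts R d k y)) y' a Q lam M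
   (omega R d * crad (@ypts R d k y) ^+ d) a0 ca cna lam0 M1 fM
   (ball_volume (cc (@ypts R d k y)) rho0) mQ Q01 Qexp.
move=> inner; rewrite /g.
have cutn := cutP y; case: (cut y) in cutn *; last first.
  rewrite mul0e; apply: cvg_near_cst; apply: filterS cutn => n ->.
  by rewrite andbF mul0e.
apply: cvgeM => //; first by rewrite mule_defE eqe oner_eq0 /= andbF.
apply: cvg_near_cst; apply: filterS cutn => n ->.
by rewrite (gy : good _ = true).
Qed.

End palm_limit.

(** * Avoidance probabilities and the two regimes of lam *)

Section count_law.
Variable R : realType.

(** The uniform approximation for n p <= K gives the limit at a fixed simplex; the last clause holds
    for every mass p and provides domination when lam is infinite. Its factor 1/2 leaves room for
    the vertices removed from the binomial exponent. *)
Definition exp_law (Q : nat -> R -> R) : Prop :=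
  [/\ forall n, measurable_fun setT (Q n),
      forall n p, 0 <= p <= 1 -> 0 <= Q n p <= 1,
      forall K e : R, 0 < e -> \forall n \near \oo, forall p : R, 0 <= p <= 1 ->
        n%:R * p <= K -> `|Q n p - expR (- (n%:R * p))| <= e &
      \forall n \near \oo, forall p : R, 0 <= p <= 1 -> Q n p <= expR (- (n%:R * p / 2))].

Lemma binomial_law j : exp_law (fun n p => (1 - p) ^+ (n - j)).
Proof.
split.
- by move=> n; apply: measurable_funX; exact: measurable_funB.
- move=> n p /andP[p0 p1]; rewrite exprn_ge0 ?subr_ge0//= exprn_ile1// ?subr_ge0//.
  by rewrite lerBlDr lerDl.
- by move=> K e; exact: binomial_exp_cvg.
- by exists j.*2 => // n /= jn p p01; exact: binomial_exp_le.
Qed.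

Lemma poisson_law : exp_law (fun n p => expR (- (n%:R * p))).
Proof.
split.
- by move=> n; apply: measurableT_comp => //; apply: measurable_funN; exact: measurable_funM.
- by move=> n p /andP[p0 p1]; rewrite expR_ge0 expR_le1 oppr_le0 mulr_ge0.
- by move=> K e e0; apply: nearW => n p _ _; rewrite subrr normr0 ltW.
- apply: nearW => n p /andP[p0 p1]; rewrite ler_expR lerN2.
  by rewrite ler_pdivrMr// ler_peMr ?mulr_ge0// ler1n.
Qed.

Lemma ffact_ratio_cvg j : (n ^_ j)%:R / n%:R ^+ j @[n --> \oo] --> (1 : R).
Proof.
elim: j => [|j IH].
  by under eq_fun do rewrite ffactn0 expr0 divr1; exact: cvg_cst.
have lim1 : (n - j)%:R / n%:R @[n --> \oo] --> (1 : R).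
  apply/cvgrPdist_le => e e0; near=> n.
  have n0 : 0 < n%:R :> R by rewrite ltr0n; near: n; exact: nbhs_infty_gt.
  have jn : (j <= n)%N by near: n; exact: nbhs_infty_ge.
  rewrite natrB// mulrBl mulfV ?gt_eqF// opprB addrCA subrr addr0 ger0_norm ?divr_ge0//.
  have : e^-1 * j%:R <= n%:R by near: n; exact: nbhs_infty_ger.
  by rewrite ler_pdivrMl// ler_pdivrMr.
rewrite -[X in _ --> X]mulr1.
under eq_fun do rewrite ffactnSr natrM exprSr invfM mulrACA.
exact: cvgM.
Unshelve. all: by end_near. Qed.

End count_law.

Section law_limit.
Variables (R : realType) (d k : nat) (f : 'rV[R]_d -> R).
Hypothesis d0 : (0 < d)%N.
Hypothesis k0 : (0 < k)%N.
Hypothesis bf : bounded_density f.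
Variables (Q : nat -> R -> R) (r : nat -> R).
Hypothesis lawQ : exp_law Q.
Hypothesis r0 : forall n, 0 < r n.
Hypothesis cr : r n @[n --> \oo] --> (0 : R).
Local Open Scope ereal_scope.
Let f0 := density_ge0 bf.
Local Hint Resolve f0 : core.

Definition limit_integral (lam : R) (cut : (nat -> R) -> bool) : \bar R :=
  \int[lebs R (k * d)]_y ((good (@ypts R d k y) && cut y)%:R%:E *
    \int[lebs R d]_x (f (blk d 0 x) ^+ k.+1 *
      expR (- (lam * (omega R d * crad (@ypts R d k y) ^+ d) * f (blk d 0 x))))%:E).

Let bound : exists M : R, (1 <= M)%R /\ forall x, (f x <= M)%R.
Proof.
have [_ [_ [[M fM] _]]] := bf; exists (Num.max 1%R M); rewrite le_max lexx; split => // x.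
by rewrite le_max fM orbT.
Qed.

(** At scale a = r the constraint is exactly crad <= 1, so the coordinates of y lie in [-2, 2] and
    M^k times the indicator of that cube dominates. The factor lam^k is the limit of (n r_n^d)^k,
    the ratio of the two normalisations. *)
Lemma palm_limit_fin (lam : R) : (0 < lam)%R ->
  (n%:R * r n ^+ d)%R @[n --> \oo] --> lam ->
  (n%:R ^+ k)%:E * palm_gen k f (r n) (Q n) @[n --> \oo] -->
  (lam ^+ k)%:E * limit_integral lam (fun y => (crad (@ypts R d k y) <= 1)%R).
Proof.
move=> lam0 cnr; have [mQ Q01 Qexp _] := lawQ; have [M [M1 fM]] := bound.
have M0 : (0 <= M)%R by exact: le_trans M1.
pose H (y : nat -> R) : R := (M ^+ k * \prod_(j < k * d) (`|y j| <= 2)%R%:R)%R.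
have mI : measurable_fun setT (fun y : rseq R => \prod_(j < k * d) (`|y j| <= 2)%R%:R : R)%R.
  apply: measurable_prod => j _; apply: measurable_bool_nat; apply: measurable_fun_ler => //.
  by apply: measurableT_comp => //; exact: measurable_coord.
have lim1 : ((r n ^+ (k * d))^-1)%:E * palm_gen k f (r n) (Q n) @[n --> \oo] -->
    limit_integral lam (fun y => (crad (@ypts R d k y) <= 1)%R).
  apply: (@cvg_palm_gen R d k f k0 bf M M1 fM r r Q lam _ H) => //.
  - exact: ltW.
  - by move=> y; apply: nearW => n; rewrite ger_pMr.
  - exact: measurable_funM.
  - by move=> y; rewrite mulr_ge0 ?exprn_ge0// prodr_ge0.
  - under eq_integral do rewrite EFinM.
    rewrite ge0_integralZl//; last 3 first.
    + exact/measurable_EFinP.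
    + by move=> y _; rewrite lee_fin prodr_ge0.
    + by rewrite lee_fin exprn_ge0.
    by apply: lte_mul_pinfty; rewrite ?lee_fin ?exprn_ge0//; by rewrite box_volume// ltry.
  - apply: nearW => n y gy ry x.
    have c1 : (crad (@ypts R d k y) <= 1)%R by move: ry; rewrite ger_pMr.
    rewrite /H big1 ?mulr1; last first.
      move=> j _; rewrite (le_trans (ypts_bound (ltn_ord j) gy))//.
      by rewrite -[leRHS]mulr1 ler_pM2l.
    rewrite /scaled_weight -mulrA mulrC; apply: ler_wpM2r => //.
    have /andP[q0 q1] : (0 <= Q n (ballmass f (x + r n *: cc (@ypts R d k y)) (r n * crad (@ypts R d k y))) <= 1)%R.
      by apply: Q01; rewrite ballmass_ge0//= ballmass_le1.
    rewrite -[leRHS]mulr1; apply: ler_pM => //; first exact: prodr_ge0.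
    rewrite -[X in (_ <= M ^+ X)%R](card_ord k) -prodr_const; apply: ler_prod => i _.
    by rewrite f0 fM.
have -> : (fun n => (n%:R ^+ k)%:E * palm_gen k f (r n) (Q n)) =
    (fun n => ((n%:R * r n ^+ d) ^+ k)%:E * (((r n ^+ (k * d))^-1)%:E * palm_gen k f (r n) (Q n))).
  apply/funext => n; rewrite muleA -EFinM; congr (_%:E * _).
  by rewrite exprMn -exprM [(d * k)%N]mulnC mulfK// gt_eqF// exprn_gt0.
apply: cvgeM => //.
- by rewrite mule_defE eqe expf_eq0 (gt_eqF lam0) andbF /= andbF.
- apply: cvg_EFin; first exact: nearW.
  apply: (@continuous_cvg _ R R _ _ (fun n => n%:R * r n ^+ d)%R (fun x => x ^+ k)%R lam) => //.
  exact: exprn_continuous.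
Qed.

Lemma palm_limit_inf : (n%:R * r n ^+ d)%:E @[n --> \oo] --> +oo ->
  lower_bounded f -> convex_set (supp f) ->
  (n%:R ^+ k)%:E * palm_gen k f (r n) (Q n) @[n --> \oo] --> limit_integral 1 (fun _ => true).
Proof.
move=> cnr lf cf; have [mQ Q01 Qexp Qle] := lawQ; have [M [M1 fM]] := bound.
have M0 : (0 <= M)%R by exact: le_trans M1.
have [kap [D [kap0 D0 massge]]] := convex_ballmass_ge bf lf cf.
(* The scale n^(-1/d), at which n a_n^d = 1; the maximum with 1 keeps it positive at n = 0. *)
pose a n : R := ((maxn 1 n)%:R `^ (- (d%:R)^-1))%R.
have a0 n : (0 < a n)%R by rewrite powR_gt0// ltr0n leq_max.
have ad n : (a n ^+ d = (maxn 1 n)%:R^-1)%R.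
  rewrite -powR_mulrn ?powR_ge0// -powRrM mulNr mulVf ?pnatr_eq0 -?lt0n//.
  by rewrite powR_inv1.
have na n : (0 < n)%N -> (n%:R * a n ^+ d = 1)%R.
  by move=> n0; rewrite ad (maxn_idPr n0) mulfV// pnatr_eq0 -lt0n.
have ca : a n @[n --> \oo] --> (0 : R)%R.
  apply/cvgrPdist_le => e e0.
  near=> n; rewrite sub0r normrN gtr0_norm//.
  rewrite -(ler_pXn2r d0) ?nnegrE ?(ltW e0) ?(ltW (a0 n))// ad.
  have n0 : (0 < n)%N by near: n; exact: nbhs_infty_gt.
  rewrite (maxn_idPr n0) -[leRHS]invrK lef_pV2 ?posrE ?invr_gt0 ?exprn_gt0 ?ltr0n//.
  near: n; exact: nbhs_infty_ger.
have kap2 : (0 < kap / 2)%R by rewrite divr_gt0.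
(* Half of the mass constant: n p is at least kap crad^d, and [exp_law] bounds Q n p by exp(- n p /
   2). *)
pose G (y : nat -> R) : R := ((good (@ypts R d k y))%:R * expR (- (kap / 2 * crad (@ypts R d k y) ^+ d)))%R.
pose H (y : nat -> R) : R := (M ^+ k * G y)%R.
have G0 y : (0 <= G y)%R by rewrite mulr_ge0 ?expR_ge0.
have mG : measurable_fun setT (G : rseq R -> R).
  apply: measurable_funM.
    by apply: measurable_bool_nat; exact: (measurable_good (@vmeas_ypts R d k)).
  apply: measurableT_comp => //; apply: measurable_funN; apply: measurable_funM => //.
  by apply: measurable_funX; exact: (measurable_crad (@vmeas_ypts R d k)).
have lim1 : ((a n ^+ (k * d))^-1)%:E * palm_gen k f (r n) (Q n) @[n --> \oo] -->
    limit_integral 1 (fun _ => true).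
  apply: (@cvg_palm_gen R d k f k0 bf M M1 fM a r Q 1%R (fun _ => true) H) => //.
  - by apply: cvg_near_cst; exists 1%N => // n /= n0; exact: na.
  (* As n a_n^d = 1, the constraint a_n crad <= r_n, raised to the power d and multiplied by n,
     reads crad^d <= n r_n^d; it holds for n large because the right-hand side diverges. *)
  - move=> y; have big := cvgey_ge cnr (crad (@ypts R d k y) ^+ d)%R.
    have c0 : (0 <= crad (@ypts R d k y))%R by exact: edist_ge0.
    near=> n; apply/idP; have n0 : (0 < n)%N by near: n; exact: nbhs_infty_gt.
    rewrite -(ler_pXn2r d0) ?nnegrE ?mulr_ge0 ?(ltW (a0 n)) ?(ltW (r0 n))//.
    have n0' : (0 < n%:R :> R)%R by rewrite ltr0n.
    rewrite -(ler_pM2l n0') exprMn mulrA na// mul1r -lee_fin.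
    near: n; exact: big.
  - exact: measurable_funM.
  - by move=> y; rewrite mulr_ge0 ?exprn_ge0.
  - under eq_integral do rewrite EFinM.
    rewrite ge0_integralZl//; last 3 first.
    + exact/measurable_EFinP.
    + by move=> y _; rewrite lee_fin.
    + by rewrite lee_fin exprn_ge0.
    by apply: lte_mul_pinfty; rewrite ?lee_fin ?exprn_ge0//; exact: good_expR_lty.
  - near=> n => y gy ry x.
    have n0 : (0 < n)%N by near: n; exact: nbhs_infty_gt.
    (* The lower bound on ball masses covers radii up to D only; since r_n tends to 0, every
       admissible radius is eventually in that range. *)
    have rD : (r n <= D)%R.
      near: n; have /cvgrPdist_le /(_ _ D0) := cr; apply: filterS => n.
      by rewrite sub0r normrN gtr0_norm.
    have Qn : forall p : R, (0 <= p <= 1)%R -> (Q n p <= expR (- (n%:R * p / 2)))%R.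
      by near: n.
    rewrite /H /G gy mul1r /scaled_weight.
    set z := @ypts R d k y in gy ry *.
    have rho0 := crad_gt0 k0 gy.
    have p01 : (0 <= ballmass f (x + a n *: cc z) (a n * crad z) <= 1)%R.
      by rewrite ballmass_ge0//= ballmass_le1.
    have /andP[q0 q1] := Q01 n _ p01.
    have [fx|fx] := ltP 0%R (f x); last first.
      have -> : f x = 0%R by apply/eqP; rewrite eq_le fx f0.
      by rewrite !mul0r mulr0.
    have P0 : (0 <= \prod_(i < k) f (x + a n *: blk d i y))%R by exact: prodr_ge0.
    have PM : (\prod_(i < k) f (x + a n *: blk d i y) <= M ^+ k)%R.
      rewrite -[X in (_ <= M ^+ X)%R](card_ord k) -prodr_const; apply: ler_prod => i _.
      by rewrite f0 fM.
    have [/forallP fz|/forallPn[i]] := boolP [forall i : 'I_k, (0 < f (x + a n *: blk d i y))%R]; last first.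
      rewrite -leNgt => fz; rewrite (bigD1 i)//=.
      have -> : f (x + a n *: blk d i y)%R = 0%R by apply/eqP; rewrite eq_le fz f0.
      by rewrite mul0r mulr0 mul0r !mulr_ge0 ?exprn_ge0 ?expR_ge0.
    (* If f vanished at a vertex the weight would be 0; all vertices are therefore in the support,
       and the center is a convex combination of them. *)
    have cz : supp f (x + a n *: cc z)%R.
      have [ai [t [t0 [t1]]]] := (goodP z).1 gy.
      rewrite circumcenterE// => ->.
      have -> : (x + a n *: \sum_i t i *: z i = \sum_i t i *: (x + a n *: z i))%R.
        under [RHS]eq_bigr do rewrite scalerDr.
        rewrite big_split /= -scaler_suml t1 scale1r; congr (_ + _)%R.
        by rewrite scaler_sumr; apply: eq_bigr => i _; rewrite !scalerA mulrC.
      apply: convex_comb => // i; apply: supp_pos.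
      rewrite /z /ypts /with0; case: unliftP => [j _|_]; first exact: fz.
      by rewrite scaler0 addr0.
    have mge := massge _ (a n * crad z)%R cz.
    rewrite -mulrA mulrC; apply: ler_wpM2r => //; apply: ler_pM => //.
    apply: le_trans (Qn _ p01) _; rewrite ler_expR lerN2.
    rewrite mulrAC ler_pM2r//.
    have := mge; rewrite mulr_gt0//= (le_trans ry rD) => /(_ isT) h.
    have : (n%:R * (kap * (a n * crad z) ^+ d) <= n%:R * ballmass f (x + a n *: cc z) (a n * crad z))%R.
      by rewrite ler_wpM2l.
    apply: le_trans.
    have -> : (n%:R * (kap * (a n * crad z) ^+ d) = (n%:R * a n ^+ d) * (kap * crad z ^+ d))%R.
      by rewrite exprMn; ring.
    by rewrite na// mul1r.
apply: cvg_trans lim1; apply: near_eq_cvg; exists 1%N => // n /= n0.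
rewrite mulnC exprM -exprVn; have := na _ n0; move=> /(congr1 (fun x => x / a n ^+ d)%R).
by rewrite mulfK ?gt_eqF ?exprn_gt0// mul1r => ->.
Unshelve. all: by end_near. Qed.

End law_limit.

(** * The limit constants *)

Section limit_identification.
Variables (R : realType) (d k : nat).
Hypothesis d0 : (0 < d)%N.
Hypothesis k0 : (0 < k)%N.
Local Open Scope ereal_scope.
Local Notation z := (@ypts R d k).

Lemma iint_iint m n (K : rseq R * rseq R -> R) : measurable_fun setT K ->
  (forall p, 0 <= K p)%R ->
  iint m (fun s => iint n (fun t => (K (s, t))%:E)) =
  \int[lebs R m]_s \int[lebs R n]_t (K (s, t))%:E.
Proof.
move=> mK K0; have mKe : measurable_fun setT (EFin \o K) by exact/measurable_EFinP.
transitivity (iint m (fun s => \int[lebs R n]_t (K (s, t))%:E)).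
  congr iint; apply/funext => s; rewrite iint_lebs// => [|t]; last by rewrite lee_fin.
  apply: (measurableT_comp mKe); exact: measurable_pair1.
rewrite iint_lebs// => [|s]; last by apply: integral_ge0 => t _; rewrite lee_fin.
apply: (@measurable_integral_lebs R _ (rseq R) n (EFin \o K)) => //.
Qed.

Lemma integral_swap m n (K : rseq R * rseq R -> R) : measurable_fun setT K ->
  (forall p, 0 <= K p)%R ->
  \int[lebs R m]_s \int[lebs R n]_t (K (s, t))%:E =
  \int[lebs R n]_t \int[lebs R m]_s (K (s, t))%:E.
Proof.
move=> mK K0; apply: (@fubini_tonelli _ _ _ _ R (lebs R m) (lebs R n) (EFin \o K)).
  exact/measurable_EFinP.
by move=> p; rewrite lee_fin.
Qed.

Lemma crad_ge0 y : (0 <= crad (z y))%R. Proof. exact: edist_ge0. Qed.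

Lemma h_good (y : nat -> R) : h (fun i : 'I_k => blk d i y) = (good (z y))%:R :> R.
Proof.
have := goodP (z y); rewrite /h -/(z y); case: (good _) => gP.
  by case: asboolP => // nh; case: nh; apply/gP.
by case: asboolP => // /gP.
Qed.

Lemma R0_crad (y : nat -> R) : good (z y) -> R0 (fun i : 'I_k => blk d i y) = crad (z y).
Proof. by move=> /goodP[ai _]; rewrite /R0 /circumradius -/(z y) circumcenterE. Qed.

(** The homothety y -> c y preserves [good], multiplies the radius by c and has Jacobian c^(k d). *)
Lemma integral_good_scale (c : R) (F : R -> R) : (0 < c)%R -> measurable_fun setT F ->
  (forall x, 0 <= F x)%R ->
  (c ^+ (k * d))%:E * \int[lebs R (k * d)]_y ((good (z y))%:R * F (c * crad (z y)))%:E =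
  \int[lebs R (k * d)]_y ((good (z y))%:R * F (crad (z y)))%:E.
Proof.
move=> c0 mF F0; rewrite -(@integral_affine R (k * d) (fun _ => 0%R) c
    (fun y => ((good (z y))%:R * F (crad (z y)))%:E) c0).
- congr (_ * _); apply: eq_integral => y _.
  have -> : z (fun j => 0 + c * y j)%R = (fun i => 0 + c *: z y i)%R.
    apply/funext => i; rewrite /ypts /with0; case: unliftP => [j _|_].
      by apply/rowP => l; rewrite !mxE.
    by rewrite scaler0 addr0.
  rewrite (good_affine _ _ c0); have [gy|_] := boolP (good _); last by rewrite !mul0r.
  by rewrite (crad_affine _ c0 gy).
- move=> s t st /=; have -> // : z s = z t.
  apply/funext => i; rewrite /ypts /with0; case: unliftP => // j _.
  exact: (@dep_blk R d _ k j id (ltn_ord j) s t st).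
- apply/measurable_EFinP; apply: measurable_funM.
    by apply: measurable_bool_nat; exact: (measurable_good (@vmeas_ypts R d k)).
  by apply: (measurableT_comp mF); exact: (measurable_crad (@vmeas_ypts R d k)).
- by move=> s; rewrite lee_fin mulr_ge0.
Qed.

Let om := omega R d.
Let om0 : (0 < om)%R. Proof. exact: omega_gt0. Qed.

Let mgood : measurable_fun setT (fun y : rseq R => (good (z y))%:R : R)%R.
Proof. by apply: measurable_bool_nat; exact: (measurable_good (@vmeas_ypts R d k)). Qed.

Let mcrad : measurable_fun setT (fun y : rseq R => crad (z y)).
Proof. exact: (measurable_crad (@vmeas_ypts R d k)). Qed.

Let root_pos (v : R) : (0 < v)%R -> exists c : R, (0 < c)%R /\ (c ^+ d = v)%R.
Proof.
move=> v0; exists (v `^ (d%:R)^-1)%R; split; first exact: powR_gt0.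
by rewrite -powR_mulrn ?powR_ge0// -powRrM mulVf ?powRr1 ?(ltW v0)// pnatr_eq0 -lt0n.
Qed.

Definition simplex_integral : \bar R :=
  \int[lebs R (k * d)]_y ((good (z y))%:R * expR (- (om * crad (z y) ^+ d)))%:E.

Definition cut_integral (v : R) : \bar R :=
  \int[lebs R (k * d)]_y
    ((good (z y))%:R * ((crad (z y) ^+ d <= v)%R%:R * expR (- (om * crad (z y) ^+ d))))%:E.

Lemma simplex_integral_scale (v : R) : (0 < v)%R ->
  (v ^+ k)%:E * \int[lebs R (k * d)]_y ((good (z y))%:R * expR (- (om * crad (z y) ^+ d * v)))%:E =
  simplex_integral.
Proof.
move=> v0; have [c [c0 cv]] := root_pos v0.
have mF : measurable_fun setT (fun x : R => expR (- (om * x ^+ d))).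
  by apply: measurableT_comp => //; apply: measurable_funN; exact: measurable_funM.
have := @integral_good_scale c _ c0 mF (fun x => expR_ge0 _).
rewrite /simplex_integral => <-; rewrite mulnC exprM cv; congr (_ * _).
apply: eq_integral => y _; congr (_ * expR _)%:E.
by rewrite exprMn cv [(v * _)%R]mulrC mulrA.
Qed.

(** A homothety of ratio c with c^d = v has Jacobian v^k, absorbs v in the exponent and turns the
    constraint of radius at most 1 into radius^d <= v. *)
Lemma cut_integral_scale (v : R) : (0 < v)%R ->
  (v ^+ k)%:E * \int[lebs R (k * d)]_y ((good (z y))%:R *
    ((crad (z y) <= 1)%R%:R * expR (- (om * crad (z y) ^+ d * v))))%:E = cut_integral v.
Proof.
move=> v0; have [c [c0 cv]] := root_pos v0.
have mF : measurable_fun setT (fun x : R => ((x ^+ d <= v)%R%:R * expR (- (om * x ^+ d)))%R).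
  apply: measurable_funM; last first.
    by apply: measurableT_comp => //; apply: measurable_funN; exact: measurable_funM.
  by apply: measurable_bool_nat; exact: measurable_fun_ler.
have := @integral_good_scale c _ c0 mF.
rewrite /cut_integral => <-; last by move=> x; rewrite mulr_ge0// expR_ge0.
rewrite mulnC exprM cv; congr (_ * _).
apply: eq_integral => y _; congr (_ * (_%:R * expR _))%:E.
  by congr nat_of_bool; rewrite exprMn cv ger_pMr// expr_le1// crad_ge0.
by rewrite exprMn cv [(v * _)%R]mulrC mulrA.
Qed.

Section density.
Variable f : 'rV[R]_d -> R.
Hypothesis bf : bounded_density f.
Let f0 := density_ge0 bf.
Local Hint Resolve f0 : core.

Let mf : measurable_fun setT (fun s : rseq R => f (blk d 0 s)).
Proof. by apply: (measurable_density bf); exact: vmeas_blk. Qed.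

Let mf2 : measurable_fun setT (fun p : rseq R * rseq R => f (blk d 0 p.1)).
Proof. exact: (measurableT_comp mf). Qed.

Definition simplex_kernel (lam : R) (cut : (nat -> R) -> bool) (p : rseq R * rseq R) : R :=
  ((good (z p.2))%:R * ((cut p.2)%:R *
    expR (- (lam * (om * crad (z p.2) ^+ d) * f (blk d 0 p.1)))))%R.

Lemma simplex_kernel_ge0 lam cut p : (0 <= simplex_kernel lam cut p)%R.
Proof. by rewrite !mulr_ge0 ?expR_ge0. Qed.

Section kernel.
Variables (lam : R) (cut : (nat -> R) -> bool).
Hypothesis mcut : measurable_fun setT (cut : rseq R -> bool).

Lemma measurable_simplex_kernel : measurable_fun setT (simplex_kernel lam cut).
Proof.
apply: measurable_funM; first exact: (measurableT_comp mgood).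
have mcut' : measurable_fun setT (fun y : rseq R => (cut y)%:R : R)%R by exact: measurable_bool_nat.
apply: measurable_funM; first exact: (measurableT_comp mcut').
apply: measurableT_comp => //; apply: measurable_funN; apply: measurable_funM => //.
apply: measurable_funM => //; apply: measurable_funM => //; apply: measurable_funX.
exact: (measurableT_comp mcrad).
Qed.

Let K (p : rseq R * rseq R) : R := (f (blk d 0 p.1) ^+ k.+1 * simplex_kernel lam cut p)%R.

Let mK : measurable_fun setT K.
Proof. by apply: measurable_funM; [exact: measurable_funX|exact: measurable_simplex_kernel]. Qed.

Let K0 p : (0 <= K p)%R.
Proof. by rewrite mulr_ge0 ?simplex_kernel_ge0// exprn_ge0. Qed.

Lemma limit_integral_iint : limit_integral k f lam cut =
  iint d (fun s => iint (k * d) (fun t => (f (blk d 0 s) ^+ k.+1 * simplex_kernel lam cut (s, t))%:E)).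
Proof.
have := @iint_iint d (k * d) K mK K0; rewrite /K /= => ->.
rewrite (integral_swap _ _ mK K0).
apply: eq_integral => y _; rewrite -ge0_integralZl//; last 2 first.
- apply/measurable_EFinP; apply: measurable_funM; first exact: measurable_funX.
  by apply: measurableT_comp => //; apply: measurable_funN; exact: measurable_funM.
- by move=> x _; rewrite lee_fin mulr_ge0 ?expR_ge0// exprn_ge0.
apply: eq_integral => x _; rewrite -EFinM /K /simplex_kernel /=; congr EFin.
by rewrite -mulnb natrM; ring.
Qed.

Lemma limit_integral_swap : limit_integral k f lam cut = \int[lebs R d]_x
  ((f (blk d 0 x) ^+ k.+1)%:E * \int[lebs R (k * d)]_y (simplex_kernel lam cut (x, y))%:E).
Proof.
rewrite limit_integral_iint; have := @iint_iint d (k * d) K mK K0; rewrite /K /= => ->.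
apply: eq_integral => x _.
under eq_integral do rewrite EFinM.
rewrite ge0_integralZl//.
- apply/measurable_EFinP.
  exact: (measurableT_comp measurable_simplex_kernel (measurable_pair1 _)).
- by move=> y _; rewrite lee_fin simplex_kernel_ge0.
- by rewrite lee_fin exprn_ge0.
Qed.

Lemma measurable_simplex_kernel_integral : measurable_fun setT (fun x : rseq R =>
  (f (blk d 0 x) ^+ k.+1)%:E * \int[lebs R (k * d)]_y (simplex_kernel lam cut (x, y))%:E).
Proof.
apply: emeasurable_funM; first by apply/measurable_EFinP; exact: measurable_funX.
apply: (@measurable_integral_lebs R _ (rseq R) (k * d) (EFin \o simplex_kernel lam cut)) => [|p].
  apply/measurable_EFinP; exact: measurable_simplex_kernel.
by rewrite lee_fin simplex_kernel_ge0.
Qed.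

End kernel.

Lemma simplex_integral_lty : simplex_integral < +oo.
Proof. exact: good_expR_lty. Qed.

(** Where f x > 0, a homothety of ratio c with c^d = f x absorbs f(x)^k and f x in the exponent. The
    inner integral then no longer depends on x, and the remaining factor f x integrates to 1. *)
Lemma limit_integral_infE : limit_integral k f 1 (fun _ => true) = simplex_integral.
Proof.
rewrite limit_integral_swap//.
have G0 : 0 <= simplex_integral.
  by apply: integral_ge0 => y _; rewrite lee_fin mulr_ge0 ?expR_ge0.
transitivity (\int[lebs R d]_x (simplex_integral * (f (blk d 0 x))%:E)); last first.
  rewrite ge0_integralZl//.
  - by rewrite integral_density// mule1.
  - exact/measurable_EFinP.
  - by move=> x _; rewrite lee_fin.
apply: eq_integral => x _; have [fx|fx] := ltP 0%R (f (blk d 0 x)); last first.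
  have -> : f (blk d 0 x) = 0%R by apply/eqP; rewrite eq_le fx f0.
  by rewrite expr0n /= mul0e mule0.
rewrite -(simplex_integral_scale fx) exprS EFinM -muleA muleC; congr (_ * _ * _).
by apply: eq_integral => y _; rewrite /simplex_kernel /= !mul1r.
Qed.

(** The same homothety with c^d = l f x, which leaves l only in the cutoff on the radius; this form
    is suited to letting l tend to infinity. *)
Lemma limit_integral_finE (l : R) : (0 < l)%R ->
  (l ^+ k)%:E * limit_integral k f l (fun y => (crad (z y) <= 1)%R) =
  \int[lebs R d]_x ((f (blk d 0 x))%:E * cut_integral (l * f (blk d 0 x))).
Proof.
move=> l0.
have mcut : measurable_fun setT ((fun y => (crad (z y) <= 1)%R) : rseq R -> bool).
  exact: measurable_fun_ler.
rewrite limit_integral_swap// -ge0_integralZl//; last 3 first.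
- exact: measurable_simplex_kernel_integral.
- move=> x _; rewrite mule_ge0 ?lee_fin ?exprn_ge0//; apply: integral_ge0 => y _.
  by rewrite lee_fin simplex_kernel_ge0.
- by rewrite lee_fin exprn_ge0// ltW.
apply: eq_integral => x _; have [fx|fx] := ltP 0%R (f (blk d 0 x)); last first.
  have -> : f (blk d 0 x) = 0%R by apply/eqP; rewrite eq_le fx f0.
  by rewrite expr0n /= !mul0e mule0.
rewrite -(cut_integral_scale (mulr_gt0 l0 fx)) exprS exprMn !muleA -!EFinM.
rewrite mulrCA mulrA; congr (_ * _).
by apply: eq_integral => y _; rewrite /simplex_kernel /=; congr (_ * (_ * expR _))%:E; ring.
Qed.

Lemma gamma_fin_limit (l : R) :
  gamma_fin k f l = ((k.+1)`!%:R^-1)%:E * ((l ^+ k)%:E *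
    limit_integral k f l (fun y => (crad (z y) <= 1)%R)).
Proof.
rewrite /gamma_fin muleA -EFinM mulrC; congr (_ * _).
rewrite limit_integral_iint; last by exact: measurable_fun_ler.
rewrite /intRd /intRdm; congr iint; apply/funext => s; congr iint; apply/funext => t.
have := h_good t; have := @R0_crad t; rewrite /h1 /simplex_kernel /=.
rewrite -[blk d 0 s]/(\row_(j < d) s j) /blk => hR ->.
(* [R0] is identified with [crad] on good simplices; on the others both integrands vanish. *)
case: (good _) hR => [hR|_]; last by rewrite !mul0r mulr0 mul0r.
rewrite (hR isT) !mul1r -mulrA; congr (_ * (_ * expR _))%:E; last by rewrite !mulrA.
by case: ifP.
Qed.

End density.

Lemma gamma_infE : @gamma_inf R d k = ((k.+1)`!%:R^-1)%:E * simplex_integral.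
Proof.
rewrite /gamma_inf /intRdm; congr (_ * _).
transitivity (iint (k * d) (fun y => ((good (z y))%:R * expR (- (om * crad (z y) ^+ d)))%:E)).
  congr iint; apply/funext => y.
  have := h_good y; have := @R0_crad y; rewrite /blk => hR ->.
  have [gy|_] := boolP (good _); last by rewrite !mul0r.
  by rewrite hR.
rewrite iint_lebs//; apply/measurable_EFinP; apply: measurable_funM => //.
apply: measurableT_comp => //; apply: measurable_funN; apply: measurable_funM => //.
exact: measurable_funX.
Qed.

End limit_identification.

(** * The limit of gamma at infinity *)

Section gamma_at_infinity.
Variables (R : realType) (d k : nat) (f : 'rV[R]_d -> R).
Hypothesis d0 : (0 < d)%N.
Hypothesis k0 : (0 < k)%N.
Hypothesis bf : bounded_density f.
Local Open Scope ereal_scope.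
Local Notation z := (@ypts R d k).
Let f0 := density_ge0 bf.
Local Hint Resolve f0 : core.

Let mf : measurable_fun setT (fun s : rseq R => f (blk d 0 s)).
Proof. by apply: (measurable_density bf); exact: vmeas_blk. Qed.

Let mgood : measurable_fun setT (fun y : rseq R => (good (z y))%:R : R)%R.
Proof. by apply: measurable_bool_nat; exact: (measurable_good (@vmeas_ypts R d k)). Qed.

Let mcrad : measurable_fun setT (fun y : rseq R => crad (z y) ^+ d)%R.
Proof. by apply: measurable_funX; exact: (measurable_crad (@vmeas_ypts R d k)). Qed.

Let mexp : measurable_fun setT (fun y : rseq R => expR (- (omega R d * crad (z y) ^+ d))).
Proof. by apply: measurableT_comp => //; apply: measurable_funN; exact: measurable_funM. Qed.

Lemma cut_integral_ge0 v : 0 <= @cut_integral R d k v.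
Proof. by apply: integral_ge0 => y _; rewrite lee_fin !mulr_ge0 ?expR_ge0. Qed.

Lemma simplex_integral_ge0 : 0 <= @simplex_integral R d k.
Proof. by apply: integral_ge0 => y _; rewrite lee_fin !mulr_ge0 ?expR_ge0. Qed.

Let cut_le v y : ((good (z y))%:R * ((crad (z y) ^+ d <= v)%R%:R *
    expR (- (omega R d * crad (z y) ^+ d))) <=
  (good (z y))%:R * expR (- (omega R d * crad (z y) ^+ d)))%R.
Proof. by apply: ler_wpM2l => //; apply: ler_piMl; rewrite ?expR_ge0// lern1 leq_b1. Qed.

Lemma cut_integral_le v : @cut_integral R d k v <= @simplex_integral R d k.
Proof.
apply: le_integral_nomeas => y; first by rewrite lee_fin !mulr_ge0 ?expR_ge0.
by rewrite lee_fin; exact: cut_le.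
Qed.

Lemma simplex_integral_fin_num : @simplex_integral R d k \is a fin_num.
Proof. by rewrite ge0_fin_numE ?simplex_integral_ge0//; exact: simplex_integral_lty. Qed.

Lemma cvg_cut_integral (v : nat -> R) : v n @[n --> \oo] --> +oo%R ->
  @cut_integral R d k (v n) @[n --> \oo] --> @simplex_integral R d k.
Proof.
move=> cv; apply: (@cvg_integral_dominated _ (rseq R) R (lebs R (k * d))
  (fun n y => ((good (z y))%:R * ((crad (z y) ^+ d <= v n)%R%:R *
    expR (- (omega R d * crad (z y) ^+ d))))%:E) _
  (fun y => (good (z y))%:R * expR (- (omega R d * crad (z y) ^+ d)))%R).
- move=> n; apply/measurable_EFinP; apply: measurable_funM => //.
  by apply: measurable_funM => //; apply: measurable_bool_nat; exact: measurable_fun_ler.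
- by move=> n y; rewrite lee_fin !mulr_ge0 ?expR_ge0.
- by apply: nearW => n y; rewrite lee_fin; exact: cut_le.
- exact: measurable_funM.
- exact: simplex_integral_lty.
move=> y; apply: cvg_near_cst.
move: cv => /cvgryPge /(_ (crad (z y) ^+ d)%R).
by apply: filterS => n ->; rewrite mul1r.
Qed.

Definition mean_cut_integral (l : R) : \bar R :=
  \int[lebs R d]_x ((f (blk d 0 x))%:E * @cut_integral R d k (l * f (blk d 0 x))).

Lemma mean_cut_integral_ge0 l : 0 <= mean_cut_integral l.
Proof. by apply: integral_ge0 => x _; rewrite mule_ge0 ?lee_fin// cut_integral_ge0. Qed.

Let G := fine (@simplex_integral R d k).
Let GE : @simplex_integral R d k = G%:E.
Proof. by rewrite fineK// simplex_integral_fin_num. Qed.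

Let G0 : (0 <= G)%R. Proof. by rewrite -lee_fin -GE simplex_integral_ge0. Qed.

Let integral_Gf : \int[lebs R d]_x (G * f (blk d 0 x))%:E = G%:E.
Proof.
under eq_integral do rewrite EFinM.
rewrite ge0_integralZl//; first by rewrite integral_density// mule1.
- exact/measurable_EFinP.
- by move=> x _; rewrite lee_fin.
Qed.

Let mean_cut_le l x : (f (blk d 0 x))%:E * @cut_integral R d k (l * f (blk d 0 x)) <=
  (G * f (blk d 0 x))%:E.
Proof.
have -> : (G * f (blk d 0 x))%:E = (f (blk d 0 x))%:E * G%:E by rewrite muleC.
by apply: lee_wpmul2l; rewrite ?lee_fin// -GE; exact: cut_integral_le.
Qed.

Lemma mean_cut_integral_fin_num l : mean_cut_integral l \is a fin_num.
Proof.
rewrite ge0_fin_numE ?mean_cut_integral_ge0//; apply: (@le_lt_trans _ _ G%:E); last exact: ltry.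
rewrite -integral_Gf; apply: le_integral_nomeas => x; last exact: mean_cut_le.
by rewrite mule_ge0 ?lee_fin// cut_integral_ge0.
Qed.

(** Where f x > 0 the cutoff u_n f x tends to infinity and the cut integral tends to the full one;
    where f x = 0 the integrand is 0. A multiple of f dominates. *)
Lemma cvg_mean_cut_integral (u : nat -> R) : u n @[n --> \oo] --> +oo%R ->
  mean_cut_integral (u n) @[n --> \oo] --> @simplex_integral R d k.
Proof.
move=> cu; rewrite GE -integral_Gf.
apply: (@cvg_integral_dominated _ (rseq R) R (lebs R d)
  (fun n x => (f (blk d 0 x))%:E * @cut_integral R d k (u n * f (blk d 0 x))) _
  (fun x => G * f (blk d 0 x))%R).
- move=> n; apply: emeasurable_funM; first exact/measurable_EFinP.
  apply: (@measurable_integral_lebs R _ (rseq R) (k * d) (fun p =>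
    ((good (z p.2))%:R * ((crad (z p.2) ^+ d <= u n * f (blk d 0 p.1))%R%:R *
      expR (- (omega R d * crad (z p.2) ^+ d))))%:E)) => [|p]; last first.
    by rewrite lee_fin !mulr_ge0 ?expR_ge0.
  apply/measurable_EFinP; apply: measurable_funM; first exact: (measurableT_comp mgood).
  apply: measurable_funM; last exact: (measurableT_comp mexp).
  apply: measurable_bool_nat; apply: measurable_fun_ler.
    exact: (measurableT_comp mcrad).
  by apply: measurable_funM => //; exact: (measurableT_comp mf).
- by move=> n x; rewrite mule_ge0 ?lee_fin// cut_integral_ge0.
- by apply: nearW => n x; exact: mean_cut_le.
- exact: measurable_funM.
- by rewrite integral_Gf ltry.
move=> x; have -> : (G * f (blk d 0 x))%:E = (f (blk d 0 x))%:E * @simplex_integral R d k.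
  by rewrite muleC GE.
have [fx|fx] := ltP 0%R (f (blk d 0 x)); last first.
  have -> : f (blk d 0 x) = 0%R by apply/eqP; rewrite eq_le fx f0.
  by rewrite mul0e; under eq_fun do rewrite mul0e; exact: cvg_cst.
apply: cvgeZl => //; apply: cvg_cut_integral.
apply/cvgryPge => A; have /cvgryPge /(_ (A / f (blk d 0 x))%R) := cu.
by apply: filterS => n; rewrite ler_pdivrMr.
Qed.

Lemma cvg_gamma_fin : gamma_fin k f l @[l --> +oo%R] --> @gamma_inf R d k.
Proof.
rewrite gamma_infE//.
have cm : mean_cut_integral l @[l --> +oo%R] --> @simplex_integral R d k.
  rewrite GE; apply: cvg_EFin; first by apply: nearW => l; exact: mean_cut_integral_fin_num.
  (* Dominated convergence concerns sequences; the limit along real l is tested on all sequences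
     tending to infinity, after passing to finite values. *)
  apply/cvg_pinftyP => u cu.
  have := cvg_mean_cut_integral cu; rewrite GE; exact: fine_cvg.
have cm2 : (((k.+1)`!%:R^-1)%:E : \bar R) * mean_cut_integral l @[l --> +oo%R] -->
    ((k.+1)`!%:R^-1)%:E * @simplex_integral R d k.
  by apply: cvgeZl.
apply: cvg_trans cm2; apply: near_eq_cvg.
near=> l; rewrite gamma_fin_limit// limit_integral_finE//.
Unshelve. all: by end_near. Qed.

End gamma_at_infinity.

(** * The two mean counts *)

Section mean_counts.
Variables (R : realType) (d k : nat) (f : 'rV[R]_d -> R) (r : nat -> R) (lam : \bar R).
Hypothesis d0 : (0 < d)%N.
Hypothesis k0 : (0 < k)%N.
Hypothesis bf : bounded_density f.
Hypothesis r0 : forall n, 0 < r n.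
Hypothesis cr : r n @[n --> \oo] --> (0 : R).
Hypothesis lam0 : (0 < lam)%E.
Hypothesis cnr : (n%:R * r n ^+ d)%:E @[n --> \oo] --> lam.
Hypothesis cf : lam = +oo%E -> lower_bounded f /\ convex_set (supp f).
Local Open Scope ereal_scope.

(** Here [kap n] is the combinatorial factor divided by n^(k+1): the ratio C(n, k+1) / n^(k+1) for
    the sample, and the constant 1 / (k+1)! for the Poisson process. The remaining power n^k
    normalises the integral over simplices. *)
Lemma cvg_mean_count (Q : nat -> R -> R) (E : nat -> \bar R) (kap : nat -> R) :
  exp_law Q ->
  kap n @[n --> \oo] --> ((k.+1)`!%:R^-1 : R)%R ->
  (forall n, (0 < n)%N -> (n%:R^-1)%:E * E n =
     (kap n)%:E * ((n%:R ^+ k)%:E * palm_gen k f (r n) (Q n))) ->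
  (n%:R^-1)%:E * E n @[n --> \oo] --> gamma k f lam.
Proof.
move=> lawQ ckap EE.
have fact0 : ((k.+1)`!%:R^-1 != 0 :> R)%R by rewrite invr_neq0// pnatr_eq0 -lt0n fact_gt0.
have key L : (n%:R ^+ k)%:E * palm_gen k f (r n) (Q n) @[n --> \oo] --> L ->
    (n%:R^-1)%:E * E n @[n --> \oo] --> ((k.+1)`!%:R^-1)%:E * L.
  move=> cL; have : (kap n)%:E * ((n%:R ^+ k)%:E * palm_gen k f (r n) (Q n)) @[n --> \oo] -->
      ((k.+1)`!%:R^-1)%:E * L.
    apply: cvgeM => //; first by rewrite mule_defE eqe (negbTE fact0) /= andbF.
    by apply: cvg_EFin => //; exact: nearW.
  by apply: cvg_trans; apply: near_eq_cvg; exists 1%N => // n /= n0; rewrite EE.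
move: lam0 cnr cf; case: lam => [l||]//= l0 cl cf'.
  rewrite gamma_fin_limit//; apply: key; apply: palm_limit_fin => //.
  exact: (fine_cvg cl).
have [lf cs] := cf' erefl; rewrite gamma_infE// -(limit_integral_infE k d0 bf); apply: key.
exact: palm_limit_inf.
Qed.

Lemma cvg_mean_binomial : (n%:R^-1)%:E * ENbin k f (r n) n @[n --> \oo] --> gamma k f lam.
Proof.
apply: (cvg_mean_count (binomial_law R k.+1) (kap := fun n => ('C(n, k.+1)%:R / n%:R ^+ k.+1)%R)).
  rewrite -[X in _ --> X]mulr1.
  have -> : (fun n => 'C(n, k.+1)%:R / n%:R ^+ k.+1 : R)%R =
      (fun n => (k.+1)`!%:R^-1 * ((n ^_ k.+1)%:R / n%:R ^+ k.+1))%R.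
    apply/funext => n; rewrite -bin_ffact natrM -[X in (_ = _ * X)%R]mulrA [RHS]mulrCA mulKf//.
  apply: cvgMr; exact: ffact_ratio_cvg.
move=> n n0; rewrite (ENbin_palm k d0 bf) !muleA -!EFinM; congr (_%:E * _).
have nR : (n%:R != 0 :> R)%R by rewrite pnatr_eq0 -lt0n.
by rewrite exprSr; field; rewrite nR expf_neq0.
Qed.

Lemma cvg_mean_poisson : (n%:R^-1)%:E * ENpois k f (r n) n @[n --> \oo] --> gamma k f lam.
Proof.
apply: (cvg_mean_count (poisson_law R) (kap := fun _ => ((k.+1)`!%:R^-1)%R)).
  exact: cvg_cst.
move=> n n0; rewrite (ENpois_palm k d0 bf) !muleA -!EFinM; congr (_%:E * _).
have nR : (n%:R != 0 :> R)%R by rewrite pnatr_eq0 -lt0n.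
by rewrite exprSr; field; rewrite nR pnatr_eq0 -lt0n fact_gt0.
Qed.

End mean_counts.

Theorem theorem3p5 (R : realType) (d : nat) (f : 'rV[R]_d -> R)
    (r : nat -> R) (lam : \bar R) (k : nat) :
  (1 <= d)%N ->
  bounded_density f ->
  (forall n, 0 < r n) ->
  r n @[n --> \oo] --> 0 ->
  (0 < lam)%E ->
  ((n%:R * r n ^+ d)%:E @[n --> \oo] --> lam) ->
  (lam = +oo%E -> lower_bounded f /\ convex_set (supp f)) ->
  (1 <= k <= d)%N ->
  ((n%:R^-1)%:E * ENbin k f (r n) n)%E @[n --> \oo] --> gamma k f lam /\
  ((n%:R^-1)%:E * ENpois k f (r n) n)%E @[n --> \oo] --> gamma k f lam /\
  gamma_fin k f l @[l --> +oo] --> @gamma_inf R d k.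
Proof.
move=> d0 bf r0 cr lam0 cnr cf /andP[k0 _]; split; [|split].
- exact: cvg_mean_binomial.
- exact: cvg_mean_poisson.
- exact: cvg_gamma_fin.
Qed.
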